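(* Let $K\ge 1$, $0<p\le\infty$ and $\beta>0$, and let $f=u+iv$ be a harmonic $K$-quasiregular mapping in the unit disk $\mathbb{D}$, where $u$ and $v$ are the real and imaginary parts of $f$. If $$M_p(r,u)=O\left(\frac{1}{(1-r)^{\beta}}\right)\quad (r\to 1^-),$$ then $$M_p(r,v)=O\left(\frac{1}{(1-r)^{\beta}}\right)\quad (r\to 1^-).$$
   Context: $\mathbb{D}=\{z\in\mathbb{C}:|z|<1\}$. For a (real- or complex-valued) function $\varphi$ harmonic in $\mathbb{D}$ and $0<r<1$, the integral means are $$M_p(r,\varphi)=\left(\frac{1}{2\pi}\int_0^{2\pi}|\varphi(re^{i\theta})|^p\,d\theta\right)^{1/p}\ (0<p<\infty),\qquad M_\infty(r,\varphi)=\sup_{|z|=r}|\varphi(z)|.$$ A complex-valued function $f=u+iv$ is harmonic in $\mathbb{D}$ if $u$ and $v$ are real-valued harmonic functions in $\mathbb{D}$. Every such $f$ has a unique representation $f=h+\overline{g}$ with $h,g$ analytic in $\mathbb{D}$ and $g(0)=0$. For $K\ge1$, a sense-preserving harmonic function $f=h+\overline{g}$ in $\mathbb{D}$ is called $K$-quasiregular if its complex dilatation $\omega=g'/h'$ satisfies $|\omega(z)|\le k<1$ for all $z\in\mathbb{D}$, where $k=\frac{K-1}{K+1}$. Sense-preserving is meant in the usual sense that $h'\not\equiv0$ and $\omega=g'/h'$ is analytic in $\mathbb{D}$ (after removing removable singularities at zeros of $h'$) with $|\omega|<1$; no injectivity of $f$ is assumed. *)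

(* Defs.v *)
From Stdlib Require Import Reals.
From Coquelicot Require Import Coquelicot.

Open Scope R_scope.

Definition unit_disk (z : C) : Prop := Cmod z < 1.

Definition harmonic (u : C -> R) : Prop :=
  forall x y : R, unit_disk (x, y) ->
    ex_diff_n (fun s t => u (s, t)) 2 x y /\
    Derive_n (fun s => u (s, y)) 2 x + Derive_n (fun t => u (x, t)) 2 y = 0.

Definition complex_harmonic (f : C -> C) : Prop :=
  harmonic (fun z => Re (f z)) /\ harmonic (fun z => Im (f z)).

(** Complex differentiability at every point. [C_derive] is a total function,
    equal to the complex derivative wherever the latter exists; below it is only
    applied to functions that are analytic in the disk. *)
Definition analytic (h : C -> C) : Prop :=
  forall z : C, unit_disk z ->
    @ex_derive C_AbsRing C_NormedModule h z.

Definition canonical_decomposition (f h g : C -> C) : Prop :=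
  analytic h /\ analytic g /\ g (RtoC 0) = RtoC 0 /\
  forall z : C, unit_disk z -> f z = Cplus (h z) (Cconj (g z)).

(** [w] is the analytic function [g' / h'], with its removable singularities at
    the zeros of [h'] removed: analyticity determines [w] at these zeros, which
    are isolated since [h'] is not identically zero. *)
Definition complex_dilatation (h g w : C -> C) : Prop :=
  (exists z : C, unit_disk z /\ C_derive h z <> RtoC 0) /\
  analytic w /\
  forall z : C, unit_disk z -> C_derive h z <> RtoC 0 ->
    w z = Cdiv (C_derive g z) (C_derive h z).

Definition sense_preserving (h g w : C -> C) : Prop :=
  complex_dilatation h g w /\ forall z : C, unit_disk z -> Cmod (w z) < 1.

(** The decomposition and the dilatation are unique in the disk, so
    quantifying them existentially is harmless. *)
Definition harmonic_quasiregular (K : R) (f : C -> C) : Prop :=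
  complex_harmonic f /\
  exists h g w : C -> C,
    canonical_decomposition f h g /\ sense_preserving h g w /\
    forall z : C, unit_disk z -> Cmod (w z) <= (K - 1) / (K + 1).

(** [Rpower 0 p] is [1], whereas [0 ^ p = 0] is needed here for [0 < p]. *)
Definition rpow (x p : R) : R :=
  if Req_EM_T x 0 then 0 else Rpower x p.

Definition circle_point (r theta : R) : C := (r * cos theta, r * sin theta).

(** The exponent ranges over [0 < p <= p_infty]; the value at [m_infty] is
    irrelevant. *)
Definition integral_mean (p : Rbar) (r : R) (u : C -> R) : R :=
  match p with
  | Finite q =>
      rpow (/ (2 * PI) *
            RInt (fun theta => rpow (Rabs (u (circle_point r theta))) q)
                 0 (2 * PI)) (/ q)
  | p_infty =>
      real (Lub_Rbar (fun y => exists z : C, Cmod z = r /\ y = Rabs (u z)))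
  | m_infty => 0
  end.

Definition bigO_at_left_1 (F G : R -> R) : Prop :=
  exists A : R, at_left 1 (fun r => Rabs (F r) <= A * Rabs (G r)).

(* Main.v *)
Require Import Defs.
From Stdlib Require Import Reals Lra Classical ClassicalEpsilon.
From Coquelicot Require Import Coquelicot.

Open Scope R_scope.

(** Write [f = h + conj g] and put [F = h + g], [G = h - g], so that [u = Re F]
    and [v = Im G]. From [|g'| <= k |h'|] one gets
    [|G'| <= (1 + k) |h'| = K (1 - k) |h'| <= K |F'|]: the gradient of [v] is
    pointwise at most [K] times the gradient of [u]
    ([quasiregular_gradient_bound]). At the zeros of [h'] the dilatation gives no
    information, and the bound is reached there by continuity, since by the
    identity theorem these zeros have no interior.

    It remains to pass from [u] to its gradient, which costs a factor
    [1 / (1 - r)], and to integrate the gradient of [v] along radii, which gains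
    this factor back because [beta > 0]. To treat [p < 1] together with
    [p >= 1], both passages are made locally. In the coordinate [log z] circles
    become vertical lines, the disk becomes the left half-plane, and the distance
    to the boundary becomes [tau = - Re (log z)], comparable with [1 - r]. On a
    square of side comparable with [tau] the gradient is bounded by
    [sup |u| / tau] ([gradient_estimate]), and [sup |u|^p] by the mean of
    [|u|^p] over a larger square ([local_Lp_bound]). Both rest on a weighted mean
    value property over squares ([area_mean_value]), which is proved from the
    Cauchy-Riemann equations.

    Hence the increment of [v] from [- tau] to [- 7 tau / 8] is at most a constant
    times the [L^p] mean of [u] over a square ([one_step]). Integrating the [p]-th
    power over the angle turns the means over squares into means over circles, by
    Fubini's theorem and periodicity, and with
    [(a + b)^p <= (1 + delta) a^p + C b^p] gives
    [B (7 tau / 8) <= (1 + delta) B tau + C tau^(- beta p)] for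
    [B tau = int |v|^p]. With [delta] small this recursion is solved by
    [B tau = O (tau^(- beta p))] ([power_growth_of_recursion]). For [p = oo] the
    same recursion holds at each angle. *)

(** * Powers with real exponents *)

Lemma rpow_pos : forall x p, 0 < x -> rpow x p = Rpower x p.
Proof. intros x p Hx; unfold rpow; destruct (Req_EM_T x 0); [lra|reflexivity]. Qed.

Lemma rpow_0 : forall p, rpow 0 p = 0.
Proof. intros p; unfold rpow; destruct (Req_EM_T 0 0); [reflexivity|lra]. Qed.

Lemma Rpower_gt_0 : forall x p, 0 < Rpower x p.
Proof. intros; apply exp_pos. Qed.

Lemma rpow_ge_0 : forall x p, 0 <= rpow x p.
Proof.
  intros x p; unfold rpow; destruct (Req_EM_T x 0); [lra|].
  left; apply Rpower_gt_0.
Qed.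

Lemma rpow_gt_0 : forall x p, 0 < x -> 0 < rpow x p.
Proof. intros; rewrite rpow_pos by assumption; apply Rpower_gt_0. Qed.

Lemma rpow_le : forall x y p, 0 < p -> 0 <= x <= y -> rpow x p <= rpow y p.
Proof.
  intros x y p Hp [Hx Hxy].
  destruct (Req_dec x 0) as [->|Hx0].
  - rewrite rpow_0; apply rpow_ge_0.
  - rewrite !rpow_pos by lra. apply Rle_Rpower_l; lra.
Qed.

Lemma rpow_mult : forall x y p, 0 <= x -> 0 <= y -> rpow (x * y) p = rpow x p * rpow y p.
Proof.
  intros x y p Hx Hy.
  destruct (Req_dec x 0) as [->|Hx0]; [rewrite Rmult_0_l, rpow_0; ring|].
  destruct (Req_dec y 0) as [->|Hy0]; [rewrite Rmult_0_r, rpow_0; ring|].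
  rewrite !rpow_pos by (try apply Rmult_lt_0_compat; lra).
  symmetry; apply Rpower_mult_distr; lra.
Qed.

Lemma rpow_rpow : forall x p q, 0 <= x -> rpow (rpow x p) q = rpow x (p * q).
Proof.
  intros x p q Hx.
  destruct (Req_dec x 0) as [->|Hx0]; [now rewrite !rpow_0|].
  rewrite (rpow_pos (rpow x p)) by (apply rpow_gt_0; lra).
  rewrite !rpow_pos by lra. apply Rpower_mult.
Qed.

Lemma rpow_1 : forall x, 0 <= x -> rpow x 1 = x.
Proof.
  intros x Hx. destruct (Req_dec x 0) as [->|Hx0]; [apply rpow_0|].
  rewrite rpow_pos by lra; apply Rpower_1; lra.
Qed.

Lemma rpow_one : forall p, rpow 1 p = 1.
Proof. intros p. rewrite rpow_pos by lra. unfold Rpower. rewrite ln_1, Rmult_0_r. apply exp_0. Qed.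

Lemma rpow_root : forall x p, p <> 0 -> 0 <= x -> rpow (rpow x p) (/ p) = x.
Proof. intros x p Hp Hx. rewrite rpow_rpow by assumption. rewrite Rinv_r by assumption. now apply rpow_1. Qed.

Lemma rpow_root_inv : forall x p, p <> 0 -> 0 <= x -> rpow (rpow x (/ p)) p = x.
Proof. intros x p Hp Hx. rewrite rpow_rpow by assumption. rewrite Rinv_l by assumption. now apply rpow_1. Qed.

Lemma rpow_inv : forall x p, 0 < x -> rpow (/ x) p = / rpow x p.
Proof.
  intros x p Hx.
  assert (H : rpow (/ x) p * rpow x p = 1).
  { rewrite <- rpow_mult by (try (left; apply Rinv_0_lt_compat); lra).
    rewrite Rinv_l by lra. apply rpow_one. }
  pose proof (rpow_gt_0 x p Hx). apply Rmult_eq_reg_r with (rpow x p); [|lra].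
  rewrite H, Rinv_l; lra.
Qed.

Lemma rpow_abs_continuous : forall p, 0 < p -> forall x, continuous (fun x => rpow (Rabs x) p) x.
Proof.
  intros p Hp x.
  destruct (Req_dec x 0) as [->|Hx].
  - apply (filterlim_locally (F := locally 0)). intros eps.
    exists (mkposreal (rpow eps (/ p)) (rpow_gt_0 _ _ (cond_pos eps))). intros y Hy.
    change (Rabs (rpow (Rabs y) p - rpow (Rabs 0) p) < eps).
    change (Rabs (y - 0) < rpow eps (/ p)) in Hy.
    rewrite Rabs_R0, rpow_0. rewrite Rminus_0_r in *.
    rewrite Rabs_pos_eq by apply rpow_ge_0.
    destruct (Req_dec y 0) as [->|Hy0]; [rewrite Rabs_R0, rpow_0; apply cond_pos|].
    pose proof (Rabs_pos_lt _ Hy0).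
    rewrite rpow_pos by assumption.
    rewrite <- (rpow_root_inv eps p) by (try (pose proof (cond_pos eps)); lra).
    rewrite (rpow_pos (rpow eps (/ p))) by (apply rpow_gt_0, cond_pos).
    apply Rlt_Rpower_l; lra.
  - pose proof (Rabs_pos_lt _ Hx).
    apply continuous_ext_loc with (fun x => Rpower (Rabs x) p).
    + exists (mkposreal _ H). intros y Hy.
      change (Rabs (y - x) < Rabs x) in Hy.
      symmetry; apply rpow_pos. apply Rabs_pos_lt. intros ->.
      rewrite Rminus_0_l, Rabs_Ropp in Hy; lra.
    + apply (continuous_comp Rabs (fun t => Rpower t p)); [apply continuous_Rabs|].
      apply (ex_derive_continuous (V := R_NormedModule)).
      exists (p * Rpower (Rabs x) (p - 1)). apply is_derive_Reals, derivable_pt_lim_power; assumption.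
Qed.

(** Either [b] is a small fraction of [a] and is absorbed, or [a] is bounded by a
    multiple of [b]; unlike subadditivity or convexity this covers all [p] at once. *)
Lemma rpow_plus_le : forall p delta, 0 < p -> 0 < delta ->
  exists C, 0 < C /\ forall a b, 0 <= a -> 0 <= b ->
    rpow (a + b) p <= (1 + delta) * rpow a p + C * rpow b p.
Proof.
  intros p delta Hp Hd.
  set (eta := rpow (1 + delta) (/ p) - 1).
  assert (Heta : 0 < eta).
  { unfold eta. rewrite rpow_pos by lra.
    assert (Rpower 1 (/ p) < Rpower (1 + delta) (/ p)).
    { apply Rlt_Rpower_l; [now apply Rinv_0_lt_compat|lra]. }
    unfold Rpower at 1 in H. rewrite ln_1, Rmult_0_r, exp_0 in H. lra. }
  assert (Hi : 0 < / eta) by now apply Rinv_0_lt_compat.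
  exists (rpow (1 + / eta) p). split; [apply rpow_gt_0; lra|].
  intros a b Ha Hb. pose proof (rpow_ge_0 a p). pose proof (rpow_ge_0 b p).
  destruct (Rle_dec b (eta * a)) as [H1|H1].
  - apply Rle_trans with (rpow ((1 + eta) * a) p).
    + apply rpow_le; [assumption|split; lra].
    + rewrite rpow_mult by lra. unfold eta at 1.
      replace (1 + (rpow (1 + delta) (/ p) - 1)) with (rpow (1 + delta) (/ p)) by ring.
      rewrite rpow_root_inv by lra.
      assert (0 <= rpow (1 + / eta) p * rpow b p) by (apply Rmult_le_pos; [apply rpow_ge_0|assumption]).
      lra.
  - apply Rle_trans with (rpow ((1 + / eta) * b) p).
    + apply rpow_le; [assumption|split; [lra|]].
      assert (a <= / eta * b).
      { apply Rmult_le_reg_l with eta; [assumption|]. rewrite <- Rmult_assoc, Rinv_r by lra. lra. }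
      lra.
    + rewrite rpow_mult by lra.
      assert (0 <= (1 + delta) * rpow a p) by (apply Rmult_le_pos; lra). lra.
Qed.

(** Trades the first power for the [p]-th one on the range where the two are
    comparable; values below [kap * M] are kept as a small multiple of [M], to be
    absorbed later. *)
Lemma le_rpow_of_bounded : forall p kap Lam t M, 0 < p -> 0 < kap -> 0 <= Lam -> 0 < M ->
  0 <= t <= Lam * M ->
  t <= kap * M + Lam * / rpow kap p * M * (rpow t p / rpow M p).
Proof.
  intros p kap Lam t M Hp Hk HL HM [Ht HtM].
  pose proof (rpow_gt_0 kap p Hk) as Hkp. pose proof (rpow_gt_0 M p HM) as HMp.
  pose proof (rpow_ge_0 t p) as Htp.
  assert (0 < / rpow kap p) by now apply Rinv_0_lt_compat.
  assert (0 < / rpow M p) by now apply Rinv_0_lt_compat.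
  assert (0 <= Lam * / rpow kap p * M * (rpow t p / rpow M p)).
  { unfold Rdiv; repeat apply Rmult_le_pos; lra. }
  destruct (Rle_dec t (kap * M)) as [H2|H2]; [lra|].
  assert (Hr : rpow kap p * rpow M p <= rpow t p).
  { rewrite <- rpow_mult by lra. apply rpow_le; [assumption|]. split; [apply Rmult_le_pos; lra|lra]. }
  assert (1 <= / rpow kap p * (rpow t p / rpow M p)).
  { apply Rmult_le_reg_l with (rpow kap p * rpow M p); [now apply Rmult_lt_0_compat|].
    replace (rpow kap p * rpow M p * (/ rpow kap p * (rpow t p / rpow M p))) with (rpow t p) by (field; lra).
    lra. }
  assert (0 <= Lam * M) by (apply Rmult_le_pos; lra).
  assert (0 <= kap * M) by (apply Rmult_le_pos; lra).
  assert (Lam * M * 1 <= Lam * M * (/ rpow kap p * (rpow t p / rpow M p))) by (apply Rmult_le_compat_l; lra).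
  nra.
Qed.

(** * Integrals depending on parameters *)

Section ContinuityRules.
Context {U : UniformSpace}.
Implicit Types f g : U -> R.

Lemma cont_const : forall (c : R) x, continuous (fun _ : U => c) x.
Proof. intros; apply continuous_const. Qed.

Lemma cont_plus : forall f g x, continuous f x -> continuous g x -> continuous (fun y => f y + g y) x.
Proof. intros f g x; exact (continuous_plus (V := R_NormedModule) f g x). Qed.

Lemma cont_opp : forall f x, continuous f x -> continuous (fun y => - f y) x.
Proof. intros f x; exact (continuous_opp (V := R_NormedModule) f x). Qed.

Lemma cont_minus : forall f g x, continuous f x -> continuous g x -> continuous (fun y => f y - g y) x.
Proof. intros f g x; exact (continuous_minus (V := R_NormedModule) f g x). Qed.

Lemma cont_mult : forall f g x, continuous f x -> continuous g x -> continuous (fun y => f y * g y) x.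
Proof. intros f g x; exact (continuous_mult (K := R_AbsRing) f g x). Qed.

Lemma cont_comp : forall (h : R -> R) f x, continuous h (f x) -> continuous f x -> continuous (fun y => h (f y)) x.
Proof. intros h f x H1 H2; now apply (continuous_comp f h). Qed.

Lemma cont_abs : forall f x, continuous f x -> continuous (fun y => Rabs (f y)) x.
Proof. intros f x; apply cont_comp, continuous_Rabs. Qed.

Lemma cont_pair : forall f g x, continuous f x -> continuous g x ->
  @continuous U (prod_UniformSpace R_UniformSpace R_UniformSpace) (fun y => (f y, g y)) x.
Proof.
  intros f g x Hf Hg. apply (continuous_comp_2 f g (fun a b => (a, b)) x Hf Hg).
  apply continuous_ext with (fun z : R * R => z); [now intros []|apply continuous_id].
Qed.

End ContinuityRules.

Lemma cont_fst : forall {U V W : UniformSpace} (f : U -> V * W) x,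
  continuous f x -> continuous (fun y => fst (f y)) x.
Proof. intros U V W f x H. apply (continuous_comp f fst); [assumption|]. destruct (f x); apply continuous_fst. Qed.

Lemma cont_snd : forall {U V W : UniformSpace} (f : U -> V * W) x,
  continuous f x -> continuous (fun y => snd (f y)) x.
Proof. intros U V W f x H. apply (continuous_comp f snd); [assumption|]. destruct (f x); apply continuous_snd. Qed.

Lemma continuity_2d_pt_continuous : forall (f : R -> R -> R) x y,
  continuity_2d_pt f x y <-> continuous (fun z : R * R => f (fst z) (snd z)) (x, y).
Proof. intros; apply continuity_2d_pt_filterlim. Qed.

(** Dispatches on the head symbol, since applying the rules blindly makes
    higher-order unification search. *)
Ltac cont := match goal with
  | H : ?G |- ?G => exact H
  | |- continuous (fun _ => ?c) _ => apply cont_const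
  | |- continuous (fun x => x) _ => apply continuous_id
  | |- continuous (fun x => @?f x + @?g x) ?p => apply (cont_plus f g p); cont
  | |- continuous (fun x => @?f x - @?g x) ?p => apply (cont_minus f g p); cont
  | |- continuous (fun x => @?f x * @?g x) ?p => apply (cont_mult f g p); cont
  | |- continuous (fun x => - @?f x) ?p => apply (cont_opp f p); cont
  | |- continuous (fun x => Rabs (@?f x)) ?p => apply (cont_abs f p); cont
  | |- continuous (fun x => cos (@?f x)) ?p => apply (cont_comp cos f p); [apply continuous_cos|cont]
  | |- continuous (fun x => sin (@?f x)) ?p => apply (cont_comp sin f p); [apply continuous_sin|cont]
  | |- continuous (fun x => exp (@?f x)) ?p => apply (cont_comp exp f p); [apply continuous_exp|cont]
  | |- continuous (fun x => (@?f x, @?g x)) ?p => apply (cont_pair f g p); cont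
  | |- continuous (fun x => fst (@?f x)) ?p => apply (cont_fst f p); cont
  | |- continuous (fun x => snd (@?f x)) ?p => apply (cont_snd f p); cont
  | _ => idtac
  end.

(** Continuity along a compact interval of integration variables is uniform, so
    it passes to the integral. *)
Lemma continuous_RInt_param : forall {T : UniformSpace} (f : T -> R -> R) a b (p : T),
  a <= b ->
  locally p (fun q => forall t, a <= t <= b -> continuous (fun z : T * R => f (fst z) (snd z)) (q, t)) ->
  continuous (fun q => RInt (f q) a b) p.
Proof.
  intros T f a b p Hab Hc.
  assert (Hex : locally p (fun q => ex_RInt (f q) a b)).
  { apply filter_imp with (2 := Hc). intros q Hq.
    apply (ex_RInt_continuous (V := R_CompleteNormedModule)).
    rewrite Rmin_left, Rmax_right by assumption. intros z Hz.
    apply (continuous_comp_2 (fun _ => q) (fun t => t) f); [apply continuous_const|apply continuous_id|now apply Hq]. }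
  apply (filterlim_locally (F := locally p)). intros eps.
  set (e := eps / (2 * (b - a) + 1)).
  assert (He : 0 < e). { unfold e; apply Rdiv_lt_0_compat; [apply cond_pos|lra]. }
  set (P := fun (t : R) (d : posreal) => a <= t <= b -> forall q t', ball p d q -> Rabs (t' - t) < d ->
    Rabs (f q t' - f p t) < e).
  assert (HP : forall t, exists d, P t d).
  { intros t. destruct (Rle_dec a t) as [H1|H1]; [|exists (mkposreal 1 Rlt_0_1); intros H; lra].
    destruct (Rle_dec t b) as [H2|H2]; [|exists (mkposreal 1 Rlt_0_1); intros H; lra].
    pose proof (locally_singleton _ _ Hc t (conj H1 H2)) as H.
    pose proof (proj1 (filterlim_locally (F := locally (p, t)) _ _) H (mkposreal e He)) as [d Hd].
    exists d. intros _ q t' Hq Ht. apply (Hd (q, t')). split; assumption. }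
  assert (Hdel : exists del : R -> posreal, forall t, P t (del t)).
  { exists (fun t => proj1_sig (constructive_indefinite_description _ (HP t))).
    intros t; exact (proj2_sig (constructive_indefinite_description _ (HP t))). }
  destruct Hdel as [del Hdel].
  destruct (compactness_value_1d a b del) as [d Hd].
  destruct Hex as [d2 Hd2].
  exists (mkposreal (Rmin d d2) (Rmin_stable_in_posreal d d2)). intros q Hq; simpl in Hq.
  assert (Hqd : ball p d q) by (eapply ball_le; [apply Rmin_l|apply Hq]).
  assert (Hqd2 : ball p d2 q) by (eapply ball_le; [apply Rmin_r|apply Hq]).
  assert (Hclose : forall t, a <= t <= b -> Rabs (f q t - f p t) <= 2 * e).
  { intros t Ht. destruct (Rle_dec (Rabs (f q t - f p t)) (2 * e)) as [|Hn]; [assumption|exfalso].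
    apply (Hd t Ht). intros (t0 & Ht0 & Htt & Hdt). apply Hn.
    assert (H1 : Rabs (f q t - f p t0) < e) by (apply (Hdel t0 Ht0); [eapply ball_le; eassumption|assumption]).
    assert (H2 : Rabs (f p t - f p t0) < e) by (apply (Hdel t0 Ht0); [apply ball_center|assumption]).
    replace (f q t - f p t) with ((f q t - f p t0) - (f p t - f p t0)) by ring.
    eapply Rle_trans; [apply Rabs_triang|]. rewrite Rabs_Ropp. lra. }
  assert (Hp2 : ex_RInt (f p) a b) by (apply Hd2, ball_center).
  specialize (Hd2 q Hqd2).
  change (Rabs (RInt (f q) a b - RInt (f p) a b) < eps).
  replace (RInt (f q) a b - RInt (f p) a b) with (RInt (fun t => f q t - f p t) a b)
    by exact (RInt_minus (V := R_CompleteNormedModule) _ _ _ _ Hd2 Hp2).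
  eapply Rle_lt_trans.
  - apply abs_RInt_le_const; [assumption| |exact Hclose].
    exact (ex_RInt_minus (V := R_NormedModule) _ _ _ _ Hd2 Hp2).
  - unfold e. pose proof (cond_pos eps).
    apply Rmult_lt_reg_r with (2 * (b - a) + 1); [lra|].
    replace ((b - a) * (2 * (eps / (2 * (b - a) + 1))) * (2 * (b - a) + 1)) with (2 * (b - a) * eps) by (field; lra).
    lra.
Qed.

Lemma ex_RInt_cont : forall (f : R -> R) a b, a <= b ->
  (forall x, a <= x <= b -> continuous f x) -> ex_RInt f a b.
Proof.
  intros f a b Hab H. apply (ex_RInt_continuous (V := R_CompleteNormedModule)).
  now rewrite Rmin_left, Rmax_right by assumption.
Qed.

Lemma RInt_ext_le : forall (f g : R -> R) a b, a <= b ->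
  (forall x, a <= x <= b -> f x = g x) -> RInt f a b = RInt g a b.
Proof.
  intros f g a b Hab H. apply RInt_ext. rewrite Rmin_left, Rmax_right by assumption.
  intros x Hx; apply H; lra.
Qed.

(** Projection onto an interval: composing with it makes a function continuous
    on a rectangle globally continuous. *)
Definition clamp (a b x : R) : R := Rmax a (Rmin b x).

Lemma clamp_in : forall a b x, a <= b -> a <= clamp a b x <= b.
Proof. intros a b x H; unfold clamp, Rmax, Rmin; destruct (Rle_dec b x), (Rle_dec a _); lra. Qed.

Lemma clamp_id : forall a b x, a <= x <= b -> clamp a b x = x.
Proof. intros a b x H; unfold clamp, Rmax, Rmin; destruct (Rle_dec b x), (Rle_dec a _); lra. Qed.

Lemma clamp_continuous : forall a b x, continuous (clamp a b) x.
Proof.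
  intros a b x.
  apply continuous_ext with (fun x => (a + (b + x - Rabs (b - x)) / 2 + Rabs (a - (b + x - Rabs (b - x)) / 2)) / 2).
  - intros y. unfold clamp, Rmax, Rmin, Rabs.
    destruct (Rle_dec b y), (Rcase_abs (b - y)); try lra;
    destruct (Rle_dec a _), (Rcase_abs _); lra.
  - unfold Rdiv; cont.
Qed.

Definition continuous_on_rect (f : R -> R -> R) (a b c d : R) : Prop :=
  forall x y, a <= x <= b -> c <= y <= d -> continuous (fun z : R * R => f (fst z) (snd z)) (x, y).

Lemma clamp_rect_continuous : forall f a b c d, a <= b -> c <= d -> continuous_on_rect f a b c d ->
  forall p, continuous (fun z : R * R => f (clamp a b (fst z)) (clamp c d (snd z))) p.
Proof.
  intros f a b c d Hab Hcd H p.
  apply (continuous_comp_2 (fun z : R * R => clamp a b (fst z)) (fun z : R * R => clamp c d (snd z)) f).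
  - apply (cont_comp (clamp a b) fst p); [apply clamp_continuous|destruct p; apply continuous_fst].
  - apply (cont_comp (clamp c d) snd p); [apply clamp_continuous|destruct p; apply continuous_snd].
  - apply H; now apply clamp_in.
Qed.

Lemma slice_continuous : forall f a b c d, continuous_on_rect f a b c d ->
  forall x, a <= x <= b -> forall y, c <= y <= d -> continuous (f x) y.
Proof.
  intros f a b c d H x Hx y Hy.
  apply (continuous_comp_2 (fun _ => x) (fun t => t) f); [apply continuous_const|apply continuous_id|now apply H].
Qed.

Lemma ex_RInt_slice : forall f a b c d, c <= d -> continuous_on_rect f a b c d ->
  forall x, a <= x <= b -> ex_RInt (f x) c d.
Proof.
  intros f a b c d Hcd H x Hx. apply ex_RInt_cont; [assumption|].
  now apply slice_continuous with (1 := H).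
Qed.

Lemma ex_RInt_outer : forall f a b c d, a <= b -> c <= d -> continuous_on_rect f a b c d ->
  ex_RInt (fun x => RInt (f x) c d) a b.
Proof.
  intros f a b c d Hab Hcd H.
  apply ex_RInt_ext with (fun x => RInt (fun y => f (clamp a b x) (clamp c d y)) c d).
  - rewrite Rmin_left, Rmax_right by assumption. intros x Hx. apply RInt_ext_le; [assumption|].
    intros y Hy. now rewrite !clamp_id by lra.
  - apply ex_RInt_cont; [assumption|]. intros x _.
    apply (continuous_RInt_param (fun x y => f (clamp a b x) (clamp c d y))); [assumption|].
    apply filter_forall. intros q t _. now apply clamp_rect_continuous.
Qed.

(** Both iterated integrals, as functions of the upper limit of one of the
    variables, vanish at the lower limit and have the same derivative. *)
Lemma fubini : forall f a b c d, a <= b -> c <= d -> continuous_on_rect f a b c d ->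
  RInt (fun x => RInt (fun y => f x y) c d) a b = RInt (fun y => RInt (fun x => f x y) a b) c d.
Proof.
  intros f a b c d Hab Hcd H.
  set (g := fun x y => f (clamp a b x) (clamp c d y)).
  assert (Hg : forall p, continuous (fun z : R * R => g (fst z) (snd z)) p) by now apply clamp_rect_continuous.
  assert (Hg1 : forall x y, continuous (fun x => g x y) x).
  { intros x y. apply (continuous_comp_2 (fun t => t) (fun _ => y) g); [apply continuous_id|apply continuous_const|apply Hg]. }
  assert (Hg2 : forall x y, continuous (g x) y).
  { intros x y. apply (continuous_comp_2 (fun _ => x) (fun t => t) g); [apply continuous_const|apply continuous_id|apply Hg]. }
  transitivity (RInt (fun x => RInt (fun y => g x y) c d) a b).
  { apply RInt_ext_le; [assumption|]. intros x Hx. apply RInt_ext_le; [assumption|].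
    intros y Hy. unfold g; now rewrite !clamp_id by lra. }
  transitivity (RInt (fun y => RInt (fun x => g x y) a b) c d).
  2:{ apply RInt_ext_le; [assumption|]. intros y Hy. apply RInt_ext_le; [assumption|].
    intros x Hx. unfold g; now rewrite !clamp_id by lra. }
  set (L := fun t => RInt (fun x => RInt (fun y => g x y) c d) a t).
  set (M := fun t => RInt (fun y => RInt (fun x => g x y) a t) c d).
  assert (HL : forall t, is_derive L t (RInt (g t) c d)).
  { intros t. apply (is_derive_RInt (fun x => RInt (g x) c d) L a t).
    - apply filter_forall. intros t'. apply (RInt_correct (V := R_CompleteNormedModule)).
      apply (ex_RInt_continuous (V := R_CompleteNormedModule)). intros z _.
      apply continuous_RInt_param; [assumption|]. now apply filter_forall.
    - apply continuous_RInt_param; [assumption|]. now apply filter_forall. }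
  assert (Hd : forall y t, is_derive (fun t => RInt (fun x => g x y) a t) t (g t y)).
  { intros y t. apply (is_derive_RInt (fun x => g x y) _ a t); [|apply Hg1].
    apply filter_forall. intros t'. apply (RInt_correct (V := R_CompleteNormedModule)).
    apply (ex_RInt_continuous (V := R_CompleteNormedModule)). intros; apply Hg1. }
  assert (HM : forall t, is_derive M t (RInt (g t) c d)).
  { intros t.
    replace (RInt (g t) c d) with (RInt (fun y => Derive (fun t => RInt (fun x => g x y) a t) t) c d).
    2:{ apply RInt_ext. intros y _. apply is_derive_unique, Hd. }
    apply (is_derive_RInt_param (fun t y => RInt (fun x => g x y) a t)).
    - apply filter_forall. intros t' y _. eexists; apply Hd.
    - intros y _. apply continuity_2d_pt_ext with g.
      + intros u v. symmetry; apply is_derive_unique, Hd.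
      + apply continuity_2d_pt_continuous, Hg.
    - apply filter_forall. intros t'. apply ex_RInt_cont; [assumption|]. intros y _.
      destruct (Rle_dec a t') as [Ht|Ht].
      + apply (continuous_RInt_param (fun y x => g x y)); [assumption|].
        apply filter_forall. intros q s _.
        apply (continuous_comp_2 (U := prod_UniformSpace R_UniformSpace R_UniformSpace) (fun z : R * R => snd z) (fun z : R * R => fst z) g); [cont|cont|apply Hg].
      + apply continuous_ext with (fun y => - RInt (fun x => g x y) t' a).
        * intros z. exact (opp_RInt_swap (V := R_CompleteNormedModule) _ _ _
            (ex_RInt_continuous (V := R_CompleteNormedModule) (fun x => g x z) t' a (fun x _ => Hg1 x z))).
        * apply cont_opp. apply (continuous_RInt_param (fun y x => g x y)); [lra|].
          apply filter_forall. intros q s _.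
          apply (continuous_comp_2 (U := prod_UniformSpace R_UniformSpace R_UniformSpace) (fun z : R * R => snd z) (fun z : R * R => fst z) g); [cont|cont|apply Hg]. }
  assert (HLa : L a = 0) by (unfold L; apply (RInt_point (V := R_CompleteNormedModule))).
  assert (HMa : M a = 0).
  { unfold M. rewrite (RInt_ext_le _ (fun _ => 0)).
    - rewrite RInt_const. apply (scal_zero_r (V := R_NormedModule)).
    - assumption.
    - intros; apply (RInt_point (V := R_CompleteNormedModule)). }
  change (L b = M b).
  destruct (Req_dec a b) as [Heq|Hne]; [subst b; congruence|].
  assert (HD : L a - M a = L b - M b).
  { apply (eq_is_derive (V := R_NormedModule) (fun t => L t - M t) a b); [|lra].
    intros t _. replace (@zero R_NormedModule) with (RInt (g t) c d - RInt (g t) c d) by apply Rminus_diag.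
    exact (is_derive_minus (V := R_NormedModule) L M t _ _ (HL t) (HM t)). }
  lra.
Qed.

Lemma RInt_ge_0_cont : forall f a b, a <= b -> ex_RInt f a b -> (forall x, a <= x <= b -> 0 <= f x) -> 0 <= RInt f a b.
Proof. intros f a b Hab Hf H. apply RInt_ge_0; [assumption|assumption|]. intros; apply H; lra. Qed.

Lemma RInt_subinterval : forall f a b a' b', a <= a' -> a' <= b' -> b' <= b ->
  (forall x, a <= x <= b -> 0 <= f x) -> ex_RInt f a b ->
  RInt f a' b' <= RInt f a b.
Proof.
  intros f a b a' b' H1 H2 H3 Hp Hex.
  assert (E1 : ex_RInt f a a') by (apply (ex_RInt_Chasles_1 (V := R_CompleteNormedModule)) with b; [lra|assumption]).
  assert (E2 : ex_RInt f a' b) by (apply (ex_RInt_Chasles_2 (V := R_CompleteNormedModule)) with a; [lra|assumption]).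
  assert (E3 : ex_RInt f a' b') by (apply (ex_RInt_Chasles_1 (V := R_CompleteNormedModule)) with b; [lra|assumption]).
  assert (E4 : ex_RInt f b' b) by (apply (ex_RInt_Chasles_2 (V := R_CompleteNormedModule)) with a'; [lra|assumption]).
  pose proof (RInt_Chasles (V := R_CompleteNormedModule) f a a' b E1 E2) as C1.
  pose proof (RInt_Chasles (V := R_CompleteNormedModule) f a' b' b E3 E4) as C2.
  change (RInt f a a' + RInt f a' b = RInt f a b) in C1.
  change (RInt f a' b' + RInt f b' b = RInt f a' b) in C2.
  assert (0 <= RInt f a a') by (apply RInt_ge_0_cont; [lra|assumption|intros; apply Hp; lra]).
  assert (0 <= RInt f b' b) by (apply RInt_ge_0_cont; [lra|assumption|intros; apply Hp; lra]).
  lra.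
Qed.

Lemma RInt_scal_R : forall f a b (k : R), ex_RInt f a b -> RInt (fun x => k * f x) a b = k * RInt f a b.
Proof. intros f a b k H. exact (RInt_scal (V := R_CompleteNormedModule) f a b k H). Qed.

Lemma RInt_plus_R : forall f g a b, ex_RInt f a b -> ex_RInt g a b ->
  RInt (fun x => f x + g x) a b = RInt f a b + RInt g a b.
Proof. intros f g a b H1 H2. exact (RInt_plus (V := R_CompleteNormedModule) f g a b H1 H2). Qed.

Lemma RInt_affine : forall (f : R -> R) x0 s, 0 < s -> ex_RInt f (x0 - s) (x0 + s) ->
  s * RInt (fun t => f (x0 + s * t)) (-1) 1 = RInt f (x0 - s) (x0 + s) /\ ex_RInt (fun t => f (x0 + s * t)) (-1) 1.
Proof.
  intros f x0 s Hs H.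
  replace (x0 - s) with (s * (-1) + x0) in * by ring. replace (x0 + s) with (s * 1 + x0) in * by ring.
  assert (E : ex_RInt (fun t => f (x0 + s * t)) (-1) 1).
  { pose proof (ex_RInt_comp_lin (V := R_NormedModule) f s x0 (-1) 1 H) as E.
    apply (ex_RInt_scal (V := R_NormedModule) _ _ _ (/ s)) in E.
    eapply ex_RInt_ext; [|exact E]. intros t _. simpl.
    change (/ s * (s * f (s * t + x0)) = f (x0 + s * t)).
    rewrite (Rplus_comm x0). field; lra. }
  split; [|assumption].
  rewrite <- RInt_scal_R by assumption.
  rewrite <- (RInt_comp_lin (V := R_CompleteNormedModule) f s x0 (-1) 1 H).
  apply RInt_ext. intros t _. rewrite (Rplus_comm x0). reflexivity.
Qed.

(** * Complex differentiability through real differentials *)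

(** [d] is the complex derivative of [F] at [z], read off as a real differential
    satisfying the Cauchy-Riemann equations. In this form the chain rule along
    real curves and the real product rule apply componentwise. *)
Definition hol (F : C -> C) (z d : C) : Prop :=
  differentiable_pt_lim (fun s t => Re (F (s, t))) (fst z) (snd z) (Re d) (- Im d) /\
  differentiable_pt_lim (fun s t => Im (F (s, t))) (fst z) (snd z) (Im d) (Re d).

(** The real differential measures increments in the maximum norm, the complex
    one in the modulus; the two differ by a factor at most [sqrt 2]. *)
Lemma hol_of_is_derive : forall (F : C -> C) (z d : C),
  @is_derive C_AbsRing C_NormedModule F z d -> hol F z d.
Proof.
  intros F z d [_ H]. specialize (H z (fun P HP => HP)).
  assert (Hk : forall eps : posreal, locally_2d (fun u v =>
      Cmod (F (u, v) - F z - d * ((u, v) - z))%C <= eps * Rmax (Rabs (u - fst z)) (Rabs (v - snd z))) (fst z) (snd z)).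
  { intros eps.
    assert (He : 0 < eps / sqrt 2).
    { apply Rdiv_lt_0_compat; [apply cond_pos|apply Rlt_sqrt2_0]. }
    destruct (H (mkposreal _ He)) as [del Hdel]. clear H.
    assert (Hd : 0 < del / sqrt 2).
    { apply Rdiv_lt_0_compat; [apply cond_pos|apply Rlt_sqrt2_0]. }
    exists (mkposreal _ Hd). intros u v Hu Hv; simpl in Hu, Hv.
    pose proof Rlt_sqrt2_0 as Hs.
    assert (Hm : Cmod ((u, v) - z)%C <= sqrt 2 * Rmax (Rabs (u - fst z)) (Rabs (v - snd z))).
    { exact (Cmod_2Rmax ((u, v) - z)%C). }
    assert (Hb : Cmod ((u, v) - z)%C < del).
    { eapply Rle_lt_trans; [apply Hm|].
      apply Rlt_le_trans with (sqrt 2 * (del / sqrt 2)).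
      - apply Rmult_lt_compat_l; [assumption|]. now apply Rmax_lub_lt.
      - right; field; lra. }
    specialize (Hdel (u, v) Hb).
    change (Cmod (F (u, v) - F z - ((u, v) - z) * d)%C <= eps / sqrt 2 * Cmod ((u, v) - z)%C) in Hdel.
    replace (d * ((u, v) - z))%C with (((u, v) - z) * d)%C by apply Cmult_comm.
    eapply Rle_trans; [apply Hdel|].
    apply Rle_trans with (eps / sqrt 2 * (sqrt 2 * Rmax (Rabs (u - fst z)) (Rabs (v - snd z)))).
    - apply Rmult_le_compat_l; [lra|assumption].
    - right; field; lra. }
  split; intros eps; destruct (Hk eps) as [del Hdel]; exists del; intros u v Hu Hv;
    specialize (Hdel u v Hu Hv); (eapply Rle_trans; [|apply Hdel]);
    (eapply Rle_trans; [|apply Rmax_Cmod]).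
  - eapply Rle_trans; [|apply Rmax_l]. right. f_equal. destruct z, d; unfold Re, Im; simpl. ring.
  - eapply Rle_trans; [|apply Rmax_r]. right. f_equal. destruct z, d; unfold Re, Im; simpl. ring.
Qed.

Lemma differentiable_of_C1 : forall (f fx : R -> R -> R) x y fy,
  locally (x, y) (fun u : R * R => is_derive (fun s => f s (snd u)) (fst u) (fx (fst u) (snd u))) ->
  is_derive (fun t => f x t) y fy ->
  continuous (fun u : R * R => fx (fst u) (snd u)) (x, y) ->
  differentiable_pt_lim f x y (fx x y) fy.
Proof.
  intros f fx x y fy H1 H2 H3.
  apply filterdiff_differentiable_pt_lim. exact (is_derive_filterdiff f x y fx fy H1 H2 H3).
Qed.

Lemma differentiable_mult2 : forall x y, differentiable_pt_lim (fun u v => u * v) x y y x.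
Proof.
  intros x y. apply (differentiable_of_C1 (fun u v => u * v) (fun u v => v)).
  - apply filter_forall. intros u. auto_derive; [trivial|ring].
  - auto_derive; [trivial|ring].
  - cont.
Qed.

Lemma differentiable_plus2 : forall x y, differentiable_pt_lim (fun u v => u + v) x y 1 1.
Proof.
  intros x y. apply (differentiable_of_C1 (fun u v => u + v) (fun u v => 1)).
  - apply filter_forall. intros u. auto_derive; [trivial|ring].
  - auto_derive; [trivial|ring].
  - cont.
Qed.

Lemma differentiable_plus : forall f g x y a b c d,
  differentiable_pt_lim f x y a b -> differentiable_pt_lim g x y c d ->
  differentiable_pt_lim (fun u v => f u v + g u v) x y (a + c) (b + d).
Proof.
  intros f g x y a b c d Hf Hg.
  replace (a + c) with (1 * a + 1 * c) by ring. replace (b + d) with (1 * b + 1 * d) by ring.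
  apply (differentiable_pt_lim_comp (fun u v => u + v)); [apply differentiable_plus2|assumption|assumption].
Qed.

Lemma differentiable_mult : forall f g x y a b c d,
  differentiable_pt_lim f x y a b -> differentiable_pt_lim g x y c d ->
  differentiable_pt_lim (fun u v => f u v * g u v) x y (a * g x y + f x y * c) (b * g x y + f x y * d).
Proof.
  intros f g x y a b c d Hf Hg.
  replace (a * g x y + f x y * c) with (g x y * a + f x y * c) by ring.
  replace (b * g x y + f x y * d) with (g x y * b + f x y * d) by ring.
  apply (differentiable_pt_lim_comp (fun u v => u * v)); [apply differentiable_mult2|assumption|assumption].
Qed.

Lemma differentiable_const : forall c x y, differentiable_pt_lim (fun _ _ => c) x y 0 0.
Proof.
  intros c x y. apply (differentiable_of_C1 (fun _ _ => c) (fun _ _ => 0)).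
  - apply filter_forall. intros u. auto_derive; [trivial|ring].
  - auto_derive; [trivial|ring].
  - cont.
Qed.

Lemma differentiable_ext : forall f g x y a b,
  (forall s t, f s t = g s t) -> differentiable_pt_lim f x y a b -> differentiable_pt_lim g x y a b.
Proof.
  intros f g x y a b H. apply differentiable_pt_lim_ext.
  exists (mkposreal 1 Rlt_0_1); intros; apply H.
Qed.

Lemma hol_ext_loc : forall F G z d, locally z (fun w => F w = G w) -> hol F z d -> hol G z d.
Proof.
  intros F G [x y] d [del H] [H1 H2].
  assert (HL : locally_2d (fun u v => F (u, v) = G (u, v)) x y).
  { exists del. intros u v Hu Hv. apply H. split; assumption. }
  destruct HL as [del' HL].
  split; (eapply differentiable_pt_lim_ext; [|eassumption]); exists del'; intros u v Hu Hv; simpl; now rewrite (HL u v Hu Hv).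
Qed.

Lemma hol_eq : forall F z d d', d = d' -> hol F z d -> hol F z d'.
Proof. now intros F z d d' ->. Qed.

Lemma hol_const : forall c z, hol (fun _ => c) z 0%C.
Proof.
  intros c z; split; simpl; [rewrite Ropp_0|]; apply differentiable_const.
Qed.

Lemma hol_id : forall z, hol (fun w => w) z 1%C.
Proof.
  intros [x y]; split; simpl; [rewrite Ropp_0|].
  - apply (differentiable_of_C1 (fun u v => u) (fun u v => 1)).
    + apply filter_forall. intros u. auto_derive; [trivial|ring].
    + auto_derive; [trivial|ring].
    + cont.
  - apply (differentiable_of_C1 (fun u v => v) (fun u v => 0)).
    + apply filter_forall. intros u. auto_derive; [trivial|ring].
    + auto_derive; [trivial|ring].
    + cont.
Qed.

Lemma hol_plus : forall F G z d e, hol F z d -> hol G z e -> hol (fun w => F w + G w)%C z (d + e)%C.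
Proof.
  intros F G z d e [H1 H2] [H3 H4]; split.
  - replace (- Im (d + e)%C) with (- Im d + - Im e) by (unfold Im; simpl; ring).
    exact (differentiable_plus _ _ _ _ _ _ _ _ H1 H3).
  - exact (differentiable_plus _ _ _ _ _ _ _ _ H2 H4).
Qed.

Lemma hol_mult : forall F G z d e, hol F z d -> hol G z e ->
  hol (fun w => F w * G w)%C z (d * G z + F z * e)%C.
Proof.
  intros F G z d e [H1 H2] [H3 H4].
  pose proof (differentiable_mult _ _ _ _ _ _ _ _ H1 H3) as A.
  pose proof (differentiable_mult _ _ _ _ _ _ _ _ H2 H4) as B.
  pose proof (differentiable_mult _ _ _ _ _ _ _ _ H1 H4) as A'.
  pose proof (differentiable_mult _ _ _ _ _ _ _ _ H2 H3) as B'.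
  pose proof (differentiable_mult _ _ _ _ _ _ _ _ (differentiable_const (-1) (fst z) (snd z)) B) as B2.
  pose proof (differentiable_plus _ _ _ _ _ _ _ _ A B2) as P.
  pose proof (differentiable_plus _ _ _ _ _ _ _ _ A' B') as Q.
  destruct z as [x y]; simpl in *.
  split.
  - match goal with |- differentiable_pt_lim _ _ _ ?a ?b =>
      match type of P with differentiable_pt_lim _ _ _ ?a' ?b' => replace a with a'; [replace b with b'|] end end.
    + eapply differentiable_ext; [|exact P]. intros s t; unfold Re, Im; simpl; ring.
    + unfold Re, Im; simpl; ring.
    + unfold Re, Im; simpl; ring.
  - match goal with |- differentiable_pt_lim _ _ _ ?a ?b =>
      match type of Q with differentiable_pt_lim _ _ _ ?a' ?b' => replace a with a'; [replace b with b'|] end end.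
    + eapply differentiable_ext; [|exact Q]. intros s t; unfold Re, Im; simpl; ring.
    + unfold Re, Im; simpl; ring.
    + unfold Re, Im; simpl; ring.
Qed.

Lemma hol_scal : forall (c : C) F z d, hol F z d -> hol (fun w => c * F w)%C z (c * d)%C.
Proof.
  intros c F z d H. eapply hol_eq; [|exact (hol_mult _ _ _ _ _ (hol_const c z) H)]. cbv beta; ring.
Qed.

Lemma hol_comp : forall F E z d e, hol F (E z) d -> hol E z e -> hol (fun w => F (E w)) z (d * e)%C.
Proof.
  intros F E [x y] d e [H1 H2] [H3 H4]. simpl in *.
  split; simpl.
  - pose proof (differentiable_pt_lim_comp (fun s t => Re (F (s, t))) (fun s t => Re (E (s, t))) (fun s t => Im (E (s, t)))
      x y _ _ _ _ _ _ H1 H3 H4) as P.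
    match goal with |- differentiable_pt_lim _ _ _ ?a ?b =>
      match type of P with differentiable_pt_lim _ _ _ ?a' ?b' => replace a with a'; [replace b with b'|] end end.
    + eapply differentiable_ext; [|exact P]. intros s t; simpl. unfold Re, Im; now rewrite <- surjective_pairing.
    + unfold Re, Im; simpl; ring.
    + unfold Re, Im; simpl; ring.
  - pose proof (differentiable_pt_lim_comp (fun s t => Im (F (s, t))) (fun s t => Re (E (s, t))) (fun s t => Im (E (s, t)))
      x y _ _ _ _ _ _ H2 H3 H4) as P.
    match goal with |- differentiable_pt_lim _ _ _ ?a ?b =>
      match type of P with differentiable_pt_lim _ _ _ ?a' ?b' => replace a with a'; [replace b with b'|] end end.
    + eapply differentiable_ext; [|exact P]. intros s t; simpl. unfold Re, Im; now rewrite <- surjective_pairing.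
    + unfold Re, Im; simpl; ring.
    + unfold Re, Im; simpl; ring.
Qed.

Lemma hol_curve : forall F (a b : R -> R) t d a' b',
  hol F (a t, b t) d -> is_derive a t a' -> is_derive b t b' ->
  is_derive (fun t => Re (F (a t, b t))) t (Re (d * (a', b'))%C) /\
  is_derive (fun t => Im (F (a t, b t))) t (Im (d * (a', b'))%C).
Proof.
  intros F a b t d a' b' [H1 H2] Ha Hb.
  apply is_derive_Reals in Ha. apply is_derive_Reals in Hb.
  pose proof (derivable_pt_lim_comp_2d _ _ _ _ _ _ _ _ H1 Ha Hb) as A.
  pose proof (derivable_pt_lim_comp_2d _ _ _ _ _ _ _ _ H2 Ha Hb) as B.
  split; apply is_derive_Reals.
  - replace (Re (d * (a', b'))%C) with (Re d * a' + - Im d * b') by (unfold Re, Im; simpl; ring). exact A.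
  - replace (Im (d * (a', b'))%C) with (Im d * a' + Re d * b') by (unfold Re, Im; simpl; ring). exact B.
Qed.

Lemma hol_partials : forall F x y d, hol F (x, y) d ->
  is_derive (fun s => Re (F (s, y))) x (Re d) /\ is_derive (fun s => Im (F (s, y))) x (Im d) /\
  is_derive (fun t => Re (F (x, t))) y (- Im d) /\ is_derive (fun t => Im (F (x, t))) y (Re d).
Proof.
  intros F x y d H.
  destruct (hol_curve F (fun s => s) (fun _ => y) x d 1 0 H) as [A B]; [auto_derive; trivial..|].
  destruct (hol_curve F (fun _ => x) (fun s => s) y d 0 1 H) as [A' B']; [auto_derive; trivial..|].
  split; [|split; [|split]].
  - replace (Re d) with (Re (d * (1, 0))%C) by (unfold Re, Im; simpl; ring). exact A.
  - replace (Im d) with (Im (d * (1, 0))%C) by (unfold Re, Im; simpl; ring). exact B.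
  - replace (- Im d) with (Re (d * (0, 1))%C) by (unfold Re, Im; simpl; ring). exact A'.
  - replace (Re d) with (Im (d * (0, 1))%C) by (unfold Re, Im; simpl; ring). exact B'.
Qed.

Lemma hol_unique : forall F z d d', hol F z d -> hol F z d' -> d = d'.
Proof.
  intros F [x y] d d' H H'.
  destruct (hol_partials _ _ _ _ H) as (A & B & _). destruct (hol_partials _ _ _ _ H') as (A' & B' & _).
  apply is_derive_unique in A. apply is_derive_unique in B.
  apply is_derive_unique in A'. apply is_derive_unique in B'.
  destruct d, d'; unfold Re, Im in *; simpl in *. congruence.
Qed.

Lemma continuous_C_of_parts : forall (F : C -> C) (z : C),
  continuous (fun w : C => Re (F w)) z -> continuous (fun w : C => Im (F w)) z -> continuous F z.
Proof.
  intros F z H1 H2. apply continuous_ext with (fun w => (Re (F w), Im (F w))).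
  - intros w. symmetry; apply surjective_pairing.
  - now apply cont_pair.
Qed.

Lemma hol_continuous : forall F z d, hol F z d -> continuous F z.
Proof.
  intros F [x y] d [H1 H2].
  apply continuous_C_of_parts.
  - apply continuous_ext with (fun w : R * R => Re (F (fst w, snd w))); [now intros []|].
    apply (continuity_2d_pt_continuous (fun s t => Re (F (s, t)))).
    apply differentiable_continuity_pt. eexists; eexists; exact H1.
  - apply continuous_ext with (fun w : R * R => Im (F (fst w, snd w))); [now intros []|].
    apply (continuity_2d_pt_continuous (fun s t => Im (F (s, t)))).
    apply differentiable_continuity_pt. eexists; eexists; exact H2.
Qed.

(** Continuity of the partial derivatives provides the real differential, so
    only the Cauchy-Riemann equations have to be computed for concrete functions. *)
Lemma hol_of_C1 : forall (F F' : C -> C) x y,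
  locally (x, y) (fun z : R * R => is_derive (fun s => Re (F (s, snd z))) (fst z) (Re (F' z)) /\
     is_derive (fun s => Im (F (s, snd z))) (fst z) (Im (F' z))) ->
  is_derive (fun t => Re (F (x, t))) y (- Im (F' (x, y))) ->
  is_derive (fun t => Im (F (x, t))) y (Re (F' (x, y))) ->
  continuous F' (x, y) -> hol F (x, y) (F' (x, y)).
Proof.
  intros F F' x y H1 H2 H3 H4.
  split; simpl.
  - apply (differentiable_of_C1 (fun s t => Re (F (s, t))) (fun s t => Re (F' (s, t)))); [|assumption|].
    + apply filter_imp with (2 := H1). intros [s t] [A _]; exact A.
    + apply continuous_ext with (fun w : R * R => fst (F' w)); [now intros []|cont].
  - apply (differentiable_of_C1 (fun s t => Im (F (s, t))) (fun s t => Im (F' (s, t)))); [|assumption|].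
    + apply filter_imp with (2 := H1). intros [s t] [_ A]; exact A.
    + apply continuous_ext with (fun w : R * R => snd (F' w)); [now intros []|cont].
Qed.

Definition Cexp (z : C) : C := (exp (fst z) * cos (snd z), exp (fst z) * sin (snd z)).

Lemma Cexp_continuous : forall z, continuous Cexp z.
Proof. intros z. unfold Cexp. cont. Qed.

Lemma hol_Cexp : forall z, hol Cexp z (Cexp z).
Proof.
  intros [x y]. apply hol_of_C1; [|..|apply Cexp_continuous].
  - apply filter_forall. intros z. unfold Cexp, Re, Im; simpl. split; auto_derive; trivial; ring.
  - unfold Cexp, Re, Im; simpl. auto_derive; trivial; ring.
  - unfold Cexp, Re, Im; simpl. auto_derive; trivial; ring.
Qed.

Lemma Cmod_Cexp : forall z, Cmod (Cexp z) = exp (fst z).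
Proof.
  intros [x y]. unfold Cmod, Cexp; simpl fst; simpl snd.
  replace ((exp x * cos y) ^ 2 + (exp x * sin y) ^ 2) with (exp x ^ 2 * (Rsqr (sin y) + Rsqr (cos y)))
    by (unfold Rsqr; ring).
  rewrite sin2_cos2, Rmult_1_r. rewrite sqrt_pow2; [reflexivity|left; apply exp_pos].
Qed.

Lemma cont_Cmult : forall {U : UniformSpace} (F G : U -> C) z,
  continuous F z -> continuous G z -> continuous (fun w => F w * G w)%C z.
Proof. intros U F G z HF HG. unfold Cmult. cont. Qed.

Lemma cont_Cplus : forall {U : UniformSpace} (F G : U -> C) z,
  continuous F z -> continuous G z -> continuous (fun w => F w + G w)%C z.
Proof. intros U F G z HF HG. unfold Cplus. cont. Qed.

Lemma cont_Cmod : forall {U : UniformSpace} (F : U -> C) z,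
  continuous F z -> continuous (fun w => Cmod (F w)) z.
Proof.
  intros U F z HF. unfold Cmod. apply (cont_comp sqrt).
  - apply continuity_pt_filterlim, continuity_pt_sqrt.
    apply Rplus_le_le_0_compat; apply pow2_ge_0.
  - apply continuous_ext with (fun w => fst (F w) * fst (F w) + snd (F w) * snd (F w)); [|cont].
    intros w. change (fst (F w) * fst (F w) + snd (F w) * snd (F w) = fst (F w) ^ 2 + snd (F w) ^ 2 :> R). ring.
Qed.

Lemma Re_le_Cmod : forall z, Rabs (Re z) <= Cmod z.
Proof. intros z. eapply Rle_trans; [|apply Rmax_Cmod]. apply Rmax_l. Qed.

Lemma Im_le_Cmod : forall z, Rabs (Im z) <= Cmod z.
Proof. intros z. eapply Rle_trans; [|apply Rmax_Cmod]. apply Rmax_r. Qed.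

Lemma Cmod_le_Re_Im : forall z, Cmod z <= Rabs (Re z) + Rabs (Im z).
Proof.
  intros [x y].
  replace (x, y) with (RtoC x + (0, y))%C by (unfold RtoC, Cplus; simpl; f_equal; ring).
  eapply Rle_trans; [apply Cmod_triangle|]. rewrite Cmod_R. unfold Re, Im; simpl.
  rewrite Rplus_0_r, Rplus_0_l. apply Rplus_le_compat_l.
  unfold Cmod; simpl fst; simpl snd. replace (0 ^ 2 + y ^ 2) with (Rsqr y) by (unfold Rsqr; ring).
  rewrite sqrt_Rsqr_abs. lra.
Qed.

(** * Means over squares *)

Definition sqint (f : R -> R -> R) : R := RInt (fun x => RInt (f x) (-1) 1) (-1) 1.

Notation on_square f := (continuous_on_rect f (-1) 1 (-1) 1).

Lemma sqint_ext : forall f g, (forall x y, -1 <= x <= 1 -> -1 <= y <= 1 -> f x y = g x y) -> sqint f = sqint g.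
Proof.
  intros f g H. unfold sqint. apply RInt_ext_le; [lra|]. intros x Hx.
  apply RInt_ext_le; [lra|]. intros y Hy. now apply H.
Qed.

Lemma sqint_plus : forall f g, on_square f -> on_square g ->
  sqint (fun x y => f x y + g x y) = sqint f + sqint g.
Proof.
  intros f g Hf Hg. unfold sqint.
  rewrite <- RInt_plus_R by (apply ex_RInt_outer; try lra; assumption).
  apply RInt_ext_le; [lra|]. intros x Hx.
  apply RInt_plus_R; apply (ex_RInt_slice _ (-1) 1); try lra; assumption.
Qed.

Lemma sqint_scal : forall f k, on_square f -> sqint (fun x y => k * f x y) = k * sqint f.
Proof.
  intros f k Hf. unfold sqint.
  rewrite <- RInt_scal_R by (apply ex_RInt_outer; try lra; assumption).
  apply RInt_ext_le; [lra|]. intros x Hx.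
  apply RInt_scal_R; apply (ex_RInt_slice _ (-1) 1); try lra; assumption.
Qed.

Lemma sqint_le : forall f g, on_square f -> on_square g ->
  (forall x y, -1 <= x <= 1 -> -1 <= y <= 1 -> f x y <= g x y) -> sqint f <= sqint g.
Proof.
  intros f g Hf Hg H. unfold sqint.
  apply RInt_le; [lra|apply ex_RInt_outer; try lra; assumption|apply ex_RInt_outer; try lra; assumption|].
  intros x Hx. apply RInt_le; [lra|apply (ex_RInt_slice _ (-1) 1); try lra; assumption|
    apply (ex_RInt_slice _ (-1) 1); try lra; assumption|].
  intros y Hy. apply H; lra.
Qed.

Lemma sqint_const : forall c, sqint (fun _ _ => c) = 4 * c.
Proof.
  intros c. unfold sqint. rewrite (RInt_ext_le _ (fun _ => 2 * c)); [|lra|].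
  - rewrite RInt_const. change ((1 - -1) * (2 * c) = 4 * c). ring.
  - intros x _. rewrite RInt_const. change ((1 - -1) * c = 2 * c). ring.
Qed.

Lemma on_square_const : forall c, on_square (fun _ _ => c).
Proof. intros c x y _ _. cont. Qed.

Lemma on_square_plus : forall f g, on_square f -> on_square g -> on_square (fun x y => f x y + g x y).
Proof. intros f g Hf Hg x y Hx Hy. apply cont_plus; [now apply Hf|now apply Hg]. Qed.

Lemma on_square_mult : forall f g, on_square f -> on_square g -> on_square (fun x y => f x y * g x y).
Proof. intros f g Hf Hg x y Hx Hy. apply cont_mult; [now apply Hf|now apply Hg]. Qed.

Lemma on_square_abs : forall f, on_square f -> on_square (fun x y => Rabs (f x y)).
Proof. intros f Hf x y Hx Hy. apply cont_abs. now apply Hf. Qed.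

Lemma sqint_abs_le : forall f B, on_square f ->
  (forall x y, -1 <= x <= 1 -> -1 <= y <= 1 -> Rabs (f x y) <= B) -> Rabs (sqint f) <= 4 * B.
Proof.
  intros f B Hf H. apply Rabs_le. rewrite <- Ropp_mult_distr_r_reverse, <- !sqint_const.
  split; apply sqint_le; try assumption; try apply on_square_const;
    intros x y Hx Hy; specialize (H x y Hx Hy); apply Rabs_le_between in H; lra.
Qed.

Lemma sqint_dy : forall g gy : R -> R -> R, on_square gy ->
  (forall x y, -1 <= x <= 1 -> -1 <= y <= 1 -> is_derive (g x) y (gy x y)) ->
  (forall x, -1 <= x <= 1 -> g x 1 = g x (-1)) -> sqint gy = 0.
Proof.
  intros g gy Hc Hd Hb. unfold sqint.
  rewrite (RInt_ext_le _ (fun _ => 0)); [|lra|].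
  - rewrite RInt_const. apply Rmult_0_r.
  - intros x Hx. apply is_RInt_unique.
    replace 0 with (g x 1 - g x (-1)) by (rewrite Hb by assumption; ring).
    apply (is_RInt_derive (V := R_CompleteNormedModule)); rewrite Rmin_left, Rmax_right by lra; intros y Hy.
    + now apply Hd.
    + now apply (slice_continuous _ _ _ _ _ Hc).
Qed.

(** As for [sqint_dy], after exchanging the order of integration. *)
Lemma sqint_dx : forall g gx : R -> R -> R, on_square gx ->
  (forall x y, -1 <= x <= 1 -> -1 <= y <= 1 -> is_derive (fun x => g x y) x (gx x y)) ->
  (forall y, -1 <= y <= 1 -> g 1 y = g (-1) y) -> sqint gx = 0.
Proof.
  intros g gx Hc Hd Hb. unfold sqint. rewrite fubini by (try lra; assumption).
  apply (sqint_dy (fun y x => g x y) (fun y x => gx x y)).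
  - intros y x Hy Hx.
    apply (continuous_comp_2 (U := prod_UniformSpace R_UniformSpace R_UniformSpace)
      (fun z : R * R => snd z) (fun z : R * R => fst z) gx); [cont|cont|now apply Hc].
  - intros y x Hy Hx. now apply Hd.
  - assumption.
Qed.

(** Differentiation under the integral sign, assuming nothing about integration
    variables outside [[a, b]]; clamping that variable makes the derivative of the
    integrand continuous across the end points. *)
Lemma is_derive_RInt_rect : forall (f df : R -> R -> R) a b t0, a <= b ->
  locally t0 (fun t => forall y, a <= y <= b -> is_derive (fun t => f t y) t (df t y) /\ continuous (f t) y) ->
  (forall y, a <= y <= b -> continuous (fun z : R * R => df (fst z) (snd z)) (t0, y)) ->
  is_derive (fun t => RInt (f t) a b) t0 (RInt (df t0) a b).
Proof.
  intros f df a b t0 Hab Hd Hc.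
  apply is_derive_ext with (fun t => RInt (fun y => f t (clamp a b y)) a b).
  { intros t. apply RInt_ext_le; [assumption|]. intros y Hy. now rewrite clamp_id. }
  assert (HD : locally t0 (fun t => forall y, is_derive (fun t => f t (clamp a b y)) t (df t (clamp a b y)))).
  { apply filter_imp with (2 := Hd). intros t Ht y. apply Ht. now apply clamp_in. }
  replace (RInt (df t0) a b) with (RInt (fun y => Derive (fun t => f t (clamp a b y)) t0) a b).
  2:{ apply RInt_ext_le; [assumption|]. intros y Hy. rewrite clamp_id by assumption.
      apply is_derive_unique. apply (locally_singleton _ _ Hd). assumption. }
  apply (is_derive_RInt_param (fun t y => f t (clamp a b y))).
  - apply filter_imp with (2 := HD). intros t Ht y _. eexists; apply Ht.
  - intros y _. destruct HD as [del HD].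
    apply continuity_2d_pt_ext_loc with (fun t y => df t (clamp a b y)).
    + exists del. intros u v Hu Hv. symmetry. apply is_derive_unique, HD. exact Hu.
    + apply continuity_2d_pt_continuous.
      apply (continuous_comp_2 (fun z : R * R => fst z) (fun z : R * R => clamp a b (snd z)) df).
      * apply continuous_fst.
      * apply (continuous_comp snd (clamp a b)); [apply continuous_snd|apply clamp_continuous].
      * apply Hc. now apply clamp_in.
  - apply filter_imp with (2 := Hd). intros t Ht. apply ex_RInt_cont; [assumption|].
    intros y _. apply (cont_comp (f t) (clamp a b) y); [|apply clamp_continuous].
    apply Ht. now apply clamp_in.
Qed.

(** [eta] is a radial weight supported in the unit disk, hence vanishing on the
    boundary of [[-1, 1]^2]; squaring the gap makes it continuously
    differentiable. *)
Definition disk_gap (x y : R) : R := Rmax 0 (1 - x * x - y * y).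
Definition eta (x y : R) : R := disk_gap x y * disk_gap x y.
Definition eta_mass : R := sqint eta.

Lemma is_derive_sqr_Rmax0 : forall t, is_derive (fun t => Rmax 0 t * Rmax 0 t) t (2 * Rmax 0 t).
Proof.
  intros t. apply is_derive_Reals. intros eps Heps. exists (mkposreal eps Heps). intros h Hh Hlt. simpl in Hlt.
  assert (Hq : Rabs (Rmax 0 (t + h) * Rmax 0 (t + h) - Rmax 0 t * Rmax 0 t - 2 * Rmax 0 t * h) <= h * h).
  { unfold Rmax; destruct (Rle_dec 0 (t + h)), (Rle_dec 0 t); apply Rabs_le; split; nra. }
  replace ((Rmax 0 (t + h) * Rmax 0 (t + h) - Rmax 0 t * Rmax 0 t) / h - 2 * Rmax 0 t)
    with ((Rmax 0 (t + h) * Rmax 0 (t + h) - Rmax 0 t * Rmax 0 t - 2 * Rmax 0 t * h) / h) by (field; assumption).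
  unfold Rdiv. rewrite Rabs_mult, Rabs_inv.
  eapply Rle_lt_trans; [|exact Hlt].
  pose proof (Rabs_pos_lt h Hh).
  apply Rmult_le_reg_r with (Rabs h); [assumption|]. rewrite Rmult_assoc, Rinv_l, Rmult_1_r by lra.
  rewrite <- Rabs_mult, (Rabs_pos_eq (h * h)) by nra. assumption.
Qed.

Lemma disk_gap_continuous : forall p, continuous (fun z : R * R => disk_gap (fst z) (snd z)) p.
Proof.
  intros p. unfold disk_gap.
  apply (cont_comp (Rmax 0) (fun z : R * R => 1 - fst z * fst z - snd z * snd z) p); [|cont].
  apply continuous_ext with (fun t => (t + Rabs t) * / 2).
  - intros t. change ((t + Rabs t) * / 2 = Rmax 0 t :> R). unfold Rmax, Rabs. destruct (Rle_dec 0 t), (Rcase_abs t); lra.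
  - cont.
Qed.

Lemma disk_gap_bounds : forall x y, 0 <= disk_gap x y <= 1.
Proof. intros x y; unfold disk_gap, Rmax; destruct (Rle_dec _ _); nra. Qed.

Lemma eta_bounds : forall x y, 0 <= eta x y <= 1.
Proof. intros x y; unfold eta; pose proof (disk_gap_bounds x y); nra. Qed.

Lemma eta_continuous : forall p, continuous (fun z : R * R => eta (fst z) (snd z)) p.
Proof. intros p; apply cont_mult; apply disk_gap_continuous. Qed.

Lemma eta_dx : forall x y, is_derive (fun x => eta x y) x (-4 * x * disk_gap x y).
Proof.
  intros x y. unfold eta, disk_gap.
  replace (-4 * x * Rmax 0 (1 - x * x - y * y)) with (scal (-2 * x) (2 * Rmax 0 (1 - x * x - y * y)))
    by (unfold scal; simpl; unfold mult; simpl; ring).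
  apply (is_derive_comp (fun t => Rmax 0 t * Rmax 0 t) (fun x => 1 - x * x - y * y)).
  - apply is_derive_sqr_Rmax0.
  - auto_derive; trivial; ring.
Qed.

Lemma eta_dy : forall x y, is_derive (eta x) y (-4 * y * disk_gap x y).
Proof.
  intros x y.
  replace (disk_gap x y) with (disk_gap y x) by (unfold disk_gap; f_equal; ring).
  apply is_derive_ext with (fun y => eta y x); [|apply eta_dx].
  intros t; unfold eta, disk_gap. replace (1 - t * t - x * x) with (1 - x * x - t * t) by ring. reflexivity.
Qed.

Lemma eta_boundary : forall x y, x * x = 1 \/ y * y = 1 -> eta x y = 0.
Proof. intros x y [H|H]; unfold eta, disk_gap, Rmax; destruct (Rle_dec _ _); nra. Qed.

Lemma eta_mass_pos : 0 < eta_mass.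
Proof.
  assert (Hc : on_square eta) by (intros x y _ _; apply eta_continuous).
  unfold eta_mass, sqint.
  apply Rlt_le_trans with (RInt (fun x => RInt (eta x) (-1) 1) (-1 / 2) (1 / 2)).
  - apply Rlt_le_trans with (RInt (fun _ => / 4) (-1 / 2) (1 / 2)).
    + rewrite RInt_const. change (0 < (1 / 2 - -1 / 2) * / 4). lra.
    + apply RInt_le; [lra|apply ex_RInt_const| |].
      * apply (ex_RInt_Chasles_2 (V := R_CompleteNormedModule)) with (-1); [lra|].
        apply (ex_RInt_Chasles_1 (V := R_CompleteNormedModule)) with 1; [lra|].
        apply ex_RInt_outer; try lra; assumption.
      * intros x Hx. apply Rle_trans with (RInt (eta x) (-1 / 2) (1 / 2)).
        -- replace (/ 4) with (RInt (fun _ => / 4) (-1 / 2) (1 / 2)).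
           2:{ rewrite RInt_const. change ((1 / 2 - -1 / 2) * / 4 = / 4). field. }
           apply RInt_le; [lra|apply ex_RInt_const| |].
           ++ apply ex_RInt_cont; [lra|]. intros y _.
              apply (ex_derive_continuous (V := R_NormedModule)). eexists; apply eta_dy.
           ++ intros y Hy. assert (/ 2 <= disk_gap x y).
              { eapply Rle_trans; [|apply Rmax_r]. nra. }
              unfold eta. nra.
        -- apply RInt_subinterval; [lra..| |].
           ++ intros; apply eta_bounds.
           ++ apply (ex_RInt_slice _ (-1) 1); try lra; assumption.
  - apply RInt_subinterval; [lra..| |apply ex_RInt_outer; try lra; assumption].
    intros x Hx. apply RInt_ge_0_cont; [lra|apply (ex_RInt_slice _ (-1) 1); try lra; assumption|].
    intros; apply eta_bounds.
Qed.

Definition pt (z : C) (s x y : R) : C := (fst z + s * x, snd z + s * y).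

Definition in_square (z : C) (s : R) (w : C) : Prop :=
  Rabs (fst w - fst z) < s /\ Rabs (snd w - snd z) < s.

Lemma pt_in_square : forall z s s' x y, Rabs s < s' -> -1 <= x <= 1 -> -1 <= y <= 1 -> in_square z s' (pt z s x y).
Proof.
  intros z s s' x y Hs Hx Hy. unfold in_square, pt; simpl.
  replace (fst z + s * x - fst z) with (s * x) by ring. replace (snd z + s * y - snd z) with (s * y) by ring.
  rewrite !Rabs_mult.
  assert (Rabs x <= 1) by (apply Rabs_le; lra). assert (Rabs y <= 1) by (apply Rabs_le; lra).
  pose proof (Rabs_pos s). split; nra.
Qed.

Lemma on_square_pt : forall (f : C -> R) z s,
  (forall x y, -1 <= x <= 1 -> -1 <= y <= 1 -> continuous f (pt z s x y)) -> on_square (fun x y => f (pt z s x y)).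
Proof.
  intros f z s H x y Hx Hy.
  apply (continuous_comp (fun q : R * R => pt z s (fst q) (snd q)) f); [unfold pt; cont|].
  now apply H.
Qed.

Lemma cont_Re : forall {U : UniformSpace} (F : U -> C) z, continuous F z -> continuous (fun w => Re (F w)) z.
Proof. intros U F z H. unfold Re. cont. Qed.

Lemma cont_Im : forall {U : UniformSpace} (F : U -> C) z, continuous F z -> continuous (fun w => Im (F w)) z.
Proof. intros U F z H. unfold Im. cont. Qed.

Lemma on_square_eta : on_square eta.
Proof. intros x y _ _; apply eta_continuous. Qed.

Lemma on_square_disk_gap : on_square disk_gap.
Proof. intros x y _ _; apply disk_gap_continuous. Qed.

Ltac sqcont := match goal with
  | H : ?G |- ?G => exact H
  | |- continuous_on_rect (fun _ _ => ?c) _ _ _ _ => apply on_square_const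
  | |- continuous_on_rect (fun x y => @?f x y * @?g x y) _ _ _ _ => apply (on_square_mult f g); sqcont
  | |- continuous_on_rect (fun x y => @?f x y + @?g x y) _ _ _ _ => apply (on_square_plus f g); sqcont
  | |- continuous_on_rect eta _ _ _ _ => apply on_square_eta
  | |- continuous_on_rect (fun x y => eta x y) _ _ _ _ => apply on_square_eta
  | |- continuous_on_rect (fun x y => disk_gap x y) _ _ _ _ => exact on_square_disk_gap
  | |- continuous_on_rect (fun x y => x) _ _ _ _ => intros ? ? _ _; cont
  | |- continuous_on_rect (fun x y => y) _ _ _ _ => intros ? ? _ _; cont
  end.

(** The radial derivative of [Re F] is the angular derivative of [Im F], so
    against a radial weight it integrates to zero. *)
Lemma sqint_radial_derivative : forall F F' z s s', s <> 0 -> Rabs s < s' ->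
  (forall w, in_square z s' w -> hol F w (F' w) /\ continuous F' w) ->
  sqint (fun x y => Re (F' (pt z s x y) * (x, y))%C * eta x y) = 0.
Proof.
  intros F F' z s s' Hs0 Hs H.
  assert (Hpt : forall x y, -1 <= x <= 1 -> -1 <= y <= 1 -> hol F (pt z s x y) (F' (pt z s x y)) /\ continuous F' (pt z s x y)).
  { intros x y Hx Hy. now apply H, pt_in_square. }
  assert (HI : on_square (fun x y => Im (F (pt z s x y)))).
  { apply (on_square_pt (fun w => Im (F w))). intros x y Hx Hy. apply cont_Im.
    eapply hol_continuous. now apply Hpt. }
  assert (HR' : on_square (fun x y => Re (F' (pt z s x y)))).
  { apply (on_square_pt (fun w => Re (F' w))). intros x y Hx Hy. apply cont_Re. now apply Hpt. }
  assert (HI' : on_square (fun x y => Im (F' (pt z s x y)))).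
  { apply (on_square_pt (fun w => Im (F' w))). intros x y Hx Hy. apply cont_Im. now apply Hpt. }
  set (A := fun x y => x * (s * Re (F' (pt z s x y)) * eta x y + Im (F (pt z s x y)) * (-4 * y * disk_gap x y))).
  set (B := fun x y => y * (s * Im (F' (pt z s x y)) * eta x y + Im (F (pt z s x y)) * (-4 * x * disk_gap x y))).
  assert (HA : on_square A).
  { unfold A. sqcont. }
  assert (HB : on_square B).
  { unfold B. sqcont. }
  assert (A0 : sqint A = 0).
  { apply (sqint_dy (fun x y => x * (Im (F (pt z s x y)) * eta x y))); [assumption| |].
    - intros x y Hx Hy. unfold A. apply (is_derive_scal (fun y => Im (F (pt z s x y)) * eta x y)).
      destruct (hol_curve F (fun _ => fst z + s * x) (fun y => snd z + s * y) y (F' (pt z s x y)) 0 s) as [_ D];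
        [now apply Hpt|auto_derive; trivial|auto_derive; trivial; ring|].
      pose proof (is_derive_mult (K := R_AbsRing) _ _ _ _ _ D (eta_dy x y) Rmult_comm) as D2.
      replace (s * Re (F' (pt z s x y))) with (Im (F' (pt z s x y) * (0, s))%C) by (unfold Re, Im; simpl; ring).
      exact D2.
    - intros x Hx. rewrite !eta_boundary by (right; ring). ring. }
  assert (B0 : sqint B = 0).
  { apply (sqint_dx (fun x y => y * (Im (F (pt z s x y)) * eta x y))); [assumption| |].
    - intros x y Hx Hy. unfold B. apply (is_derive_scal (fun x => Im (F (pt z s x y)) * eta x y)).
      destruct (hol_curve F (fun x => fst z + s * x) (fun _ => snd z + s * y) x (F' (pt z s x y)) s 0) as [_ D];
        [now apply Hpt|auto_derive; trivial; ring|auto_derive; trivial|].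
      pose proof (is_derive_mult (K := R_AbsRing) _ _ _ _ _ D (eta_dx x y) Rmult_comm) as D2.
      replace (s * Im (F' (pt z s x y))) with (Im (F' (pt z s x y) * (s, 0))%C) by (unfold Re, Im; simpl; ring).
      exact D2.
    - intros y Hy. rewrite !eta_boundary by (left; ring). ring. }
  assert (E : s * sqint (fun x y => Re (F' (pt z s x y) * (x, y))%C * eta x y) = sqint A + -1 * sqint B).
  { rewrite <- (sqint_scal B) by assumption. rewrite <- sqint_plus.
    - rewrite <- sqint_scal.
      + apply sqint_ext. intros x y Hx Hy. unfold A, B, Re, Im; simpl. ring.
      + apply (on_square_mult (fun x y => Re (F' (pt z s x y) * (x, y))%C)); [|apply on_square_eta].
        intros x y Hx Hy. apply continuous_ext with (fun q : R * R =>
          Re (F' (pt z s (fst q) (snd q))) * fst q + -1 * (Im (F' (pt z s (fst q) (snd q))) * snd q)).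
        * intros [a b]. unfold Re, Im; simpl.
          match goal with |- ?a = ?b => change (a = b :> R) end. ring.
        * revert x y Hx Hy.
          apply (on_square_plus (fun x y => Re (F' (pt z s x y)) * x) (fun x y => -1 * (Im (F' (pt z s x y)) * y)));
          sqcont.
    - assumption.
    - apply on_square_mult; [apply on_square_const|assumption]. }
  rewrite A0, B0 in E. apply Rmult_eq_reg_l with s; [|assumption]. lra.
Qed.

Lemma locally_lt : forall {U : UniformSpace} (f : U -> R) p a, continuous f p -> f p < a -> locally p (fun q => f q < a).
Proof. intros U f p a Hf H. apply (Hf (fun v => v < a)). now apply open_lt. Qed.

(** The weighted mean over the square of half-side [e] is differentiable in [e],
    its derivative is the weighted mean of the radial derivative, hence zero, and
    for [e = 0] it is the value at the centre. *)
Lemma area_mean_value : forall F F' z s s', 0 < s < s' ->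
  (forall w, in_square z s' w -> hol F w (F' w) /\ continuous F' w) ->
  sqint (fun x y => Re (F (pt z s x y)) * eta x y) = Re (F z) * eta_mass.
Proof.
  intros F F' z s s' Hs H.
  set (f := fun e x y => Re (F (pt z e x y)) * eta x y).
  set (df := fun e x y => Re (F' (pt z e x y) * (x, y))%C * eta x y).
  set (I := fun e => sqint (f e)).
  assert (Hpt : forall e x y, Rabs (e * x) < s' -> Rabs (e * y) < s' -> in_square z s' (pt z e x y)).
  { intros e x y Hx Hy. unfold in_square, pt; simpl.
    replace (fst z + e * x - fst z) with (e * x) by ring. replace (snd z + e * y - snd z) with (e * y) by ring. now split. }
  assert (Hey : forall e y, Rabs e < s' -> -1 <= y <= 1 -> Rabs (e * y) < s').
  { intros e y He Hy. rewrite Rabs_mult. assert (Rabs y <= 1) by (apply Rabs_le; lra).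
    pose proof (Rabs_pos e). pose proof (Rabs_pos y). nra. }
  assert (Cf : forall e x y, in_square z s' (pt z e x y) ->
    continuous (fun q : (R * R) * R => f (fst (fst q)) (snd (fst q)) (snd q)) (e, x, y)).
  { intros e x y Hin. unfold f.
    apply (cont_mult (fun q : (R * R) * R => Re (F (pt z (fst (fst q)) (snd (fst q)) (snd q))))
                     (fun q : (R * R) * R => eta (snd (fst q)) (snd q))).
    - apply (continuous_comp (fun q : (R * R) * R => pt z (fst (fst q)) (snd (fst q)) (snd q)) (fun w => Re (F w))).
      + unfold pt. cont.
      + apply cont_Re. eapply hol_continuous. now apply H.
    - apply (continuous_comp_2 (fun q : (R * R) * R => snd (fst q)) (fun q : (R * R) * R => snd q) eta); [cont|cont|apply eta_continuous]. }
  assert (Cdf : forall e x y, in_square z s' (pt z e x y) ->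
    continuous (fun q : (R * R) * R => df (fst (fst q)) (snd (fst q)) (snd q)) (e, x, y)).
  { intros e x y Hin. unfold df.
    apply (cont_mult (fun q : (R * R) * R => Re (F' (pt z (fst (fst q)) (snd (fst q)) (snd q)) * (snd (fst q), snd q))%C)
                     (fun q : (R * R) * R => eta (snd (fst q)) (snd q))).
    - apply cont_Re. apply cont_Cmult; [|cont].
      apply (continuous_comp (fun q : (R * R) * R => pt z (fst (fst q)) (snd (fst q)) (snd q)) F').
      + unfold pt. cont.
      + now apply H.
    - apply (continuous_comp_2 (fun q : (R * R) * R => snd (fst q)) (fun q : (R * R) * R => snd q) eta); [cont|cont|apply eta_continuous]. }
  assert (Hloc : forall e x, Rabs e < s' -> -1 <= x <= 1 ->
    locally (e, x) (fun q : R * R => forall y, -1 <= y <= 1 -> in_square z s' (pt z (fst q) (snd q) y))).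
  { intros e x He Hx.
    pose proof (locally_lt (fun q : R * R => Rabs (fst q)) (e, x) s' ltac:(cont) He) as L1.
    pose proof (locally_lt (fun q : R * R => Rabs (fst q * snd q)) (e, x) s' ltac:(cont) (Hey e x He Hx)) as L2.
    generalize (filter_and _ _ L1 L2). apply filter_imp. intros q [H1 H2] y Hy. apply Hpt; [assumption|now apply Hey]. }
  assert (Hinner : forall e x, Rabs e < s' -> -1 <= x <= 1 ->
    is_derive (fun e => RInt (f e x) (-1) 1) e (RInt (df e x) (-1) 1)).
  { intros e x He Hx. apply (is_derive_RInt_rect (fun e y => f e x y) (fun e y => df e x y)); [lra| |].
    - apply (locally_lt (fun e => Rabs e) e s') in He; [|cont]. apply filter_imp with (2 := He).
      intros e' He' y Hy. assert (Hin : in_square z s' (pt z e' x y)) by now apply pt_in_square.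
      split.
      + unfold f, df.
        destruct (hol_curve F (fun e => fst z + e * x) (fun e => snd z + e * y) e' (F' (pt z e' x y)) x y) as [D _];
          [now apply H|auto_derive; trivial; ring|auto_derive; trivial; ring|].
        replace (Re (F' (pt z e' x y) * (x, y))%C * eta x y) with (eta x y * Re (F' (pt z e' x y) * (x, y))%C) by ring.
        apply is_derive_ext with (fun e => eta x y * Re (F (pt z e x y))); [intros e0; apply Rmult_comm|].
        exact (is_derive_scal _ _ (eta x y) _ D).
      + apply (continuous_comp (fun y => ((e', x), y)) (fun q : (R * R) * R => f (fst (fst q)) (snd (fst q)) (snd q))); [|now apply Cf].
        apply (continuous_comp_2 (fun _ => (e', x)) (fun y => y) (fun a b => (a, b))); [apply continuous_const|apply continuous_id|].
        apply continuous_ext with (fun q : (R * R) * R => q); [now intros []|apply continuous_id].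
    - intros y Hy.
      apply (continuous_comp (fun q : R * R => ((fst q, x), snd q)) (fun q : (R * R) * R => df (fst (fst q)) (snd (fst q)) (snd q))).
      + apply (continuous_comp_2 (fun q : R * R => (fst q, x)) (fun q => snd q) (fun a b => (a, b))); [cont|cont|].
        apply continuous_ext with (fun q : (R * R) * R => q); [now intros []|apply continuous_id].
      + apply Cdf. now apply pt_in_square. }
  assert (HI : forall e, Rabs e < s' -> is_derive I e (sqint (df e))).
  { intros e He. unfold I, sqint.
    apply (is_derive_RInt_rect (fun e x => RInt (f e x) (-1) 1) (fun e x => RInt (df e x) (-1) 1)); [lra| |].
    - apply (locally_lt (fun e => Rabs e) e s') in He; [|cont]. apply filter_imp with (2 := He).
      intros e' He' x Hx. split; [now apply Hinner|].
      apply (continuous_comp (fun x => (e', x)) (fun q : R * R => RInt (f (fst q) (snd q)) (-1) 1)); [cont|].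
      apply (continuous_RInt_param (T := prod_UniformSpace R_UniformSpace R_UniformSpace) (fun (q : R * R) y => f (fst q) (snd q) y)); [lra|].
      generalize (Hloc e' x He' Hx). apply filter_imp. intros [e2 x2] Hq y Hy. apply Cf. now apply Hq.
    - intros x Hx.
      apply (continuous_RInt_param (T := prod_UniformSpace R_UniformSpace R_UniformSpace) (fun (q : R * R) y => df (fst q) (snd q) y)); [lra|].
      generalize (Hloc e x He Hx). apply filter_imp. intros [e2 x2] Hq y Hy. apply Cdf. now apply Hq. }
  assert (HIs : I s = I 0).
  { destruct (MVT_gen I 0 s (fun _ => 0)) as (c & _ & Hc).
    - rewrite Rmin_left, Rmax_right by lra. intros e He.
      assert (Ha : Rabs e < s') by (rewrite Rabs_pos_eq; lra).
      replace 0 with (sqint (df e)); [now apply HI|].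
      apply (sqint_radial_derivative F F' z e s'); [lra|assumption|assumption].
    - rewrite Rmin_left, Rmax_right by lra. intros e He.
      assert (Ha : Rabs e < s') by (rewrite Rabs_pos_eq; lra).
      apply continuity_pt_filterlim. apply (ex_derive_continuous (V := R_NormedModule)). eexists; now apply HI.
    - lra. }
  change (I s = Re (F z) * eta_mass). rewrite HIs. unfold I, eta_mass.
  rewrite <- sqint_scal by apply on_square_eta. apply sqint_ext. intros x y _ _. unfold f, pt.
  rewrite !Rmult_0_l, !Rplus_0_r, <- surjective_pairing. reflexivity.
Qed.

Lemma area_mean_inequality : forall F F' z s s', 0 < s < s' ->
  (forall w, in_square z s' w -> hol F w (F' w) /\ continuous F' w) ->
  Rabs (Re (F z)) * eta_mass <= sqint (fun x y => Rabs (Re (F (pt z s x y)))).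
Proof.
  intros F F' z s s' Hs H.
  pose proof eta_mass_pos as Hm.
  rewrite <- (Rabs_pos_eq eta_mass) by lra. rewrite <- Rabs_mult, <- (area_mean_value F F' z s s' Hs H).
  assert (Hc : on_square (fun x y => Re (F (pt z s x y)))).
  { apply (on_square_pt (fun w => Re (F w))). intros x y Hx Hy. apply cont_Re.
    eapply hol_continuous. apply H. apply pt_in_square; try assumption. rewrite Rabs_pos_eq; lra. }
  assert (Hce : on_square (fun x y => Re (F (pt z s x y)) * eta x y)) by (apply on_square_mult; [assumption|apply on_square_eta]).
  assert (Hb : forall x y, Rabs (Re (F (pt z s x y)) * eta x y) <= Rabs (Re (F (pt z s x y)))).
  { intros x y. rewrite Rabs_mult. pose proof (eta_bounds x y). rewrite (Rabs_pos_eq (eta x y)) by lra.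
    pose proof (Rabs_pos (Re (F (pt z s x y)))). nra. }
  apply Rabs_le. split.
  - replace (- sqint (fun x y => Rabs (Re (F (pt z s x y))))) with (-1 * sqint (fun x y => Rabs (Re (F (pt z s x y))))) by ring.
    rewrite <- sqint_scal by now apply on_square_abs.
    apply sqint_le; [|assumption|].
    + apply on_square_mult; [apply on_square_const|now apply on_square_abs].
    + intros x y _ _. specialize (Hb x y). apply Rabs_le_between in Hb. lra.
  - apply sqint_le; [assumption|now apply on_square_abs|].
    intros x y _ _. specialize (Hb x y). apply Rabs_le_between in Hb. lra.
Qed.

(** Apply the mean value property to [F'] and integrate by parts: the derivative
    moves onto the weight, and only [Re F] is left. *)
Lemma gradient_estimate : forall F F' F'' z s s' B, 0 < s < s' ->
  (forall w, in_square z s' w -> hol F w (F' w) /\ hol F' w (F'' w) /\ continuous F'' w) ->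
  (forall x y, -1 <= x <= 1 -> -1 <= y <= 1 -> Rabs (Re (F (pt z s x y))) <= B) ->
  Cmod (F' z) <= 32 / eta_mass * (B / s).
Proof.
  intros F F' F'' z s s' B Hs H HB.
  pose proof eta_mass_pos as Hm.
  assert (Hpt : forall x y, -1 <= x <= 1 -> -1 <= y <= 1 -> in_square z s' (pt z s x y)).
  { intros x y Hx Hy. apply pt_in_square; try assumption. rewrite Rabs_pos_eq; lra. }
  assert (HR : on_square (fun x y => Re (F (pt z s x y)))).
  { apply (on_square_pt (fun w => Re (F w))). intros x y Hx Hy. apply cont_Re.
    eapply hol_continuous. now apply H, Hpt. }
  assert (HR' : on_square (fun x y => Re (F' (pt z s x y)))).
  { apply (on_square_pt (fun w => Re (F' w))). intros x y Hx Hy. apply cont_Re.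
    eapply hol_continuous. now apply H, Hpt. }
  assert (HI' : on_square (fun x y => Im (F' (pt z s x y)))).
  { apply (on_square_pt (fun w => Im (F' w))). intros x y Hx Hy. apply cont_Im.
    eapply hol_continuous. now apply H, Hpt. }
  assert (Hgb : forall x y, -1 <= x <= 1 -> -1 <= y <= 1 -> Rabs (Re (F (pt z s x y)) * (-4 * x * disk_gap x y)) <= 4 * B
     /\ Rabs (Re (F (pt z s x y)) * (-4 * y * disk_gap x y)) <= 4 * B).
  { intros x y Hx Hy. specialize (HB x y Hx Hy). pose proof (disk_gap_bounds x y).
    assert (Rabs (-4 * x * disk_gap x y) <= 4) by (apply Rabs_le; split; nra).
    assert (Rabs (-4 * y * disk_gap x y) <= 4) by (apply Rabs_le; split; nra).
    rewrite !Rabs_mult in *. pose proof (Rabs_pos (Re (F (pt z s x y)))).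
    split; rewrite (Rmult_comm 4 B); apply Rmult_le_compat; try assumption;
      repeat apply Rmult_le_pos; apply Rabs_pos. }
  assert (E1 : s * (Re (F' z) * eta_mass) = -1 * sqint (fun x y => Re (F (pt z s x y)) * (-4 * x * disk_gap x y))).
  { rewrite <- (area_mean_value F' F'' z s s' Hs) by (intros w Hw; split; now apply H).
    rewrite <- sqint_scal by (apply on_square_mult; [assumption|apply on_square_eta]).
    assert (D0 : sqint (fun x y => s * (Re (F' (pt z s x y)) * eta x y) + Re (F (pt z s x y)) * (-4 * x * disk_gap x y)) = 0).
    { apply (sqint_dx (fun x y => Re (F (pt z s x y)) * eta x y)).
      - sqcont.
      - intros x y Hx Hy.
        destruct (hol_curve F (fun x => fst z + s * x) (fun _ => snd z + s * y) x (F' (pt z s x y)) s 0) as [D _];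
          [now apply H, Hpt|auto_derive; trivial; ring|auto_derive; trivial|].
        pose proof (is_derive_mult (K := R_AbsRing) _ _ _ _ _ D (eta_dx x y) Rmult_comm) as D2.
        replace (s * (Re (F' (pt z s x y)) * eta x y)) with (Re (F' (pt z s x y) * (s, 0))%C * eta x y) by (unfold Re, Im; simpl; ring).
        exact D2.
      - intros y Hy. rewrite !eta_boundary by (left; ring). ring. }
    rewrite sqint_plus in D0; [lra|..];
      sqcont. }
  assert (E2 : s * (Im (F' z) * eta_mass) = sqint (fun x y => Re (F (pt z s x y)) * (-4 * y * disk_gap x y))).
  { assert (A : sqint (fun x y => Re ((0, -1) * F' (pt z s x y))%C * eta x y) = Re ((0, -1) * F' z)%C * eta_mass).
    { apply (area_mean_value (fun w => (0, -1) * F' w)%C (fun w => (0, -1) * F'' w)%C z s s' Hs).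
      intros w Hw. destruct (H w Hw) as (H1 & H2 & H3). split; [now apply hol_scal|].
      apply cont_Cmult; [apply continuous_const|assumption]. }
    replace (Re ((0, -1) * F' z)%C) with (Im (F' z)) in A by (unfold Re, Im; simpl; ring).
    rewrite (sqint_ext _ (fun x y => Im (F' (pt z s x y)) * eta x y)) in A by (intros; unfold Re, Im; simpl; ring).
    rewrite <- A.
    rewrite <- sqint_scal by (apply on_square_mult; [assumption|apply on_square_eta]).
    assert (D0 : sqint (fun x y => -1 * (s * (Im (F' (pt z s x y)) * eta x y)) + Re (F (pt z s x y)) * (-4 * y * disk_gap x y)) = 0).
    { apply (sqint_dy (fun x y => Re (F (pt z s x y)) * eta x y)).
      - sqcont.
      - intros x y Hx Hy.
        destruct (hol_curve F (fun _ => fst z + s * x) (fun y => snd z + s * y) y (F' (pt z s x y)) 0 s) as [D _];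
          [now apply H, Hpt|auto_derive; trivial|auto_derive; trivial; ring|].
        pose proof (is_derive_mult (K := R_AbsRing) _ _ _ _ _ D (eta_dy x y) Rmult_comm) as D2.
        replace (-1 * (s * (Im (F' (pt z s x y)) * eta x y))) with (Re (F' (pt z s x y) * (0, s))%C * eta x y) by (unfold Re, Im; simpl; ring).
        exact D2.
      - intros x Hx. rewrite !eta_boundary by (right; ring). ring. }
    rewrite sqint_plus, (sqint_scal (fun x y => s * (Im (F' (pt z s x y)) * eta x y))) in D0; [lra|..];
      sqcont. }
  assert (B1 : Rabs (s * (Re (F' z) * eta_mass)) <= 16 * B).
  { rewrite E1, Rabs_mult. replace (Rabs (-1)) with 1 by (rewrite Rabs_left; lra). rewrite Rmult_1_l.
    replace (16 * B) with (4 * (4 * B)) by ring. apply sqint_abs_le; [|intros; now apply Hgb].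
    sqcont. }
  assert (B2 : Rabs (s * (Im (F' z) * eta_mass)) <= 16 * B).
  { rewrite E2.
    replace (16 * B) with (4 * (4 * B)) by ring. apply sqint_abs_le; [|intros; now apply Hgb].
    sqcont. }
  rewrite !Rabs_mult, (Rabs_pos_eq s), (Rabs_pos_eq eta_mass) in B1, B2 by lra.
  eapply Rle_trans; [apply Cmod_le_Re_Im|].
  apply Rmult_le_reg_l with (s * eta_mass); [apply Rmult_lt_0_compat; lra|].
  replace (s * eta_mass * (32 / eta_mass * (B / s))) with (32 * B) by (field; lra). lra.
Qed.

(** * Local bounds by integrals of p-th powers *)

(** Around each point the function differs by less than 1 from its value there on
    a neighbourhood whose size is at most [1 / (1 + |f|)] at that point; a uniform
    lower bound for these sizes thus bounds [|f|] as well. *)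
Lemma bounded_on_rect : forall f a b c d, continuous_on_rect f a b c d ->
  exists M, 0 < M /\ forall x y, a <= x <= b -> c <= y <= d -> Rabs (f x y) <= M.
Proof.
  intros f a b c d H.
  set (P := fun (q : R * R) (e : posreal) => a <= fst q <= b -> c <= snd q <= d ->
     (forall u v, Rabs (u - fst q) < e -> Rabs (v - snd q) < e -> Rabs (f u v - f (fst q) (snd q)) < 1) /\
     e <= / (1 + Rabs (f (fst q) (snd q)))).
  assert (HP : forall q, exists e, P q e).
  { intros [x y]. destruct (classic (a <= x <= b /\ c <= y <= d)) as [[Hx Hy]|Hn].
    2:{ exists (mkposreal 1 Rlt_0_1). intros Hx Hy. now destruct Hn. }
    specialize (H x y Hx Hy). apply (continuity_2d_pt_continuous f) in H.
    destruct (H (mkposreal 1 Rlt_0_1)) as [e He].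
    assert (Hi : 0 < / (1 + Rabs (f x y))) by (apply Rinv_0_lt_compat; pose proof (Rabs_pos (f x y)); lra).
    assert (Hm : 0 < Rmin e (/ (1 + Rabs (f x y)))) by (apply Rmin_glb_lt; [apply cond_pos|assumption]).
    exists (mkposreal _ Hm). intros _ _. simpl. split; [|apply Rmin_r].
    intros u v Hu Hv. apply He; eapply Rlt_le_trans; try eassumption; apply Rmin_l. }
  set (del := fun q => proj1_sig (constructive_indefinite_description _ (HP q))).
  assert (Hdel : forall q, P q (del q)) by (intros q; exact (proj2_sig (constructive_indefinite_description _ (HP q)))).
  destruct (compactness_value_2d a b c d (fun u v => del (u, v))) as [e He].
  assert (Hie : 0 < / e) by (apply Rinv_0_lt_compat, cond_pos).
  exists (1 + / e). split; [lra|]. intros x y Hx Hy.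
  destruct (Rle_dec (Rabs (f x y)) (1 + / e)) as [|Hn]; [assumption|exfalso].
  apply (He x y Hx Hy). intros (u & v & Hu & Hv & Hxu & Hyv & Hed). apply Hn.
  destruct (Hdel (u, v) Hu Hv) as [H1 H2]. simpl in H1, H2.
  specialize (H1 x y Hxu Hyv).
  assert (1 + Rabs (f u v) <= / e).
  { assert (H3 : e <= / (1 + Rabs (f u v))) by lra.
    pose proof (Rabs_pos (f u v)). pose proof (cond_pos e).
    apply Rinv_le_contravar in H3; [|assumption]. now rewrite Rinv_inv in H3. }
  replace (f x y) with ((f x y - f u v) + f u v) by ring.
  eapply Rle_trans; [apply Rabs_triang|]. lra.
Qed.

Lemma RInt_le_mono : forall f g a b, a <= b -> ex_RInt f a b -> ex_RInt g a b ->
  (forall x, a <= x <= b -> f x <= g x) -> RInt f a b <= RInt g a b.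
Proof. intros f g a b Hab Hf Hg H. apply RInt_le; try assumption. intros; apply H; lra. Qed.

Lemma sqint_subsquare : forall g x1 y1 s, 0 < s -> Rabs x1 + s <= 1 -> Rabs y1 + s <= 1 ->
  on_square g -> (forall x y, 0 <= g x y) ->
  s * s * sqint (fun x y => g (x1 + s * x) (y1 + s * y)) <= sqint g.
Proof.
  intros g x1 y1 s Hs Hx1 Hy1 Hg Hp.
  assert (Ax : -1 <= x1 - s /\ x1 + s <= 1) by (unfold Rabs in Hx1; destruct (Rcase_abs x1); lra).
  assert (Ay : -1 <= y1 - s /\ y1 + s <= 1) by (unfold Rabs in Hy1; destruct (Rcase_abs y1); lra).
  assert (Hg' : continuous_on_rect g (x1 - s) (x1 + s) (y1 - s) (y1 + s)) by (intros x y Hx Hy; apply Hg; lra).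
  set (h := fun x => RInt (g x) (y1 - s) (y1 + s)).
  assert (Eh : ex_RInt h (x1 - s) (x1 + s)) by (apply ex_RInt_outer; try lra; assumption).
  destruct (RInt_affine h x1 s Hs Eh) as [E1 E1'].
  assert (E2 : s * sqint (fun x y => g (x1 + s * x) (y1 + s * y)) = RInt (fun x => h (x1 + s * x)) (-1) 1).
  { unfold sqint. rewrite <- RInt_scal_R.
    - apply RInt_ext_le; [lra|]. intros x Hx.
      apply (RInt_affine (g (x1 + s * x)) y1 s Hs).
      apply (ex_RInt_slice _ (x1 - s) (x1 + s)); [lra|assumption|nra].
    - apply (ex_RInt_outer (fun x y => g (x1 + s * x) (y1 + s * y)) (-1) 1 (-1) 1); [lra|lra|].
      intros x y Hx Hy.
      apply (continuous_comp_2 (fun q : R * R => x1 + s * fst q) (fun q : R * R => y1 + s * snd q) g); [cont|cont|].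
      apply Hg'; simpl; nra. }
  rewrite Rmult_assoc, E2, E1. unfold sqint.
  apply Rle_trans with (RInt (fun x => RInt (g x) (-1) 1) (x1 - s) (x1 + s)).
  - apply RInt_le_mono; [lra|assumption| |].
    + apply (ex_RInt_outer g (x1 - s) (x1 + s) (-1) 1); [lra|lra|]. intros x y Hx Hy; apply Hg; lra.
    + intros x Hx. unfold h. apply RInt_subinterval; [lra..| |].
      * intros; apply Hp.
      * apply (ex_RInt_slice _ (-1) 1); [lra|assumption|lra].
  - apply RInt_subinterval; [lra..| |].
    + intros x Hx. apply RInt_ge_0_cont; [lra|apply (ex_RInt_slice _ (-1) 1); [lra|assumption|lra]|intros; apply Hp].
    + apply ex_RInt_outer; try lra; assumption.
Qed.

Lemma pt_pt : forall z r x1 y1 s x y, pt (pt z r x1 y1) (r * s) x y = pt z r (x1 + s * x) (y1 + s * y).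
Proof. intros; unfold pt; simpl; f_equal; ring. Qed.

(** For [p < 1] the mean value inequality controls [|u|] only by the mean of
    [|u|]; weighting [|u|] with a power of the distance to the boundary and
    looking at an almost maximal point bounds [|u|] by a multiple of its value
    there on a smaller square, which turns the mean of [|u|] into one of
    [|u|^p]. The weight exponent [2/p] makes the estimate scale invariant. *)
Lemma local_Lp_bound : forall p, 0 < p -> exists C, 0 < C /\
  forall F F' z rho rho', 0 < rho < rho' ->
  (forall w, in_square z rho' w -> hol F w (F' w) /\ continuous F' w) ->
  forall x y, -1 / 2 <= x <= 1 / 2 -> -1 / 2 <= y <= 1 / 2 ->
  rpow (Rabs (Re (F (pt z rho x y)))) p <=
  C * sqint (fun x y => rpow (Rabs (Re (F (pt z rho x y)))) p).
Proof.
  intros p Hp.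
  pose proof eta_mass_pos as Hm.
  set (a := 2 / p).
  assert (Ha : 0 < a) by (apply Rdiv_lt_0_compat; lra).
  set (Lam := 2 * rpow 2 a).
  assert (HLam : 0 < Lam) by (unfold Lam; pose proof (rpow_gt_0 2 a); lra).
  (* the square has area 4, so [kap * M] integrates to half of [M * eta_mass] *)
  set (kap := eta_mass / 8).
  assert (Hkap : 0 < kap) by (unfold kap; lra).
  pose proof (rpow_gt_0 kap p Hkap) as Hkp.
  set (L := Lam * / rpow kap p).
  assert (HL : 0 < L) by (apply Rmult_lt_0_compat; [assumption|now apply Rinv_0_lt_compat]).
  pose proof (rpow_gt_0 2 p ltac:(lra)) as H2p.
  assert (HC : 0 < 2 * L / eta_mass) by (apply Rdiv_lt_0_compat; lra).
  exists (16 * rpow 2 p * (2 * L / eta_mass)). split; [nra|].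
  intros F F' z rho rho' Hrho H.
  set (U := fun x y => Rabs (Re (F (pt z rho x y)))).
  assert (Hin : forall x y, -1 <= x <= 1 -> -1 <= y <= 1 -> in_square z rho' (pt z rho x y)).
  { intros x y Hx Hy. apply pt_in_square; try assumption. rewrite Rabs_pos_eq; lra. }
  assert (HU : on_square U).
  { unfold U. apply on_square_abs. apply (on_square_pt (fun w => Re (F w))). intros x y Hx Hy. apply cont_Re.
    eapply hol_continuous. now apply H, Hin. }
  assert (HU0 : forall x y, 0 <= U x y) by (intros; apply Rabs_pos).
  set (Up := fun x y => rpow (U x y) p).
  assert (HUp : on_square Up).
  { intros x y Hx Hy. unfold Up.
    apply continuous_ext with (fun q : R * R => rpow (Rabs (U (fst q) (snd q))) p).
    - intros q. now rewrite (Rabs_pos_eq (U _ _)) by apply HU0.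
    - apply (cont_comp (fun t => rpow (Rabs t) p) (fun q : R * R => U (fst q) (snd q))).
      + now apply rpow_abs_continuous.
      + now apply HU. }
  destruct (bounded_on_rect U (-1) 1 (-1) 1 HU) as (M0 & HM0 & HUM).
  set (d := fun x y => 1 - Rmax (Rabs x) (Rabs y)).
  assert (Hd : forall x y, -1 <= x <= 1 -> -1 <= y <= 1 -> 0 <= d x y <= 1).
  { intros x y Hx Hy. unfold d.
    assert (Rmax (Rabs x) (Rabs y) <= 1) by (apply Rmax_lub; apply Rabs_le; lra).
    pose proof (Rmax_l (Rabs x) (Rabs y)). pose proof (Rabs_pos x). lra. }
  set (T := fun x y => rpow (d x y) a * U x y).
  assert (HT0 : forall x y, 0 <= T x y) by (intros; apply Rmult_le_pos; [apply rpow_ge_0|apply HU0]).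
  set (E := fun t => exists x y, -1 <= x <= 1 /\ -1 <= y <= 1 /\ t = T x y).
  destruct (completeness E) as [A [HA1 HA2]].
  { exists M0. intros t (x & y & Hx & Hy & ->). unfold T.
    destruct (Hd x y Hx Hy).
    assert (rpow (d x y) a <= 1).
    { rewrite <- (rpow_one a). apply rpow_le; lra. }
    pose proof (rpow_ge_0 (d x y) a). specialize (HUM x y Hx Hy).
    rewrite Rabs_pos_eq in HUM by apply HU0. specialize (HU0 x y). nra. }
  { exists (T 0 0). exists 0, 0. repeat split; lra. }
  assert (HAT : forall x y, -1 <= x <= 1 -> -1 <= y <= 1 -> T x y <= A).
  { intros x y Hx Hy. apply HA1. now exists x, y. }
  assert (HTp : forall x y, -1 <= x <= 1 -> -1 <= y <= 1 -> rpow (T x y) p = d x y * d x y * Up x y).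
  { intros x y Hx Hy. unfold T, Up. rewrite rpow_mult by (try apply rpow_ge_0; apply HU0).
    f_equal. rewrite rpow_rpow by now apply Hd.
    replace (a * p) with 2 by (unfold a; field; lra).
    destruct (Hd x y Hx Hy) as [Hd0 _].
    destruct (Req_dec (d x y) 0) as [E0|E0]; [rewrite E0, rpow_0; ring|].
    rewrite rpow_pos by lra. change 2 with (INR 2). rewrite Rpower_pow by lra. ring. }
  set (I := sqint Up).
  assert (Hkey : rpow A p <= rpow 2 p * (4 * (2 * L / eta_mass) * I)).
  { assert (HI0 : 0 <= I).
    { replace 0 with (4 * 0) by ring. rewrite <- sqint_const. apply sqint_le; [apply on_square_const|assumption|].
      intros; apply rpow_ge_0. }
    assert (HA0 : 0 <= A) by (eapply Rle_trans; [apply (HT0 0 0)|apply HAT; lra]).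
    destruct (Req_dec A 0) as [->|HAne].
    { rewrite rpow_0. apply Rmult_le_pos; [lra|]. apply Rmult_le_pos; lra. }
    assert (Hex : exists x1 y1, -1 <= x1 <= 1 /\ -1 <= y1 <= 1 /\ A / 2 < T x1 y1).
    { apply NNPP. intros Hn. assert (A <= A / 2); [|lra]. apply HA2. intros t (x & y & Hx & Hy & ->).
      apply Rnot_lt_le. intros Hlt. apply Hn. now exists x, y. }
    destruct Hex as (x1 & y1 & Hx1 & Hy1 & HT1).
    destruct (Hd x1 y1 Hx1 Hy1) as [Hd0 Hd1].
    assert (Hdpos : 0 < d x1 y1).
    { destruct (Req_dec (d x1 y1) 0) as [E0|E0]; [|lra]. unfold T in HT1. rewrite E0, rpow_0 in HT1. lra. }
    set (M := U x1 y1).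
    assert (HM : 0 < M).
    { destruct (Req_dec M 0) as [E0|E0]; [|specialize (HU0 x1 y1); fold M in HU0; lra].
      unfold T in HT1. fold M in HT1. rewrite E0 in HT1. lra. }
    (* halving the distance to the boundary loses at most a factor [2 ^ a] in the weight *)
    set (s := d x1 y1 / 2).
    assert (Hs : 0 < s) by (unfold s; lra).
    assert (Hxs : Rabs x1 + 2 * s <= 1) by (unfold s, d; pose proof (Rmax_l (Rabs x1) (Rabs y1)); lra).
    assert (Hys : Rabs y1 + 2 * s <= 1) by (unfold s, d; pose proof (Rmax_r (Rabs x1) (Rabs y1)); lra).
    assert (Hsub : forall x y, -1 <= x <= 1 -> -1 <= y <= 1 ->
      -1 <= x1 + s * x <= 1 /\ -1 <= y1 + s * y <= 1 /\ s <= d (x1 + s * x) (y1 + s * y)).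
    { intros x y Hx Hy.
      assert (Bx : Rabs (s * x) <= s) by (apply Rabs_le; nra).
      assert (By : Rabs (s * y) <= s) by (apply Rabs_le; nra).
      pose proof (Rabs_triang x1 (s * x)). pose proof (Rabs_triang y1 (s * y)).
      split; [apply Rabs_le_between; lra|split; [apply Rabs_le_between; lra|]].
      unfold d. assert (Rmax (Rabs (x1 + s * x)) (Rabs (y1 + s * y)) <= 1 - s) by (apply Rmax_lub; lra). lra. }
    assert (HLM : forall x y, -1 <= x <= 1 -> -1 <= y <= 1 -> U (x1 + s * x) (y1 + s * y) <= Lam * M).
    { intros x y Hx Hy. destruct (Hsub x y Hx Hy) as (B1 & B2 & B3).
      pose proof (HAT _ _ B1 B2) as HB. unfold T in HB.
      pose proof (rpow_gt_0 s a Hs) as Hsa.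
      assert (rpow s a <= rpow (d (x1 + s * x) (y1 + s * y)) a) by (apply rpow_le; lra).
      assert (Hda : rpow (d x1 y1) a = rpow 2 a * rpow s a).
      { rewrite <- rpow_mult by lra. f_equal. unfold s; field. }
      unfold T in HT1. fold M in HT1. rewrite Hda in HT1.
      apply Rmult_le_reg_l with (rpow s a); [assumption|].
      apply Rle_trans with A.
      - eapply Rle_trans; [|apply HB]. apply Rmult_le_compat_r; [apply HU0|assumption].
      - unfold Lam. replace (rpow s a * (2 * rpow 2 a * M)) with (2 * (rpow 2 a * rpow s a * M)) by ring. lra. }
    set (S := sqint (fun x y => Up (x1 + s * x) (y1 + s * y))).
    assert (HcU : on_square (fun x y => U (x1 + s * x) (y1 + s * y))).
    { intros x y Hx Hy.
      apply (continuous_comp_2 (fun q : R * R => x1 + s * fst q) (fun q : R * R => y1 + s * snd q) U); [cont|cont|].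
      apply HU; simpl; destruct (Hsub x y Hx Hy) as (? & ? & ?); assumption. }
    assert (HcUp : on_square (fun x y => Up (x1 + s * x) (y1 + s * y))).
    { intros x y Hx Hy.
      apply (continuous_comp_2 (fun q : R * R => x1 + s * fst q) (fun q : R * R => y1 + s * snd q) Up); [cont|cont|].
      apply HUp; simpl; destruct (Hsub x y Hx Hy) as (? & ? & ?); assumption. }
    assert (Hmv : M * eta_mass <= sqint (fun x y => U (x1 + s * x) (y1 + s * y))).
    { pose proof (area_mean_inequality F F' (pt z rho x1 y1) (rho * s) (rho * s + (rho' - rho))) as Hmv.
      rewrite (sqint_ext _ (fun x y => U (x1 + s * x) (y1 + s * y))) in Hmv.
      - apply Hmv.
        + split; [apply Rmult_lt_0_compat|]; lra.
        + intros w [Hw1 Hw2]. apply H. unfold pt in Hw1, Hw2; simpl in Hw1, Hw2.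
          assert (rho * (Rabs x1 + 2 * s) <= rho * 1) by (apply Rmult_le_compat_l; lra).
          assert (rho * (Rabs y1 + 2 * s) <= rho * 1) by (apply Rmult_le_compat_l; lra).
          assert (0 < rho * s) by (apply Rmult_lt_0_compat; lra).
          split.
          * replace (fst w - fst z) with ((fst w - (fst z + rho * x1)) + rho * x1) by ring.
            eapply Rle_lt_trans; [apply Rabs_triang|].
            rewrite (Rabs_mult rho), (Rabs_pos_eq rho) by lra. lra.
          * replace (snd w - snd z) with ((snd w - (snd z + rho * y1)) + rho * y1) by ring.
            eapply Rle_lt_trans; [apply Rabs_triang|].
            rewrite (Rabs_mult rho), (Rabs_pos_eq rho) by lra. lra.
      - intros x y _ _. now rewrite pt_pt. }
    pose proof (rpow_gt_0 M p HM) as HMp.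
    assert (HS : sqint (fun x y => U (x1 + s * x) (y1 + s * y)) <= 4 * (kap * M) + L * M / rpow M p * S).
    { unfold S. rewrite <- sqint_const, <- sqint_scal, <- sqint_plus by sqcont.
      apply sqint_le; [assumption|sqcont|].
      intros x y Hx Hy.
      pose proof (le_rpow_of_bounded p kap Lam (U (x1 + s * x) (y1 + s * y)) M Hp Hkap (Rlt_le _ _ HLam) HM
        (conj (HU0 _ _) (HLM x y Hx Hy))) as Hle.
      fold L in Hle. unfold Up. unfold Rdiv in *. lra. }
    assert (HMS : rpow M p <= 2 * L / eta_mass * S).
    { assert (Hh : M * eta_mass / 2 <= L * M / rpow M p * S) by (unfold kap in HS; lra).
      apply Rmult_le_reg_l with (M * eta_mass / (2 * rpow M p)).
      - apply Rdiv_lt_0_compat; [now apply Rmult_lt_0_compat|lra].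
      - replace (M * eta_mass / (2 * rpow M p) * rpow M p) with (M * eta_mass / 2) by (field; lra).
        replace (M * eta_mass / (2 * rpow M p) * (2 * L / eta_mass * S)) with (L * M / rpow M p * S) by (field; lra).
        assumption. }
    assert (HSI : s * s * S <= I).
    { apply (sqint_subsquare Up); [assumption|lra|lra|assumption|]. intros; apply rpow_ge_0. }
    assert (HT1p : rpow (T x1 y1) p <= 4 * (2 * L / eta_mass) * I).
    { rewrite HTp by assumption. unfold Up. fold M. replace (d x1 y1) with (2 * s) by (unfold s; field).
      apply Rle_trans with (2 * s * (2 * s) * (2 * L / eta_mass * S)).
      - apply Rmult_le_compat_l; [nra|assumption].
      - replace (2 * s * (2 * s) * (2 * L / eta_mass * S)) with (4 * (2 * L / eta_mass) * (s * s * S)) by ring.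
        apply Rmult_le_compat_l; lra. }
    apply Rle_trans with (rpow (2 * T x1 y1) p); [apply rpow_le; lra|].
    rewrite rpow_mult by (try apply HT0; lra). apply Rmult_le_compat_l; lra. }
  intros x y Hx Hy. change (Up x y <= 16 * rpow 2 p * (2 * L / eta_mass) * I).
  assert (Hx' : -1 <= x <= 1) by lra. assert (Hy' : -1 <= y <= 1) by lra.
  assert (Hdh : / 2 <= d x y).
  { unfold d. assert (Rmax (Rabs x) (Rabs y) <= / 2) by (apply Rmax_lub; apply Rabs_le; lra). lra. }
  assert (HTA : rpow (T x y) p <= rpow A p) by (apply rpow_le; [assumption|split; [apply HT0|now apply HAT]]).
  rewrite HTp in HTA by assumption.
  assert (HUp0 : 0 <= Up x y) by apply rpow_ge_0.
  assert (/ 2 * / 2 <= d x y * d x y) by (apply Rmult_le_compat; lra).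
  assert (/ 4 * Up x y <= d x y * d x y * Up x y) by (apply Rmult_le_compat_r; lra).
  lra.
Qed.

(** * The identity theorem *)

(** Continuity of the derivative is included so that integrals involving [F] can
    be differentiated in a parameter. *)
Definition holomorphic (F F' : C -> C) : Prop :=
  forall w, unit_disk w -> hol F w (F' w) /\ continuous F' w.

Lemma Cmod_circle_point : forall r t, 0 <= r -> Cmod (circle_point r t) = r.
Proof.
  intros r t HR. unfold Cmod, circle_point; simpl fst; simpl snd.
  replace ((r * cos t) ^ 2 + (r * sin t) ^ 2) with (r ^ 2 * (Rsqr (sin t) + Rsqr (cos t))) by (unfold Rsqr; ring).
  rewrite sin2_cos2, Rmult_1_r. now apply sqrt_pow2.
Qed.

Lemma Cmod_sqr : forall z, Cmod z * Cmod z = fst z * fst z + snd z * snd z.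
Proof.
  intros z. unfold Cmod. rewrite sqrt_sqrt; [ring|]. apply Rplus_le_le_0_compat; apply pow2_ge_0.
Qed.

(** [zeta / (zeta - z) = 1 / (1 - w)] with [|w| < 1], and the map [1 / (1 - w)]
    sends the unit disk onto the half-plane of real part above [1 / 2]. *)
Lemma Re_cauchy_kernel_ge : forall zeta z, Cmod z < Cmod zeta -> / 2 <= Re (zeta / (zeta - z))%C.
Proof.
  intros zeta z H. pose proof (Cmod_ge_0 z).
  pose proof (Cmod_sqr z) as A. pose proof (Cmod_sqr zeta) as B.
  assert (HAB : fst z * fst z + snd z * snd z < fst zeta * fst zeta + snd zeta * snd zeta) by (rewrite <- A, <- B; nra).
  assert (Hne : (zeta - z)%C <> 0%C).
  { intros E. assert (zeta = z) by (replace zeta with ((zeta - z) + z)%C by ring; rewrite E; ring). subst; lra. }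
  apply Cmod_gt_0 in Hne. pose proof (Cmod_sqr (zeta - z)%C) as D.
  destruct zeta as [a b], z as [x y]. simpl in *.
  unfold Re, Cdiv, Cinv; simpl.
  assert (HD : 0 < (a + - x) * (a + - x) + (b + - y) * (b + - y)) by nra.
  replace (a * ((a + - x) / ((a + - x) * ((a + - x) * 1) + (b + - y) * ((b + - y) * 1))) -
    b * (- (b + - y) / ((a + - x) * ((a + - x) * 1) + (b + - y) * ((b + - y) * 1))))
    with ((a * (a + - x) + b * (b + - y)) / ((a + - x) * (a + - x) + (b + - y) * (b + - y))) by (field; lra).
  apply Rmult_le_reg_r with ((a + - x) * (a + - x) + (b + - y) * (b + - y)); [assumption|].
  unfold Rdiv. rewrite (Rmult_assoc _ (/ _)), Rinv_l by lra. nra.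
Qed.

Lemma continuous_Cinv : forall z : C, z <> 0%C -> continuous Cinv z.
Proof.
  intros z Hz. apply Cmod_gt_0 in Hz. pose proof (Cmod_sqr z).
  assert (Hd : continuous (fun w : C => / (fst w ^ 2 + snd w ^ 2)) z).
  { apply (cont_comp Rinv (fun w : C => fst w ^ 2 + snd w ^ 2)).
    - apply (ex_derive_continuous (V := R_NormedModule)). auto_derive. nra.
    - apply continuous_ext with (fun w : C => fst w * fst w + snd w * snd w); [|cont].
      intros w. match goal with |- ?a = ?b => change (a = b :> R) end. ring. }
  unfold Cinv, Rdiv. cont.
Qed.

Lemma hol_Cinv : forall z : C, z <> 0%C -> hol Cinv z (- / (z * z))%C.
Proof.
  intros z Hz. pose proof (proj1 (Cmod_gt_0 z) Hz) as Hm.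
  assert (Hloc : locally z (fun w : C => 0 < Cmod w)).
  { apply (cont_Cmod (fun w => w) z (continuous_id _)). now apply open_gt. }
  assert (Hsq : forall w : C, 0 < Cmod w -> 0 < fst w * fst w + snd w * snd w).
  { intros w Hw. rewrite <- Cmod_sqr. nra. }
  destruct z as [x y].
  apply (hol_of_C1 Cinv (fun z => - / (z * z))%C).
  - apply filter_imp with (2 := Hloc). intros [a b] Hw. specialize (Hsq _ Hw). unfold Cinv, Re, Im; simpl in *.
    split; auto_derive; try nra; field; split; nra.
  - specialize (Hsq _ Hm). unfold Cinv, Re, Im; simpl in *. auto_derive; try nra; field; split; nra.
  - specialize (Hsq _ Hm). unfold Cinv, Re, Im; simpl in *. auto_derive; try nra; field; split; nra.
  - assert (Hc : continuous (fun z : C => / (z * z))%C (x, y)).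
    { apply (continuous_comp (fun z : C => z * z)%C Cinv); [apply cont_Cmult; apply continuous_id|].
      apply continuous_Cinv. now apply Cmult_neq_0. }
    unfold Copp. cont.
Qed.

(** Contract the circle to [z] along segments, keeping the Cauchy kernel [k] of
    the original circle: the derivative of the integral of [G k] in the
    contraction parameter is the integral of an exact derivative in the angle,
    hence zero. At the end point the integral is [G z] times the integral of the
    kernel, whose real part is at least [1 / 2]. *)
Lemma cauchy_estimate : forall F F' z r M, holomorphic F F' -> Cmod z < r < 1 ->
  (forall t, 0 <= t <= 2 * PI -> Cmod (F (circle_point r t)) <= M) -> Cmod (F z) <= 2 * r / (r - Cmod z) * M.
Proof.
  intros F F' z r M HF HR HM.
  pose proof (Cmod_ge_0 z) as Hz0. pose proof PI_RGT_0 as HPI.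
  destruct (Req_dec (Cmod (F z)) 0) as [E0|Hne].
  { rewrite E0. assert (0 <= M) by (eapply Rle_trans; [apply Cmod_ge_0|apply (HM 0); lra]).
    apply Rmult_le_pos; [|assumption]. unfold Rdiv; apply Rmult_le_pos; [lra|]. left; apply Rinv_0_lt_compat; lra. }
  pose proof (Cmod_ge_0 (F z)) as HFz.
  (* rotate so that the value at [z] is a positive real number *)
  set (u := (Cconj (F z) / Cmod (F z))%C).
  assert (Hu1 : Cmod u = 1).
  { unfold u. rewrite Cmod_div by (intros E; apply Hne; apply RtoC_inj in E; exact E).
    rewrite Cmod_conj, Cmod_R, Rabs_pos_eq by assumption. field; assumption. }
  assert (Hu2 : (u * F z)%C = RtoC (Cmod (F z))).
  { unfold u. pose proof (Cmod_sqr (F z)) as HS.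
    assert (E : (Cconj (F z) * F z)%C = RtoC (Cmod (F z) * Cmod (F z))).
    { rewrite HS. destruct (F z) as [a b]; unfold Cconj, Cmult, RtoC; simpl; f_equal; ring. }
    replace (Cconj (F z) / Cmod (F z) * F z)%C with (/ Cmod (F z) * (Cconj (F z) * F z))%C by (unfold Cdiv; ring).
    rewrite E, RtoC_mult. field. intros E2; apply Hne; apply RtoC_inj in E2; exact E2. }
  set (G := fun w => (u * F w)%C). set (G' := fun w => (u * F' w)%C).
  assert (HG : holomorphic G G').
  { intros w Hw. destruct (HF w Hw). split; [now apply hol_scal|]. apply cont_Cmult; [apply continuous_const|assumption]. }
  assert (HGM : forall t, 0 <= t <= 2 * PI -> Cmod (G (circle_point r t)) <= M).
  { intros t Ht. unfold G. rewrite Cmod_mult, Hu1, Rmult_1_l. now apply HM. }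
  set (k := fun t => (circle_point r t / (circle_point r t - z))%C).
  assert (Hne2 : forall t, (circle_point r t - z)%C <> 0%C).
  { intros t E. assert (circle_point r t = z) by (replace (circle_point r t) with ((circle_point r t - z) + z)%C by ring; rewrite E; ring).
    pose proof (Cmod_circle_point r t). rewrite H in H0. lra. }
  assert (Hck : forall t, continuous k t).
  { intros t. unfold k, Cdiv. apply cont_Cmult; [unfold circle_point; cont|].
    apply (continuous_comp (fun t => circle_point r t - z)%C Cinv); [|apply continuous_Cinv, Hne2].
    unfold Cminus. apply cont_Cplus; [unfold circle_point; cont|apply continuous_const]. }
  set (g := fun l t : R => (fst z + l * (r * cos t - fst z), snd z + l * (r * sin t - snd z)) : C).
  assert (Hg : forall l t, g l t = ((1 - l)%R * z + l * circle_point r t)%C).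
  { intros l t. destruct z as [a b]; unfold g, circle_point, Cplus, Cmult, RtoC; simpl; f_equal; ring. }
  assert (Hdom : forall l t, Rabs (1 - l) * Cmod z + Rabs l * r < 1 -> unit_disk (g l t)).
  { intros l t Hl. unfold unit_disk. rewrite Hg. eapply Rle_lt_trans; [apply Cmod_triangle|].
    rewrite !Cmod_mult, !Cmod_R, Cmod_circle_point by lra. assumption. }
  set (f := fun l t => Re (G (g l t) * k t)%C).
  set (df := fun l t => Re (G' (g l t) * circle_point r t)%C).
  assert (Hgc : forall l t, continuous (fun q : R * R => g (fst q) (snd q)) (l, t)) by (intros; unfold g; cont).
  assert (Hgc2 : forall l t, continuous (g l) t) by (intros; unfold g; cont).
  assert (HJ : forall l, Rabs (1 - l) * Cmod z + Rabs l * r < 1 ->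
    is_derive (fun l => RInt (f l) 0 (2 * PI)) l (RInt (df l) 0 (2 * PI))).
  { intros l Hl. apply is_derive_RInt_rect; [lra| |].
    - apply (locally_lt (fun l => Rabs (1 - l) * Cmod z + Rabs l * r) l 1) in Hl; [|cont].
      apply filter_imp with (2 := Hl). intros l' Hl' t Ht.
      destruct (HG (g l' t) (Hdom l' t Hl')) as [H1 H2].
      split.
      + destruct (hol_curve G (fun l => fst z + l * (r * cos t - fst z)) (fun l => snd z + l * (r * sin t - snd z)) l'
          (G' (g l' t)) (r * cos t - fst z) (r * sin t - snd z) H1) as [D1 D2];
          [auto_derive; trivial; ring|auto_derive; trivial; ring|].
        set (dz := (r * cos t - fst z, r * sin t - snd z) : C) in *.
        unfold f, df.
        replace (Re (G' (g l' t) * circle_point r t)%C) with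
          (Re (k t) * Re (G' (g l' t) * dz)%C - Im (k t) * Im (G' (g l' t) * dz)%C).
        * apply is_derive_ext with (fun l => Re (k t) * Re (G (g l t)) - Im (k t) * Im (G (g l t))).
          -- intros l2. unfold Re, Im; simpl. match goal with |- ?a = ?b => change (a = b :> R) end. ring.
          -- apply (is_derive_minus (V := R_NormedModule)); apply is_derive_scal; assumption.
        * assert (Ek : (k t * (circle_point r t - z))%C = circle_point r t) by (unfold k; field; apply Hne2).
          replace dz with (circle_point r t - z)%C by (destruct z; reflexivity).
          rewrite <- Ek at 3. unfold Re, Im; simpl. ring.
      + unfold f. apply cont_Re. apply cont_Cmult; [|apply Hck].
        apply (continuous_comp (g l') G); [apply Hgc2|eapply hol_continuous; exact H1].
    - intros t Ht. unfold df. apply cont_Re. apply cont_Cmult.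
      + apply (continuous_comp (fun q : R * R => g (fst q) (snd q)) G'); [apply Hgc|]. now apply HG, Hdom.
      + unfold circle_point; cont. }
  assert (HJ0 : forall l, 0 < l -> Rabs (1 - l) * Cmod z + Rabs l * r < 1 -> RInt (df l) 0 (2 * PI) = 0).
  { intros l Hl0 Hl.
    assert (D : forall t, is_derive (fun t => Im (G (g l t))) t (l * df l t)).
    { intros t. destruct (HG (g l t) (Hdom l t Hl)) as [H1 _].
      destruct (hol_curve G (fun t => fst z + l * (r * cos t - fst z)) (fun t => snd z + l * (r * sin t - snd z)) t
          (G' (g l t)) (- l * (r * sin t)) (l * (r * cos t)) H1) as [_ D2];
          [auto_derive; trivial; ring|auto_derive; trivial; ring|].
      set (dz := (- l * (r * sin t), l * (r * cos t)) : C) in *.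
      replace (l * df l t) with (Im (G' (g l t) * dz)%C); [exact D2|]. unfold dz.
      unfold df, Re, Im, circle_point; simpl. ring. }
    assert (Hcd : forall t, continuous (df l) t).
    { intros t. unfold df. apply cont_Re. apply cont_Cmult; [|unfold circle_point; cont].
      apply (continuous_comp (g l) G'); [apply Hgc2|]. now apply HG, Hdom. }
    assert (E : RInt (fun t => l * df l t) 0 (2 * PI) = 0).
    { assert (HI : is_RInt (fun t => l * df l t) 0 (2 * PI) (Im (G (g l (2 * PI))) - Im (G (g l 0)))).
      { apply (is_RInt_derive (V := R_CompleteNormedModule) (fun t => Im (G (g l t)))); intros t _; [apply D|].
        apply cont_mult; [apply cont_const|apply Hcd]. }
      rewrite (is_RInt_unique _ _ _ _ HI).
      replace (g l (2 * PI)) with (g l 0); [apply Rminus_diag|].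
      unfold g. now rewrite cos_2PI, sin_2PI, cos_0, sin_0. }
    rewrite RInt_scal_R in E by (apply ex_RInt_cont; [lra|intros; apply Hcd]).
    apply Rmult_eq_reg_l with l; lra. }
  assert (Hd01 : forall l, 0 <= l <= 1 -> Rabs (1 - l) * Cmod z + Rabs l * r < 1).
  { intros l Hl. rewrite !Rabs_pos_eq by lra. nra. }
  assert (HE : RInt (f 1) 0 (2 * PI) = RInt (f 0) 0 (2 * PI)).
  { destruct (MVT_gen (fun l => RInt (f l) 0 (2 * PI)) 0 1 (fun _ => 0)) as (c & _ & Hc).
    - rewrite Rmin_left, Rmax_right by lra. intros l Hl.
      assert (Hl' : 0 <= l <= 1) by lra. pose proof (HJ l (Hd01 l Hl')) as D.
      rewrite (HJ0 l) in D by (try apply Hd01; lra). exact D.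
    - rewrite Rmin_left, Rmax_right by lra. intros l Hl.
      apply continuity_pt_filterlim. apply (ex_derive_continuous (V := R_NormedModule) (fun l => RInt (f l) 0 (2 * PI))).
      exact (ex_intro _ _ (HJ l (Hd01 l Hl))).
    - lra. }
  assert (Hf0 : PI * Cmod (F z) <= RInt (f 0) 0 (2 * PI)).
  { replace (PI * Cmod (F z)) with (RInt (fun _ => Cmod (F z) / 2) 0 (2 * PI)).
    2:{ rewrite RInt_const. change ((2 * PI - 0) * (Cmod (F z) / 2) = PI * Cmod (F z)). field. }
    assert (Ef : forall t, f 0 t = Cmod (F z) * Re (k t)).
    { intros t. unfold f. replace (g 0 t) with z by (unfold g; rewrite !Rmult_0_l, !Rplus_0_r; apply surjective_pairing).
      unfold G. rewrite Hu2. unfold Re; simpl. ring. }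
    apply RInt_le_mono; [lra|apply ex_RInt_const| |].
    - apply ex_RInt_cont; [lra|]. intros t _. apply continuous_ext with (fun t => Cmod (F z) * Re (k t)).
      + intros; symmetry; apply Ef.
      + apply cont_mult; [apply cont_const|apply cont_Re, Hck].
    - intros t _. rewrite Ef. unfold Rdiv. apply Rmult_le_compat_l; [assumption|].
      apply Re_cauchy_kernel_ge. rewrite Cmod_circle_point; lra. }
  assert (Hf1 : RInt (f 1) 0 (2 * PI) <= 2 * PI * (M * (r / (r - Cmod z)))).
  { replace (2 * PI * (M * (r / (r - Cmod z)))) with (RInt (fun _ => M * (r / (r - Cmod z))) 0 (2 * PI)).
    2:{ rewrite RInt_const. change ((2 * PI - 0) * (M * (r / (r - Cmod z))) = 2 * PI * (M * (r / (r - Cmod z)))). ring. }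
    apply RInt_le_mono; [lra| |apply ex_RInt_const|].
    - apply ex_RInt_cont; [lra|]. intros t _. unfold f. apply cont_Re. apply cont_Cmult; [|apply Hck].
      apply (continuous_comp (g 1) G); [apply Hgc2|].
      eapply hol_continuous. apply HG, Hdom, Hd01. lra.
    - intros t Ht. unfold f. eapply Rle_trans; [apply Rle_abs|]. eapply Rle_trans; [apply Re_le_Cmod|].
      rewrite Cmod_mult. apply Rmult_le_compat; try apply Cmod_ge_0.
      + replace (g 1 t) with (circle_point r t); [now apply HGM|]. unfold g, circle_point; f_equal; ring.
      + unfold k. rewrite Cmod_div by apply Hne2. rewrite Cmod_circle_point by lra.
        unfold Rdiv. apply Rmult_le_compat_l; [lra|]. apply Rinv_le_contravar; [lra|].
        pose proof (Cmod_triangle (circle_point r t - z) z) as T.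
        replace (circle_point r t - z + z)%C with (circle_point r t) in T by ring. rewrite Cmod_circle_point in T by lra. lra. }
  apply Rmult_le_reg_l with PI; [assumption|].
  replace (PI * (2 * r / (r - Cmod z) * M)) with (2 * PI * (M * (r / (r - Cmod z)))) by (field; lra).
  lra.
Qed.

Lemma unit_disk_open : forall z, unit_disk z -> locally z unit_disk.
Proof. intros z Hz. apply (locally_lt Cmod z 1 (cont_Cmod (fun w => w) z (continuous_id _)) Hz). Qed.

(** The reciprocal of the disk automorphism sending [c] to [0]: its modulus is 1 on
    the unit circle and larger inside. *)
Definition blaschke_inv (c w : C) : C := ((1 - Cconj c * w) * / (w - c))%C.

Lemma hol_blaschke_inv : forall c w, w <> c ->
  hol (blaschke_inv c) w (- Cconj c * / (w - c) + (1 - Cconj c * w) * (- / ((w - c) * (w - c))))%C /\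
  continuous (fun w => - Cconj c * / (w - c) + (1 - Cconj c * w) * (- / ((w - c) * (w - c))))%C w.
Proof.
  intros c w Hw.
  assert (Hn : (w - c)%C <> 0%C).
  { intros E. apply Hw. replace w with ((w - c) + c)%C by ring. rewrite E. ring. }
  assert (H1 : hol (fun w => 1 - Cconj c * w)%C w (- Cconj c)%C).
  { eapply hol_eq; [|apply (hol_plus (fun _ => 1%C) (fun w => - (Cconj c * w))%C)].
    2: apply hol_const.
    2:{ apply hol_ext_loc with (fun w => (- Cconj c) * w)%C.
        - apply filter_forall. intros; ring.
        - apply hol_scal, hol_id. }
    ring. }
  assert (H2 : hol (fun w => w - c)%C w 1%C).
  { eapply hol_eq; [|apply (hol_plus (fun w => w) (fun _ => - c)%C); [apply hol_id|apply hol_const]]. ring. }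
  assert (Hc2 : continuous (fun w => w - c)%C w) by (eapply hol_continuous; exact H2).
  split.
  - eapply hol_eq; [|apply (hol_mult _ _ _ _ _ H1 (hol_comp Cinv (fun w => w - c)%C w _ _ (hol_Cinv _ Hn) H2))]. ring.
  - apply cont_Cplus.
    + apply cont_Cmult; [apply continuous_const|]. apply (continuous_comp (fun w => w - c)%C Cinv); [assumption|now apply continuous_Cinv].
    + apply cont_Cmult; [eapply hol_continuous; exact H1|].
      apply continuous_ext with (fun w => (-1) * / ((w - c) * (w - c)))%C; [intros u; match goal with |- ?a = ?b => change (@eq C a b) end; ring|].
      apply cont_Cmult; [apply continuous_const|].
      apply (continuous_comp (fun w => (w - c) * (w - c))%C Cinv); [now apply cont_Cmult|].
      apply continuous_Cinv. now apply Cmult_neq_0.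
Qed.

(** The pole at [c] is harmless because [F] vanishes in a neighbourhood of it. *)
Lemma holomorphic_mult_blaschke_inv : forall F F' c, unit_disk c -> holomorphic F F' ->
  locally c (fun w => F w = 0%C) ->
  exists G', holomorphic (fun w => F w * blaschke_inv c w)%C G'.
Proof.
  intros F F' c Hc HF H0.
  set (q' := fun w => (- Cconj c * / (w - c) + (1 - Cconj c * w) * (- / ((w - c) * (w - c))))%C).
  exists (fun w => F' w * blaschke_inv c w + F w * q' w)%C. intros w Hw.
  destruct (classic (w = c)) as [->|Hne].
  - assert (HF'0 : locally c (fun w => F w = 0%C /\ F' w = 0%C)).
    { apply locally_locally in H0. generalize (filter_and _ _ H0 (unit_disk_open c Hc)). apply filter_imp.
      intros v [Hv Hvd]. split; [exact (locally_singleton _ _ Hv)|].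
      apply (hol_unique F v); [now apply HF|].
      apply hol_ext_loc with (fun _ => 0%C); [|apply hol_const].
      apply filter_imp with (2 := Hv). now intros u ->. }
    split.
    + destruct (locally_singleton _ _ HF'0) as [E1 E2]. rewrite E1, E2.
      apply hol_ext_loc with (fun _ => 0%C).
      * apply filter_imp with (2 := H0). intros u ->. ring.
      * eapply hol_eq; [|apply hol_const]. ring.
    + apply (continuous_ext_loc (T := C_UniformSpace) (U := C_UniformSpace) _ (fun _ : C => RtoC 0)); [|apply continuous_const].
      apply filter_imp with (2 := HF'0). intros u [-> ->]. match goal with |- ?a = ?b => change (@eq C a b) end. ring.
  - destruct (hol_blaschke_inv c w Hne) as [H1 H2]. destruct (HF w Hw) as [H3 H4].
    split; [now apply hol_mult|].
    apply cont_Cplus; apply cont_Cmult; try assumption; eapply hol_continuous; eassumption.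
Qed.

Lemma holomorphic_mult_blaschke_inv_pow : forall F F' c n, unit_disk c -> holomorphic F F' ->
  locally c (fun w => F w = 0%C) ->
  exists G', holomorphic (fun w => F w * pow_n (K := C_Ring) (blaschke_inv c w) n)%C G'.
Proof.
  intros F F' c n Hc HF H0. induction n as [|n [G' IH]].
  - exists F'. intros w Hw. destruct (HF w Hw). split; [|assumption].
    apply hol_ext_loc with F; [|assumption]. apply filter_forall. intros u. simpl. symmetry. apply Cmult_1_r.
  - destruct (holomorphic_mult_blaschke_inv _ _ c Hc IH) as [G2 HG2].
    + apply filter_imp with (2 := H0). intros u ->. ring.
    + exists G2. intros w Hw. destruct (HG2 w Hw). split; [|assumption].
      eapply hol_ext_loc; [|eassumption]. apply filter_forall. intros u. simpl. unfold mult; simpl. ring.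
Qed.

Lemma Cmod_pow_n : forall z n, Cmod (pow_n (K := C_Ring) z n) = Cmod z ^ n.
Proof.
  intros z n. induction n as [|n IH]; simpl; [apply Cmod_1|].
  change (Cmod (z * pow_n (K := C_Ring) z n)%C = Cmod z * Cmod z ^ n). now rewrite Cmod_mult, IH.
Qed.

(** From the identity
    [|1 - conj c w|^2 - |w - c|^2 = (1 - |w|^2) (1 - |c|^2)]. *)
Lemma Cmod_blaschke_inv_sqr : forall c w, w <> c ->
  Cmod (blaschke_inv c w) ^ 2 = 1 + (1 - Cmod w ^ 2) * (1 - Cmod c ^ 2) / Cmod (w - c) ^ 2.
Proof.
  intros c w Hne.
  assert (Hn : (w - c)%C <> 0%C).
  { intros E. apply Hne. replace w with ((w - c) + c)%C by ring. rewrite E. ring. }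
  pose proof (proj1 (Cmod_gt_0 _) Hn) as Hm.
  unfold blaschke_inv. rewrite Cmod_mult, Cmod_inv by assumption.
  assert (E : Cmod (1 - Cconj c * w)%C ^ 2 = Cmod (w - c) ^ 2 + (1 - Cmod w ^ 2) * (1 - Cmod c ^ 2)).
  { simpl. rewrite !Rmult_1_r, !Cmod_sqr. destruct c, w; unfold Cconj, Cminus, Cplus, Copp, Cmult, RtoC; simpl. ring. }
  rewrite Rpow_mult_distr, E. field. lra.
Qed.

(** A zero of infinite order can be divided by every power of the Blaschke factor
    vanishing at [c]. On circles close to the unit circle, where this factor is
    almost unimodular, the quotients grow more slowly than at [z], which
    contradicts the Cauchy estimate unless [F z = 0]. *)
Theorem identity_theorem : forall F F' c, unit_disk c -> holomorphic F F' ->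
  locally c (fun w => F w = 0%C) -> forall z, unit_disk z -> F z = 0%C.
Proof.
  intros F F' c Hc HF H0 z Hz. unfold unit_disk in Hc, Hz.
  destruct (classic (z = c)) as [->|Hne]; [exact (locally_singleton _ _ H0)|].
  apply NNPP. intros HFz. apply Cmod_gt_0 in HFz.
  pose proof (Cmod_ge_0 z) as Hz0. pose proof (Cmod_ge_0 c) as Hc0.
  assert (Hzc : 0 < Cmod (z - c)).
  { apply Cmod_gt_0. intros E. apply Hne. replace z with ((z - c) + c)%C by ring. rewrite E. ring. }
  set (sig := (1 - Cmod z ^ 2) / Cmod (z - c) ^ 2).
  assert (Hsig : 0 < sig) by (apply Rdiv_lt_0_compat; [nra|nra]).
  set (m := Rmax (Cmod z) (Cmod c)).
  assert (Hm1 : m < 1) by now apply Rmax_lub_lt.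
  assert (Hmz : Cmod z <= m) by apply Rmax_l. assert (Hmc : Cmod c <= m) by apply Rmax_r.
  (* [|blaschke_inv c|^2 = 1 + sig (1 - |c|^2)] at [z]; on the circle of radius
     [1 - e] the factor [sig] is replaced by at most
     [2 e / ((1 - m) / 2)^2 <= sig / 2] *)
  set (e := Rmin ((1 - m) / 4) (sig * (1 - m) ^ 2 / 16)).
  assert (He0 : 0 < e).
  { apply Rmin_glb_lt; [lra|]. assert (0 < (1 - m) ^ 2) by nra. assert (0 < sig * (1 - m) ^ 2) by (now apply Rmult_lt_0_compat). lra. }
  assert (He1 : e <= (1 - m) / 4) by apply Rmin_l.
  assert (He2 : e <= sig * (1 - m) ^ 2 / 16) by apply Rmin_r.
  set (r := 1 - e).
  assert (Er : r = 1 - e) by reflexivity.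
  set (Q := Cmod (blaschke_inv c z)).
  assert (HQ2 : Q ^ 2 = 1 + sig * (1 - Cmod c ^ 2)).
  { unfold Q. rewrite Cmod_blaschke_inv_sqr by assumption. unfold sig. field. lra. }
  assert (Hc2 : 0 < 1 - Cmod c ^ 2) by nra.
  assert (HQ0 : 1 < Q).
  { assert (0 < sig * (1 - Cmod c ^ 2)) by now apply Rmult_lt_0_compat.
    pose proof (Cmod_ge_0 (blaschke_inv c z)). fold Q in H1. nra. }
  set (kap := sqrt (1 + sig / 2 * (1 - Cmod c ^ 2))).
  assert (Hkin : 0 < 1 + sig / 2 * (1 - Cmod c ^ 2)).
  { assert (0 < sig / 2 * (1 - Cmod c ^ 2)) by (apply Rmult_lt_0_compat; lra). lra. }
  assert (Hk2 : kap ^ 2 = 1 + sig / 2 * (1 - Cmod c ^ 2)) by (unfold kap; rewrite <- Rsqr_pow2; apply Rsqr_sqrt; lra).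
  assert (Hk0 : 0 < kap) by now apply sqrt_lt_R0.
  assert (HkQ : kap < Q).
  { assert (0 < sig * (1 - Cmod c ^ 2)) by now apply Rmult_lt_0_compat. nra. }
  assert (Hcirc : forall t, Cmod (blaschke_inv c (circle_point r t)) <= kap).
  { intros t. assert (Hr : Cmod (circle_point r t) = r) by (apply Cmod_circle_point; lra).
    assert (Hd : (1 - m) / 2 <= Cmod (circle_point r t - c)).
    { pose proof (Cmod_triangle (circle_point r t - c) c) as T.
      replace (circle_point r t - c + c)%C with (circle_point r t) in T by ring. rewrite Hr in T. lra. }
    assert (Hcne : circle_point r t <> c).
    { intros E. rewrite E in Hr. lra. }
    apply Rsqr_incr_0_var; [|lra]. rewrite !Rsqr_pow2, Hk2, Cmod_blaschke_inv_sqr, Hr by assumption.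
    apply Rplus_le_compat_l.
    replace ((1 - r ^ 2) * (1 - Cmod c ^ 2) / Cmod (circle_point r t - c) ^ 2)
      with ((1 - r ^ 2) / Cmod (circle_point r t - c) ^ 2 * (1 - Cmod c ^ 2)) by (field; lra).
    apply Rmult_le_compat_r; [lra|].
    assert (Hd2 : ((1 - m) / 2) ^ 2 <= Cmod (circle_point r t - c) ^ 2) by (apply pow_incr; lra).
    assert (Hd3 : 0 < ((1 - m) / 2) ^ 2) by nra.
    apply Rmult_le_reg_r with (Cmod (circle_point r t - c) ^ 2); [lra|].
    unfold Rdiv at 1. rewrite Rmult_assoc, Rinv_l, Rmult_1_r by lra.
    apply Rle_trans with (sig / 2 * ((1 - m) / 2) ^ 2).
    - rewrite Er. nra.
    - apply Rmult_le_compat_l; lra. }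
  destruct (bounded_on_rect (fun t _ => Cmod (F (circle_point r t))) 0 (2 * PI) 0 1) as (M & HM & HMb).
  { intros t y _ _. apply (continuous_comp (fun q : R * R => fst q) (fun t => Cmod (F (circle_point r t)))); [cont|].
    apply cont_Cmod. apply (continuous_comp (circle_point r) F); [unfold circle_point; cont|].
    eapply hol_continuous. apply HF. unfold unit_disk. rewrite Cmod_circle_point; lra. }
  assert (HMall : forall t, 0 <= t <= 2 * PI -> Cmod (F (circle_point r t)) <= M).
  { intros t Ht. rewrite <- (Rabs_pos_eq (Cmod _)) by apply Cmod_ge_0. apply (HMb t 0); lra. }
  assert (Hn : forall n, Cmod (F z) <= 2 * r / (r - Cmod z) * M * (kap / Q) ^ n).
  { intros n. destruct (holomorphic_mult_blaschke_inv_pow F F' c n Hc HF H0) as [G' HG].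
    assert (HB : Cmod (F z) * Q ^ n <= 2 * r / (r - Cmod z) * (M * kap ^ n)).
    { unfold Q. rewrite <- Cmod_pow_n, <- Cmod_mult.
      apply (cauchy_estimate _ G' z r (M * kap ^ n) HG); [lra|].
      intros t Ht. rewrite Cmod_mult, Cmod_pow_n. apply Rmult_le_compat; [apply Cmod_ge_0|apply pow_le, Cmod_ge_0|now apply HMall|].
      apply pow_incr. split; [apply Cmod_ge_0|apply Hcirc]. }
    assert (HQn : 0 < Q ^ n) by (apply pow_lt; lra).
    apply Rmult_le_reg_r with (Q ^ n); [assumption|]. unfold Rdiv at 2. rewrite Rpow_mult_distr, pow_inv.
    replace (2 * r / (r - Cmod z) * M * (kap ^ n * / Q ^ n) * Q ^ n) with (2 * r / (r - Cmod z) * (M * kap ^ n)) by (field; lra).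
    assumption. }
  set (B := 2 * r / (r - Cmod z) * M).
  assert (HB0 : 0 < B). { unfold B. apply Rmult_lt_0_compat; [|assumption]. apply Rdiv_lt_0_compat; lra. }
  assert (Hkq : Rabs (kap / Q) < 1).
  { rewrite Rabs_pos_eq; [|left; apply Rdiv_lt_0_compat; lra]. apply Rmult_lt_reg_r with Q; [lra|].
    unfold Rdiv; rewrite Rmult_assoc, Rinv_l; lra. }
  assert (Hfb : 0 < Cmod (F z) / B) by (apply Rdiv_lt_0_compat; assumption).
  destruct (pow_lt_1_zero _ Hkq _ Hfb) as [N HN].
  specialize (HN N (le_n N)). specialize (Hn N). fold B in Hn.
  pose proof (Rle_abs ((kap / Q) ^ N)).
  assert (B * (kap / Q) ^ N < B * (Cmod (F z) / B)) by (apply Rmult_lt_compat_l; lra).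
  replace (B * (Cmod (F z) / B)) with (Cmod (F z)) in H1 by (field; lra). lra.
Qed.

(** * Harmonic quasiregular mappings *)

(** If [Re F = u] is harmonic, then [F' = u_x - i u_y] is continuously
    differentiable and satisfies the Cauchy-Riemann equations by Laplace's
    equation and the symmetry of the second derivatives. *)
Lemma harmonic_real_part : forall u F F', harmonic u ->
  (forall z, unit_disk z -> hol F z (F' z)) ->
  (forall z, unit_disk z -> Re (F z) = u z) ->
  holomorphic F F' /\ exists F'', holomorphic F' F''.
Proof.
  intros u F F' Hu HF HR.
  set (ux := fun s t => Derive (fun a => u (a, t)) s).
  set (uy := fun s t => Derive (fun b => u (s, b)) t).
  set (Fd := fun z : C => (ux (fst z) (snd z), - uy (fst z) (snd z)) : C).
  set (Fdd := fun z : C => (Derive (fun s => ux s (snd z)) (fst z), - Derive (fun s => uy s (snd z)) (fst z)) : C).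
  assert (Hd : forall z, unit_disk z -> F' z = Fd z).
  { intros [x y] Hz. destruct (hol_partials F x y _ (HF _ Hz)) as (A & _ & B & _).
    assert (L := unit_disk_open _ Hz). destruct L as [del L].
    assert (A' : Derive (fun a => Re (F (a, y))) x = Re (F' (x, y))) by (apply is_derive_unique; exact A).
    assert (B' : Derive (fun b => Re (F (x, b))) y = - Im (F' (x, y))) by (apply is_derive_unique; exact B).
    unfold Fd, ux, uy; simpl.
    rewrite (Derive_ext_loc (fun a => u (a, y)) (fun a => Re (F (a, y)))).
    2:{ exists del. intros s Hs. symmetry. apply HR, L. split; [exact Hs|apply ball_center]. }
    rewrite (Derive_ext_loc (fun b => u (x, b)) (fun b => Re (F (x, b)))).
    2:{ exists del. intros s Hs. symmetry. apply HR, L. split; [apply ball_center|exact Hs]. }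
    change (F' (x, y) = (Derive (fun a => Re (F (a, y))) x, - Derive (fun b => Re (F (x, b))) y)).
    rewrite A', B', Ropp_involutive. apply surjective_pairing. }
  assert (Hprop : forall x y, unit_disk (x, y) ->
    (continuity_2d_pt ux x y /\ continuity_2d_pt uy x y) /\
    (ex_derive (fun s => u (s, y)) x /\ ex_derive (fun t => u (x, t)) y) /\
    (ex_derive (fun s => ux s y) x /\ ex_derive (fun t => ux x t) y) /\
    (ex_derive (fun s => uy s y) x /\ ex_derive (fun t => uy x t) y) /\
    continuity_2d_pt (fun s t => Derive (fun a => ux a t) s) x y /\
    continuity_2d_pt (fun s t => Derive (fun b => ux s b) t) x y /\
    continuity_2d_pt (fun s t => Derive (fun a => uy a t) s) x y /\
    Derive (fun s => ux s y) x + Derive (fun t => uy x t) y = 0).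
  { intros x y Hz. destruct (Hu x y Hz) as [Hdiff Hlap]. simpl in Hdiff.
    destruct Hdiff as (_ & D1 & D2 & (C1 & D3 & D4 & C3 & C4) & (C2 & D5 & D6 & C5 & _)).
    repeat match goal with |- _ /\ _ => split end; try assumption.
    - apply C3.
    - apply C4.
    - apply C5. }
  assert (Hloc2 : forall x y, unit_disk (x, y) -> locally_2d (fun a b => unit_disk (a, b)) x y).
  { intros x y Hz. destruct (unit_disk_open _ Hz) as [del L]. exists del. intros a b Ha Hb. apply L. split; assumption. }
  assert (Hcd : forall z, unit_disk z -> continuous Fd z).
  { intros [x y] Hz. destruct (Hprop x y Hz) as ((C1 & C2) & _).
    apply continuity_2d_pt_continuous in C1. apply continuity_2d_pt_continuous in C2.
    unfold Fd. cont. }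
  assert (Hcdd : forall z, unit_disk z -> continuous Fdd z).
  { intros [x y] Hz. destruct (Hprop x y Hz) as (_ & _ & _ & _ & C1 & _ & C2 & _).
    apply (continuity_2d_pt_continuous (fun s t => Derive (fun a => ux a t) s)) in C1.
    apply (continuity_2d_pt_continuous (fun s t => Derive (fun a => uy a t) s)) in C2.
    unfold Fdd. cont. }
  assert (Hhol : forall z, unit_disk z -> hol Fd z (Fdd z)).
  { intros [x y] Hz. apply hol_of_C1.
    - generalize (unit_disk_open _ Hz). apply filter_imp. intros [a b] Hab.
      destruct (Hprop a b Hab) as (_ & _ & (D1 & _) & (D2 & _) & _).
      unfold Fd, Fdd, Re, Im; simpl. split.
      + apply Derive_correct. exact D1.
      + apply (is_derive_opp (V := R_NormedModule) (fun s => uy s b)). apply Derive_correct. exact D2.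
    - destruct (Hprop x y Hz) as (_ & _ & (_ & D1) & _ & _ & C2 & C3 & _).
      unfold Fd, Fdd, Re, Im; simpl. rewrite Ropp_involutive.
      replace (Derive (fun s => uy s y) x) with (Derive (fun t => ux x t) y).
      + apply Derive_correct. exact D1.
      + symmetry. apply (Schwarz (fun a b => u (a, b)) x y); [|exact C3|exact C2].
        destruct (Hloc2 x y Hz) as [del L]. exists del. intros a b Ha Hb.
        destruct (Hprop a b (L a b Ha Hb)) as (_ & (E1 & E2) & (_ & E3) & (E4 & _) & _).
        repeat match goal with |- _ /\ _ => split end; assumption.
    - destruct (Hprop x y Hz) as (_ & _ & _ & (_ & D1) & _ & _ & _ & Hlap).
      unfold Fd, Fdd, Re, Im; simpl.
      replace (Derive (fun s => ux s y) x) with (- Derive (fun t => uy x t) y) by lra.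
      apply (is_derive_opp (V := R_NormedModule) (fun t => uy x t)). apply Derive_correct. exact D1.
    - now apply Hcdd. }
  assert (Hloc : forall z, unit_disk z -> locally z (fun w => Fd w = F' w)).
  { intros z Hz. generalize (unit_disk_open z Hz). apply filter_imp. intros w Hw. symmetry; now apply Hd. }
  split.
  - intros z Hz. split; [now apply HF|].
    apply (continuous_ext_loc (T := C_UniformSpace) (U := C_UniformSpace) _ Fd); [now apply Hloc|now apply Hcd].
  - exists Fdd. intros z Hz. split; [|now apply Hcdd].
    apply hol_ext_loc with Fd; [now apply Hloc|now apply Hhol].
Qed.

Lemma holomorphic_plus : forall F F' G G', holomorphic F F' -> holomorphic G G' ->
  holomorphic (fun w => F w + G w)%C (fun w => F' w + G' w)%C.
Proof.
  intros F F' G G' HF HG w Hw. destruct (HF w Hw), (HG w Hw). split; [now apply hol_plus|now apply cont_Cplus].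
Qed.

Lemma holomorphic_scal : forall c F F', holomorphic F F' -> holomorphic (fun w => c * F w)%C (fun w => c * F' w)%C.
Proof.
  intros c F F' HF w Hw. destruct (HF w Hw). split; [now apply hol_scal|].
  apply cont_Cmult; [apply continuous_const|assumption].
Qed.

(** [|g'| <= k |h'|] extends over the zeros of [h'], which have empty interior. *)
Lemma dilatation_bound : forall h' h'' g' g'' k,
  holomorphic h' h'' -> holomorphic g' g'' ->
  (exists z, unit_disk z /\ h' z <> 0%C) ->
  (forall z, unit_disk z -> h' z <> 0%C -> Cmod (g' z) <= k * Cmod (h' z)) ->
  forall z, unit_disk z -> Cmod (g' z) <= k * Cmod (h' z).
Proof.
  intros h' h'' g' g'' k Hh Hg (z0 & Hz0 & Hne) Hk z Hz.
  apply Rnot_lt_le. intros Hlt. apply Hne.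
  apply (identity_theorem h' h'' z Hz Hh); [|assumption].
  assert (Hc : continuous (fun w => k * Cmod (h' w) - Cmod (g' w)) z).
  { apply cont_minus; [apply cont_mult; [apply cont_const|]|]; apply cont_Cmod; eapply hol_continuous.
    - now apply Hh.
    - now apply Hg. }
  assert (Hneg : k * Cmod (h' z) - Cmod (g' z) < 0) by lra.
  generalize (filter_and _ _ (locally_lt _ z 0 Hc Hneg) (unit_disk_open z Hz)). apply filter_imp.
  intros w [Hw Hwd]. apply NNPP. intros Hn. specialize (Hk w Hwd Hn). lra.
Qed.

Lemma quasiregular_gradient_bound : forall K f, 1 <= K -> harmonic_quasiregular K f ->
  exists F F' F'' G G', holomorphic F F' /\ holomorphic F' F'' /\ holomorphic G G' /\
    (forall z, unit_disk z -> Re (F z) = Re (f z)) /\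
    (forall z, unit_disk z -> Im (G z) = Im (f z)) /\
    (forall z, unit_disk z -> Cmod (G' z) <= K * Cmod (F' z)).
Proof.
  intros K f HK ([Hu Hv] & h & g & w & (Hh & Hg & _ & Hf) & ((Hnz & _ & Hw) & _) & Hk).
  set (h' := C_derive h). set (g' := C_derive g).
  assert (Dh : forall z, unit_disk z -> hol h z (h' z)).
  { intros z Hz. apply hol_of_is_derive, C_derive_correct; [exact z|]. now apply Hh. }
  assert (Dg : forall z, unit_disk z -> hol g z (g' z)).
  { intros z Hz. apply hol_of_is_derive, C_derive_correct; [exact z|]. now apply Hg. }
  set (F := fun z => (h z + g z)%C). set (F' := fun z => (h' z + g' z)%C).
  set (G := fun z => (h z + -1 * g z)%C). set (G' := fun z => (h' z + -1 * g' z)%C).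
  assert (HRe : forall z, unit_disk z -> Re (F z) = Re (f z)).
  { intros z Hz. rewrite Hf by assumption. unfold F, Re, Cconj; simpl. ring. }
  assert (HIm : forall z, unit_disk z -> Im (G z) = Im (f z)).
  { intros z Hz. rewrite Hf by assumption. unfold G, Im, Cconj; simpl. ring. }
  destruct (harmonic_real_part _ F F' Hu) as [HF [F'' HF']]; [|exact HRe|].
  { intros z Hz. apply hol_plus; [now apply Dh|now apply Dg]. }
  destruct (harmonic_real_part _ (fun z => (0, -1) * G z)%C (fun z => (0, -1) * G' z)%C Hv) as [HG [G'' HG']].
  { intros z Hz. apply hol_scal. apply hol_plus; [now apply Dh|]. apply hol_scal; now apply Dg. }
  { intros z Hz. rewrite <- HIm by assumption. unfold Re, Im; simpl. ring. }
  apply (holomorphic_scal (0, 1)%R) in HG. apply (holomorphic_scal (0, 1)%R) in HG'.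
  assert (Ei : forall z : C, ((0, 1)%R * ((0, -1)%R * z))%C = z).
  { intros [a b]; unfold Cmult; simpl; f_equal; ring. }
  assert (HGh : holomorphic G G').
  { intros z Hz. destruct (HG z Hz) as [A B]. rewrite Ei in A. split.
    - apply hol_ext_loc with (2 := A). apply filter_forall. intros v; apply Ei.
    - apply (continuous_ext (T := C_UniformSpace) (U := C_UniformSpace)) with (2 := B). intros v; apply Ei. }
  set (G2 := fun z => ((0, 1)%R * G'' z)%C).
  assert (HGh' : holomorphic G' G2).
  { intros z Hz. destruct (HG' z Hz) as [A B]. split; [|exact B].
    apply hol_ext_loc with (2 := A). apply filter_forall. intros v; apply Ei. }
  assert (Hh' : holomorphic h' (fun z => / 2 * (F'' z + G2 z))%C).
  { pose proof (holomorphic_scal (/ 2)%C _ _ (holomorphic_plus _ _ _ _ HF' HGh')) as H.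
    intros z Hz. destruct (H z Hz) as [A B]. split; [|exact B].
    apply hol_ext_loc with (2 := A). apply filter_forall. intros v. unfold F', G'. field. }
  assert (Hg' : holomorphic g' (fun z => / 2 * (F'' z + -1 * G2 z))%C).
  { pose proof (holomorphic_scal (/ 2)%C _ _ (holomorphic_plus _ _ _ _ HF' (holomorphic_scal (-1)%C _ _ HGh'))) as H.
    intros z Hz. destruct (H z Hz) as [A B]. split; [|exact B].
    apply hol_ext_loc with (2 := A). apply filter_forall. intros v. unfold F', G'. field. }
  set (k := (K - 1) / (K + 1)) in *.
  assert (Hgk : forall z, unit_disk z -> Cmod (g' z) <= k * Cmod (h' z)).
  { apply (dilatation_bound h' _ g' _ k Hh' Hg' Hnz).
    intros z Hz Hn. specialize (Hk z Hz). rewrite (Hw z Hz Hn) in Hk.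
    fold h' g' in Hk. rewrite Cmod_div in Hk by assumption.
    apply Cmod_gt_0 in Hn. apply Rmult_le_reg_r with (/ Cmod (h' z)); [now apply Rinv_0_lt_compat|].
    rewrite (Rmult_assoc k), Rinv_r by lra. rewrite Rmult_1_r. exact Hk. }
  exists F, F', F'', G, G'. repeat match goal with |- _ /\ _ => split end; try assumption.
  intros z Hz. specialize (Hgk z Hz).
  pose proof (Cmod_ge_0 (h' z)) as H0.
  assert (H1 : Cmod (G' z) <= (1 + k) * Cmod (h' z)).
  { unfold G'. eapply Rle_trans; [apply Cmod_triangle|]. rewrite Cmod_mult, Cmod_R.
    rewrite Rabs_left by lra. lra. }
  assert (H2 : (1 - k) * Cmod (h' z) <= Cmod (F' z)).
  { pose proof (Cmod_triangle (F' z) (-1 * g' z)) as T.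
    replace (F' z + -1 * g' z)%C with (h' z) in T by (unfold F'; ring).
    rewrite Cmod_mult, Cmod_R, Rabs_left in T by lra. lra. }
  assert (Hkk : 1 + k = K * (1 - k)) by (unfold k; field; lra).
  rewrite Hkk in H1. apply (Rmult_le_compat_l K) in H2; lra.
Qed.

(** * Transfer of growth from [Re F] to [Im G] *)

Lemma rpow_lt_1 : forall x p, 0 < p -> 0 < x < 1 -> rpow x p < 1.
Proof.
  intros x p Hp Hx. rewrite <- (rpow_one p), !rpow_pos by lra. apply Rlt_Rpower_l; lra.
Qed.

(** A geometric recursion: along [tau, 7 tau / 8, ...] the quantity
    [B tau * tau ^ gam] satisfies a contraction with a constant perturbation. *)
Lemma power_growth_of_recursion : forall gam a C M tau0, 0 < gam -> 0 < tau0 -> 0 <= a -> 0 <= C -> 0 <= M ->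
  a * rpow (7 / 8) gam < 1 ->
  exists C', 0 < C' /\ forall B : R -> R,
    (forall tau, 0 < tau <= tau0 -> B (7 / 8 * tau) <= a * B tau + C * rpow (/ tau) gam) ->
    (forall tau, 7 / 8 * tau0 <= tau <= tau0 -> B tau <= M) ->
    forall tau, 0 < tau <= tau0 -> B tau <= C' * rpow (/ tau) gam.
Proof.
  intros gam a C M tau0 Hg Ht0 Ha HC HM Hk.
  set (k := rpow (7 / 8) gam) in *.
  assert (Hk0 : 0 < k) by (apply rpow_gt_0; lra).
  set (M2 := M * rpow tau0 gam + C * k / (1 - a * k) + 1).
  assert (Hr0 : 0 < rpow tau0 gam) by now apply rpow_gt_0.
  assert (A1 : 0 <= M * rpow tau0 gam) by (apply Rmult_le_pos; lra).
  assert (A2 : 0 <= C * k / (1 - a * k)).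
  { apply Rmult_le_pos; [apply Rmult_le_pos; lra|]. left; apply Rinv_0_lt_compat; lra. }
  exists M2. split; [unfold M2; lra|].
  intros B Hrec Hinit.
  assert (HE : forall n tau, 7 / 8 * tau0 * (7 / 8) ^ n <= tau <= tau0 -> B tau * rpow tau gam <= M2).
  { assert (Hbase : forall tau, 7 / 8 * tau0 <= tau <= tau0 -> B tau * rpow tau gam <= M2).
    { intros tau Ht. apply Rle_trans with (M * rpow tau0 gam); [|unfold M2; lra].
      apply Rle_trans with (M * rpow tau gam).
      - apply Rmult_le_compat_r; [apply rpow_ge_0|now apply Hinit].
      - apply Rmult_le_compat_l; [assumption|]. apply rpow_le; lra. }
    induction n as [|n IH]; intros tau Ht.
    - apply Hbase. simpl in Ht. lra.
    - destruct (Rle_dec (7 / 8 * tau0) tau) as [H1|H1]; [apply Hbase; lra|].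
      set (t := 8 / 7 * tau).
      assert (Hpn : 0 < (7 / 8) ^ n) by (apply pow_lt; lra).
      assert (Hpos : 0 < 7 / 8 * tau0 * (7 / 8) ^ n) by (apply Rmult_lt_0_compat; lra).
      simpl in Ht.
      assert (Htt : 7 / 8 * tau0 * (7 / 8) ^ n <= t <= tau0) by (unfold t; split; nra).
      assert (Ht0' : 0 < t) by lra.
      specialize (IH t Htt).
      assert (Et : tau = 7 / 8 * t) by (unfold t; field).
      assert (Hrt : 0 < rpow t gam) by now apply rpow_gt_0.
      rewrite Et, rpow_mult by lra. fold k.
      assert (Hr := Hrec t (conj Ht0' (proj2 Htt))).
      apply Rle_trans with ((a * B t + C * rpow (/ t) gam) * (k * rpow t gam)).
      + apply Rmult_le_compat_r; [apply Rmult_le_pos; lra|exact Hr].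
      + rewrite rpow_inv by assumption.
        replace ((a * B t + C * / rpow t gam) * (k * rpow t gam)) with (a * k * (B t * rpow t gam) + C * k) by (field; lra).
        assert (a * k * (B t * rpow t gam) <= a * k * M2) by (apply Rmult_le_compat_l; [apply Rmult_le_pos; lra|exact IH]).
        assert (C * k <= M2 * (1 - a * k)); [|lra].
        replace (C * k) with (C * k / (1 - a * k) * (1 - a * k)) by (field; lra).
        apply Rmult_le_compat_r; [lra|unfold M2; lra]. }
  intros tau Ht.
  assert (Hs : 0 < tau / tau0) by (apply Rdiv_lt_0_compat; lra).
  destruct (pow_lt_1_zero (7 / 8) ltac:(rewrite Rabs_pos_eq; lra) (tau / tau0) Hs) as [n Hn].
  specialize (Hn n (le_n n)). rewrite Rabs_pos_eq in Hn by (apply pow_le; lra).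
  assert (Hle : 7 / 8 * tau0 * (7 / 8) ^ n <= tau).
  { apply (Rmult_lt_compat_l tau0) in Hn; [|assumption].
    replace (tau0 * (tau / tau0)) with tau in Hn by (field; lra).
    assert (0 < tau0 * (7 / 8) ^ n) by (apply Rmult_lt_0_compat; [assumption|apply pow_lt; lra]). lra. }
  specialize (HE n tau (conj Hle (proj2 Ht))).
  assert (Hrt : 0 < rpow tau gam) by (apply rpow_gt_0; lra).
  rewrite rpow_inv by lra. apply Rmult_le_reg_r with (rpow tau gam); [assumption|].
  rewrite Rmult_assoc, Rinv_l by lra. lra.
Qed.

Lemma RInt_shift_periodic : forall (g : R -> R) T c, 0 < T -> (forall x, continuous g x) -> (forall x, g (x + T) = g x) ->
  RInt (fun x => g (x + c)) 0 T = RInt g 0 T.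
Proof.
  intros g T c HT Hc Hp.
  assert (Hex : forall a b, ex_RInt g a b).
  { intros a b. apply (ex_RInt_continuous (V := R_CompleteNormedModule)). intros; apply Hc. }
  assert (Hshift : forall d a b, RInt (fun x => g (x + d)) a b = RInt g (a + d) (b + d)).
  { intros d a b. pose proof (RInt_comp_lin (V := R_CompleteNormedModule) g 1 d a b (Hex _ _)) as E.
    rewrite !Rmult_1_l in E. rewrite <- E. apply RInt_ext. intros x _.
    change (g (x + d) = 1 * g (1 * x + d)). now rewrite !Rmult_1_l. }
  rewrite Hshift, Rplus_0_l.
  pose proof (RInt_Chasles (V := R_CompleteNormedModule) g c 0 (T + c) (Hex _ _) (Hex _ _)) as C1.
  pose proof (RInt_Chasles (V := R_CompleteNormedModule) g 0 T (T + c) (Hex _ _) (Hex _ _)) as C2.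
  pose proof (RInt_Chasles (V := R_CompleteNormedModule) g c 0 c (Hex _ _) (Hex _ _)) as C3.
  assert (E : RInt g T (T + c) = RInt g 0 c).
  { rewrite <- (Rplus_0_l T) at 1. rewrite (Rplus_comm T c). rewrite <- Hshift. apply RInt_ext. intros; apply Hp. }
  rewrite (RInt_point (V := R_CompleteNormedModule)) in C3.
  change (RInt g c 0 + RInt g 0 (T + c) = RInt g c (T + c)) in C1.
  change (RInt g 0 T + RInt g T (T + c) = RInt g 0 (T + c)) in C2.
  change (RInt g c 0 + RInt g 0 c = 0) in C3. lra.
Qed.

Lemma Cexp_in_disk : forall z : C, fst z < 0 -> unit_disk (Cexp z).
Proof.
  intros z Hz. unfold unit_disk. rewrite Cmod_Cexp, <- exp_0. now apply exp_increasing.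
Qed.

Lemma Cexp_periodic : forall x y, Cexp (x, y + 2 * PI) = Cexp (x, y).
Proof. intros x y. unfold Cexp; simpl. now rewrite cos_plus, sin_plus, cos_2PI, sin_2PI, !Rmult_1_r, !Rmult_0_r, Rminus_0_r, Rplus_0_r. Qed.

(** In the coordinate [log z] the disk becomes the left half-plane and the
    circles about the origin become vertical lines. *)
Definition abs_re_log (F : C -> C) (x y : R) : R := Rabs (Re (F (Cexp (x, y)))).
Definition abs_im_log (F : C -> C) (x y : R) : R := Rabs (Im (F (Cexp (x, y)))).

Section Transfer.
Context (K : R) (F F' F'' G G' : C -> C) (HK : 1 <= K)
  (HF : holomorphic F F') (HF' : holomorphic F' F'') (HG : holomorphic G G')
  (HGF : forall z, unit_disk z -> Cmod (G' z) <= K * Cmod (F' z)).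

Let Phi := fun z => F (Cexp z).
Let Phi' := fun z => (F' (Cexp z) * Cexp z)%C.
Let Phi'' := fun z => (F'' (Cexp z) * Cexp z * Cexp z + F' (Cexp z) * Cexp z)%C.
Local Notation U := (abs_re_log F).
Local Notation V := (abs_im_log G).

Lemma hol_log : forall z : C, fst z < 0 -> hol Phi z (Phi' z) /\ hol Phi' z (Phi'' z) /\ continuous Phi'' z.
Proof.
  intros z Hz. pose proof (Cexp_in_disk z Hz) as Hd. pose proof (hol_Cexp z) as HE.
  destruct (HF _ Hd) as [A1 A2]. destruct (HF' _ Hd) as [B1 B2].
  pose proof (hol_comp F Cexp z _ _ A1 HE) as D1. pose proof (hol_comp F' Cexp z _ _ B1 HE) as D2.
  pose proof (hol_mult _ _ _ _ _ D2 HE) as D3.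
  split; [exact D1|split; [exact D3|]].
  pose proof (Cexp_continuous z) as Ec.
  pose proof (continuous_comp (U := C_UniformSpace) (V := C_UniformSpace) (W := C_UniformSpace) Cexp F'' z Ec B2) as E2.
  pose proof (hol_continuous _ _ _ D2) as E1.
  exact (cont_Cplus _ _ z (cont_Cmult _ _ z (cont_Cmult _ _ z E2 Ec) Ec) (cont_Cmult _ _ z E1 Ec)).
Qed.

Lemma in_square_left : forall (z w : C) s, in_square z s w -> fst z + s <= 0 -> fst w < 0.
Proof. intros z w s [H _] Hs. apply Rabs_def2 in H. lra. Qed.

(** The segment has length [tau / 8] and the gradient of [Re F] on it is at most a
    constant times [B / (tau / 8)], by squares of half-side [tau / 8] centred on
    the segment; the powers of [tau] cancel. *)
Lemma one_step : forall tau theta B, 0 < tau ->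
  (forall x y, - (9 / 8 * tau) <= x <= - (3 / 4 * tau) -> Rabs (y - theta) <= tau / 8 -> U x y <= B) ->
  V (- (7 / 8 * tau)) theta <= V (- tau) theta + 32 * K / eta_mass * B.
Proof.
  intros tau theta B Ht HU. pose proof eta_mass_pos as Hm.
  assert (Hgrad : forall x, - tau <= x <= - (7 / 8 * tau) -> Cmod (Phi' (x, theta)) <= 32 / eta_mass * (B / (tau / 8))).
  { intros x Hx. apply (gradient_estimate Phi Phi' Phi'' (x, theta) (tau / 8) (tau / 4)); [lra| |].
    - intros w Hw. apply hol_log. apply (in_square_left (x, theta) w (tau / 4)); simpl; [assumption|lra].
    - intros a b Ha Hb. unfold Phi, pt; simpl. apply (HU (x + tau / 8 * a) (theta + tau / 8 * b)); [nra|].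
      replace (theta + tau / 8 * b - theta) with (tau / 8 * b) by ring. apply Rabs_le; nra. }
  set (dV := fun x => Im (G' (Cexp (x, theta)) * Cexp (x, theta))%C).
  assert (HdV : forall x, x < 0 -> is_derive (fun x => Im (G (Cexp (x, theta)))) x (dV x)).
  { intros x Hx. destruct (HG _ (Cexp_in_disk (x, theta) Hx)) as [A _].
    pose proof (hol_comp G Cexp (x, theta) _ _ A (hol_Cexp _)) as D.
    exact (proj1 (proj2 (hol_partials _ x theta _ D))). }
  destruct (MVT_gen (fun x => Im (G (Cexp (x, theta)))) (- tau) (- (7 / 8 * tau)) dV) as (c & Hc & E).
  - rewrite Rmin_left, Rmax_right by lra. intros x Hx. apply HdV; lra.
  - rewrite Rmin_left, Rmax_right by lra. intros x Hx.
    assert (Hx0 : x < 0) by lra.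
    apply continuity_pt_filterlim.
    apply (ex_derive_continuous (V := R_NormedModule) (fun x => Im (G (Cexp (x, theta))))). exact (ex_intro _ _ (HdV x Hx0)).
  - rewrite Rmin_left, Rmax_right in Hc by lra.
    assert (Hdc : Rabs (dV c) <= K * (32 / eta_mass * (B / (tau / 8)))).
    { unfold dV. eapply Rle_trans; [apply Im_le_Cmod|]. rewrite Cmod_mult.
      apply Rle_trans with (K * Cmod (Phi' (c, theta))).
      - unfold Phi'. rewrite Cmod_mult, <- Rmult_assoc. apply Rmult_le_compat_r; [apply Cmod_ge_0|].
        apply HGF, Cexp_in_disk; simpl; lra.
      - apply Rmult_le_compat_l; [lra|]. now apply Hgrad. }
    unfold abs_im_log. replace (Im (G (Cexp (- (7 / 8 * tau), theta)))) with
      (Im (G (Cexp (- tau, theta))) + dV c * (tau / 8)) by (simpl in E; lra).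
    eapply Rle_trans; [apply Rabs_triang|]. apply Rplus_le_compat_l.
    rewrite Rabs_mult, (Rabs_pos_eq (tau / 8)) by lra.
    apply Rle_trans with (K * (32 / eta_mass * (B / (tau / 8))) * (tau / 8)).
    + apply Rmult_le_compat_r; [lra|assumption].
    + right. field. lra.
Qed.

Lemma U_continuous : forall x y, x < 0 -> continuous (fun q : R * R => U (fst q) (snd q)) (x, y).
Proof.
  intros x y Hx. unfold abs_re_log. apply cont_abs. apply cont_Re.
  apply (continuous_comp (fun q : R * R => Cexp (fst q, snd q)) F).
  - unfold Cexp; simpl. cont.
  - eapply hol_continuous. apply HF. now apply Cexp_in_disk.
Qed.

Lemma V_continuous : forall x y, x < 0 -> continuous (fun q : R * R => V (fst q) (snd q)) (x, y).
Proof.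
  intros x y Hx. unfold abs_im_log. apply cont_abs. apply cont_Im.
  apply (continuous_comp (fun q : R * R => Cexp (fst q, snd q)) G).
  - unfold Cexp; simpl. cont.
  - eapply hol_continuous. apply HG. now apply Cexp_in_disk.
Qed.

Lemma transfer_sup : forall beta t1 Cm, 0 < beta -> 0 < t1 -> 0 <= Cm ->
  (forall t theta, 0 < t < t1 -> U (- t) theta <= Cm * rpow (/ t) beta) ->
  exists tau0 C, 0 < tau0 /\ 0 < C /\
    forall tau theta, 0 < tau <= tau0 -> - PI <= theta <= PI -> V (- tau) theta <= C * rpow (/ tau) beta.
Proof.
  intros beta t1 Cm Hb Ht1 HCm HU. pose proof eta_mass_pos as Hm.
  set (tau0 := t1 / 2). assert (Ht0 : 0 < tau0) by (unfold tau0; lra).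
  destruct (bounded_on_rect V (- tau0) (- (7 / 8 * tau0)) (- PI) PI) as (M & HM & HMb).
  { intros x y Hx Hy. apply V_continuous. lra. }
  set (C := 32 * K / eta_mass * (Cm * rpow 2 beta)).
  assert (HC : 0 <= C).
  { unfold C. apply Rmult_le_pos; [left; apply Rdiv_lt_0_compat; lra|].
    apply Rmult_le_pos; [assumption|apply rpow_ge_0]. }
  assert (Hk : 1 * rpow (7 / 8) beta < 1) by (rewrite Rmult_1_l; apply rpow_lt_1; lra).
  destruct (power_growth_of_recursion beta 1 C M tau0 Hb Ht0 Rle_0_1 HC (Rlt_le _ _ HM) Hk) as (C' & HC' & HB).
  exists tau0, C'. split; [assumption|split; [assumption|]]. intros tau theta Ht Hth.
  apply (HB (fun tau => V (- tau) theta)); [| |assumption].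
  - intros t Htt. rewrite Rmult_1_l.
    replace (C * rpow (/ t) beta) with (32 * K / eta_mass * (Cm * rpow (2 * / t) beta)).
    2:{ unfold C. rewrite rpow_mult by (try (left; apply Rinv_0_lt_compat); lra). ring. }
    apply one_step; [lra|]. intros x y Hx Hy.
    replace x with (- - x) by ring.
    eapply Rle_trans; [apply HU; unfold tau0 in *; lra|].
    apply Rmult_le_compat_l; [assumption|]. apply rpow_le; [assumption|].
    split; [left; apply Rinv_0_lt_compat; lra|].
    replace (2 * / t) with (/ (t / 2)) by (field; lra). apply Rinv_le_contravar; lra.
  - intros t Htt. rewrite <- (Rabs_pos_eq (V _ _)) by apply Rabs_pos. apply HMb; lra.
Qed.

(** Integrates [one_step] over the angle, with [B] given by [local_Lp_bound] on
    the square of half-side [tau / 2] about [- tau + i theta]. *)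
Lemma transfer_Lp : forall p beta t1 Cm, 0 < p -> 0 < beta -> 0 < t1 -> 0 <= Cm ->
  (forall t, 0 < t < t1 -> RInt (fun theta => rpow (U (- t) theta) p) 0 (2 * PI) <= Cm * rpow (/ t) (beta * p)) ->
  exists tau0 C, 0 < tau0 /\ 0 < C /\
    forall tau, 0 < tau <= tau0 -> RInt (fun theta => rpow (V (- tau) theta) p) 0 (2 * PI) <= C * rpow (/ tau) (beta * p).
Proof.
  intros p beta t1 Cm Hp Hb Ht1 HCm HU. pose proof eta_mass_pos as Hm. pose proof PI_RGT_0 as HPI.
  set (gam := beta * p) in *. assert (Hg : 0 < gam) by (apply Rmult_lt_0_compat; assumption).
  set (W := fun x y => rpow (U x y) p).
  assert (HWc : forall x y, x < 0 -> continuous (fun q : R * R => W (fst q) (snd q)) (x, y)).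
  { intros x y Hx. unfold W.
    apply continuous_ext with (fun q : R * R => rpow (Rabs (U (fst q) (snd q))) p).
    - intros q. unfold abs_re_log. now rewrite Rabs_Rabsolu.
    - apply (cont_comp (fun t => rpow (Rabs t) p) (fun q : R * R => U (fst q) (snd q))).
      + now apply rpow_abs_continuous.
      + now apply U_continuous. }
  assert (HVp : forall x, x < 0 -> forall y, continuous (fun y => rpow (V x y) p) y).
  { intros x Hx y.
    apply continuous_ext with (fun y => rpow (Rabs (V x y)) p).
    - intros q. unfold abs_im_log. now rewrite Rabs_Rabsolu.
    - apply (cont_comp (fun t => rpow (Rabs t) p) (fun y => V x y)).
      + now apply rpow_abs_continuous.
      + apply (continuous_comp (fun y => (x, y)) (fun q : R * R => V (fst q) (snd q))); [cont|now apply V_continuous]. }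
  assert (HWper : forall x y, W x (y + 2 * PI) = W x y).
  { intros x y. unfold W, abs_re_log. now rewrite Cexp_periodic. }
  destruct (local_Lp_bound p Hp) as (CL & HCL & HL).
  set (S := fun tau theta => sqint (fun x y => W (- tau + tau / 2 * x) (theta + tau / 2 * y))).
  (* integrating the mean over a moving square in the angle gives means over whole
     circles, whose radii stay comparable with the central one *)
  assert (HSc : forall tau, 0 < tau -> continuous_on_rect
     (fun theta a => RInt (fun b => W (- tau + tau / 2 * a) (theta + tau / 2 * b)) (-1) 1) 0 (2 * PI) (-1) 1).
  { intros tau Ht theta a _ Ha.
    apply (continuous_RInt_param (T := prod_UniformSpace R_UniformSpace R_UniformSpace)
      (fun (q : R * R) b => W (- tau + tau / 2 * snd q) (fst q + tau / 2 * b))); [lra|].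
    assert (Hn : - tau + tau / 2 * a < 0) by nra.
    assert (Hl : continuous (fun q : R * R => - tau + tau / 2 * snd q) (theta, a)) by cont.
    generalize (locally_lt _ (theta, a) 0 Hl Hn). apply filter_imp. intros [th a'] Hlt b _. simpl in Hlt.
    apply (continuous_comp_2 (fun z : (R * R) * R => - tau + tau / 2 * snd (fst z))
      (fun z : (R * R) * R => fst (fst z) + tau / 2 * snd z) W); [cont|cont|now apply HWc]. }
  assert (HSint : forall tau, 0 < tau <= t1 / 2 ->
     ex_RInt (S tau) 0 (2 * PI) /\ RInt (S tau) 0 (2 * PI) <= 4 * (Cm * rpow 2 gam) * rpow (/ tau) gam).
  { intros tau Ht. split.
    - apply (ex_RInt_outer (fun theta a => RInt (fun b => W (- tau + tau / 2 * a) (theta + tau / 2 * b)) (-1) 1) 0 (2 * PI) (-1) 1);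
        [lra|lra|apply HSc; lra].
    - unfold S, sqint.
      rewrite (fubini (fun theta a => RInt (fun b => W (- tau + tau / 2 * a) (theta + tau / 2 * b)) (-1) 1) 0 (2 * PI) (-1) 1)
        by (try lra; apply HSc; lra).
      assert (Hin : forall a, -1 <= a <= 1 ->
        RInt (fun theta => RInt (fun b => W (- tau + tau / 2 * a) (theta + tau / 2 * b)) (-1) 1) 0 (2 * PI) <=
        2 * (Cm * rpow 2 gam * rpow (/ tau) gam)).
      { intros a Ha.
        assert (Hn : - tau + tau / 2 * a < 0) by nra.
        rewrite (fubini (fun theta b => W (- tau + tau / 2 * a) (theta + tau / 2 * b)) 0 (2 * PI) (-1) 1); [|lra|lra|].
        2:{ intros theta b _ _.
            apply (continuous_comp_2 (fun z : R * R => - tau + tau / 2 * a) (fun z : R * R => fst z + tau / 2 * snd z) W);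
              [cont|cont|now apply HWc]. }
        rewrite (RInt_ext_le _ (fun _ => RInt (fun theta => W (- tau + tau / 2 * a) theta) 0 (2 * PI))); [|lra|].
        2:{ intros b Hb'. apply (RInt_shift_periodic (W (- tau + tau / 2 * a))); [lra| |intros; apply HWper].
            intros y. apply (continuous_comp (fun y => (- tau + tau / 2 * a, y)) (fun q : R * R => W (fst q) (snd q)));
              [cont|now apply HWc]. }
        rewrite RInt_const. change ((1 - -1) * RInt (fun theta => W (- tau + tau / 2 * a) theta) 0 (2 * PI) <=
          2 * (Cm * rpow 2 gam * rpow (/ tau) gam)).
        replace (1 - -1) with 2 by ring. apply Rmult_le_compat_l; [lra|].
        replace (- tau + tau / 2 * a) with (- (tau - tau / 2 * a)) by ring.
        eapply Rle_trans; [apply HU; nra|].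
        rewrite Rmult_assoc. apply Rmult_le_compat_l; [assumption|].
        assert (0 < / tau) by (apply Rinv_0_lt_compat; lra).
        rewrite <- rpow_mult by lra.
        apply rpow_le; [assumption|]. split; [left; apply Rinv_0_lt_compat; nra|].
        replace (2 * / tau) with (/ (tau / 2)) by (field; lra). apply Rinv_le_contravar; nra. }
      apply Rle_trans with (RInt (fun _ => 2 * (Cm * rpow 2 gam * rpow (/ tau) gam)) (-1) 1).
      + apply RInt_le_mono; [lra| |apply ex_RInt_const|exact Hin].
        apply (ex_RInt_outer (fun a theta => RInt (fun b => W (- tau + tau / 2 * a) (theta + tau / 2 * b)) (-1) 1) (-1) 1 0 (2 * PI)); [lra|lra|].
        intros a theta Ha Hth.
        assert (Htau : 0 < tau) by lra.
        apply (continuous_comp_2 (U := prod_UniformSpace R_UniformSpace R_UniformSpace) (fun z : R * R => snd z) (fun z : R * R => fst z)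
          (fun theta a => RInt (fun b => W (- tau + tau / 2 * a) (theta + tau / 2 * b)) (-1) 1)); [cont|cont|].
        exact (HSc tau Htau theta a Hth Ha).
      + rewrite RInt_const. right.
        change ((1 - -1) * (2 * (Cm * rpow 2 gam * rpow (/ tau) gam)) = 4 * (Cm * rpow 2 gam) * rpow (/ tau) gam). ring. }
  set (k := rpow (7 / 8) gam).
  assert (Hk0 : 0 < k) by (apply rpow_gt_0; lra).
  assert (Hk1 : k < 1) by (apply rpow_lt_1; lra).
  (* makes [(1 + delta) k] the midpoint of [k] and 1 *)
  set (delta := (1 - k) / (2 * k)).
  assert (Hdelta : 0 < delta) by (apply Rdiv_lt_0_compat; lra).
  destruct (rpow_plus_le p delta Hp Hdelta) as (Cd & HCd & Hplus).
  set (c1 := 32 * K / eta_mass).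
  assert (Hc1 : 0 < c1) by (apply Rdiv_lt_0_compat; lra).
  set (C2 := Cd * (rpow c1 p * CL)).
  assert (HC2 : 0 < C2) by (repeat apply Rmult_lt_0_compat; try assumption; now apply rpow_gt_0).
  assert (HS0 : forall tau theta, 0 < tau -> 0 <= S tau theta).
  { intros tau theta Ht. replace 0 with (4 * 0) by ring. rewrite <- sqint_const. unfold S.
    apply sqint_le; [apply on_square_const| |intros; apply rpow_ge_0].
    intros x y Hx Hy. apply (continuous_comp_2 (fun z : R * R => - tau + tau / 2 * fst z) (fun z : R * R => theta + tau / 2 * snd z) W);
      [cont|cont|apply HWc; simpl; nra]. }
  assert (Hstep : forall tau theta, 0 < tau ->
    rpow (V (- (7 / 8 * tau)) theta) p <= (1 + delta) * rpow (V (- tau) theta) p + C2 * S tau theta).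
  { intros tau theta Ht.
    set (B := rpow (CL * S tau theta) (/ p)).
    assert (HCS : 0 <= CL * S tau theta) by (apply Rmult_le_pos; [lra|now apply HS0]).
    assert (HB0 : 0 <= B) by apply rpow_ge_0.
    assert (HUB : forall x y, - (9 / 8 * tau) <= x <= - (3 / 4 * tau) -> Rabs (y - theta) <= tau / 8 -> U x y <= B).
    { intros x y Hx Hy.
      assert (HPhi : forall w, in_square (- tau, theta) (3 / 4 * tau) w -> hol Phi w (Phi' w) /\ continuous Phi' w).
      { intros w Hw. destruct (hol_log w) as (D1 & D2 & _).
        - apply (in_square_left (- tau, theta) w (3 / 4 * tau) Hw). simpl; lra.
        - split; [exact D1|exact (hol_continuous _ _ _ D2)]. }
      assert (HH := HL Phi Phi' (- tau, theta) (tau / 2) (3 / 4 * tau) ltac:(lra) HPhi).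
      specialize (HH ((x + tau) / (tau / 2)) ((y - theta) / (tau / 2))).
      apply Rabs_le_between in Hy.
      assert (Ex : x = - tau + tau / 2 * ((x + tau) / (tau / 2))) by (field; lra).
      assert (Ey : y = theta + tau / 2 * ((y - theta) / (tau / 2))) by (field; lra).
      unfold pt, Phi in HH; simpl in HH. rewrite <- Ex, <- Ey in HH.
      rewrite <- (rpow_root (U x y) p) by (try apply Rabs_pos; lra).
      apply rpow_le; [now apply Rinv_0_lt_compat|]. split; [apply rpow_ge_0|].
      apply HH; split; (apply Rmult_le_reg_r with (tau / 2); [lra|]; unfold Rdiv at 2; rewrite ?(Rmult_assoc _ (/ _)), ?Rinv_l by lra; lra). }
    pose proof (one_step tau theta B Ht HUB) as H1. fold c1 in H1.
    assert (HV0 : forall x, 0 <= V x theta) by (intros; apply Rabs_pos).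
    eapply Rle_trans; [apply rpow_le; [assumption|split; [apply HV0|exact H1]]|].
    eapply Rle_trans; [apply Hplus; [apply HV0|apply Rmult_le_pos; lra]|].
    apply Rplus_le_compat_l. unfold C2. rewrite Rmult_assoc. apply Rmult_le_compat_l; [lra|].
    rewrite rpow_mult by lra. unfold B. rewrite rpow_root_inv by (try assumption; lra). right; ring. }
  set (tau0 := t1 / 2). assert (Ht0 : 0 < tau0) by (unfold tau0; lra).
  destruct (bounded_on_rect V (- tau0) (- (7 / 8 * tau0)) 0 (2 * PI)) as (M & HM & HMb).
  { intros x y Hx Hy. apply V_continuous. lra. }
  set (C3 := C2 * (4 * (Cm * rpow 2 gam))).
  assert (HC3 : 0 <= C3).
  { unfold C3. apply Rmult_le_pos; [lra|]. apply Rmult_le_pos; [lra|]. apply Rmult_le_pos; [assumption|apply rpow_ge_0]. }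
  assert (Hkk : (1 + delta) * rpow (7 / 8) gam < 1).
  { fold k. unfold delta. replace ((1 + (1 - k) / (2 * k)) * k) with ((1 + k) / 2) by (field; lra). lra. }
  assert (HM2 : 0 <= 2 * PI * rpow M p) by (apply Rmult_le_pos; [lra|apply rpow_ge_0]).
  destruct (power_growth_of_recursion gam (1 + delta) C3 (2 * PI * rpow M p) tau0 Hg Ht0 ltac:(lra) HC3 HM2 Hkk) as (C' & HC' & HB).
  exists tau0, C'. split; [assumption|split; [assumption|]].
  apply (HB (fun tau => RInt (fun theta => rpow (V (- tau) theta) p) 0 (2 * PI))).
  - intros tau Ht. unfold tau0 in Ht. destruct (HSint tau Ht) as [E1 E2].
    assert (EV : ex_RInt (fun theta => rpow (V (- tau) theta) p) 0 (2 * PI)).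
    { apply ex_RInt_cont; [lra|]. intros; apply HVp; lra. }
    assert (EV1 := ex_RInt_scal (V := R_NormedModule) _ _ _ (1 + delta) EV).
    assert (ES1 := ex_RInt_scal (V := R_NormedModule) _ _ _ C2 E1).
    apply Rle_trans with (RInt (fun theta => (1 + delta) * rpow (V (- tau) theta) p + C2 * S tau theta) 0 (2 * PI)).
    + apply RInt_le_mono; [lra| | |].
      * apply ex_RInt_cont; [lra|]. intros; apply HVp; lra.
      * exact (ex_RInt_plus (V := R_NormedModule) _ _ _ _ EV1 ES1).
      * intros theta _. apply Hstep; lra.
    + rewrite RInt_plus_R, !RInt_scal_R by assumption.
      apply Rplus_le_compat_l. unfold C3. rewrite Rmult_assoc. apply Rmult_le_compat_l; [lra|exact E2].
  - intros tau Ht.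
    replace (2 * PI * rpow M p) with (RInt (fun _ => rpow M p) 0 (2 * PI)).
    2:{ rewrite RInt_const. change ((2 * PI - 0) * rpow M p = 2 * PI * rpow M p). ring. }
    apply RInt_le_mono; [lra| |apply ex_RInt_const|].
    + apply ex_RInt_cont; [lra|]. intros; apply HVp; lra.
    + intros theta Hth. apply rpow_le; [assumption|]. split; [apply Rabs_pos|].
      rewrite <- (Rabs_pos_eq (V _ _)) by apply Rabs_pos. apply HMb; lra.
Qed.

End Transfer.

(** * The theorem *)

Lemma one_minus_exp_bounds : forall t, 0 < t <= 1 -> t / 2 <= 1 - exp (- t) <= t.
Proof.
  intros t Ht. split.
  - rewrite exp_Ropp. pose proof (exp_ineq1_le t).
    assert (/ exp t <= / (1 + t)) by (apply Rinv_le_contravar; lra).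
    assert (/ (1 + t) <= 1 - t / 2); [|lra].
    apply Rmult_le_reg_l with (1 + t); [lra|]. rewrite Rinv_r by lra. nra.
  - pose proof (exp_ineq1_le (- t)). lra.
Qed.

Lemma weight_upper : forall t beta, 0 < beta -> 0 < t <= 1 ->
  Rabs (1 / Rpower (1 - exp (- t)) beta) <= rpow 2 beta * rpow (/ t) beta.
Proof.
  intros t beta Hb Ht. destruct (one_minus_exp_bounds t Ht).
  assert (0 < / t) by (apply Rinv_0_lt_compat; lra).
  rewrite <- rpow_pos by lra. unfold Rdiv. rewrite Rmult_1_l, <- rpow_inv by lra.
  rewrite Rabs_pos_eq by apply rpow_ge_0. rewrite <- rpow_mult by lra.
  apply rpow_le; [assumption|]. split; [left; apply Rinv_0_lt_compat; lra|].
  replace (2 * / t) with (/ (t / 2)) by (field; lra). apply Rinv_le_contravar; lra.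
Qed.

Lemma weight_lower : forall t beta, 0 < beta -> 0 < t <= 1 ->
  rpow (/ t) beta <= Rabs (1 / Rpower (1 - exp (- t)) beta).
Proof.
  intros t beta Hb Ht. destruct (one_minus_exp_bounds t Ht).
  rewrite <- rpow_pos by lra. unfold Rdiv. rewrite Rmult_1_l, <- rpow_inv by lra.
  rewrite Rabs_pos_eq by apply rpow_ge_0.
  apply rpow_le; [assumption|]. split; [left; apply Rinv_0_lt_compat; lra|].
  apply Rinv_le_contravar; lra.
Qed.

(** On the circle of radius [exp (- t)] the weights [1 - r] and [t] are
    comparable; the growth condition is used below in the variable [t]. *)
Lemma bigO_elim : forall M beta, 0 < beta -> bigO_at_left_1 M (fun r => 1 / Rpower (1 - r) beta) ->
  exists A t1, 0 <= A /\ 0 < t1 <= 1 /\ forall t, 0 < t < t1 -> Rabs (M (exp (- t))) <= A * rpow (/ t) beta.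
Proof.
  intros M beta Hb (A & [e HA]).
  exists (Rabs A * rpow 2 beta), (Rmin 1 e). split; [apply Rmult_le_pos; [apply Rabs_pos|apply rpow_ge_0]|].
  split; [split; [apply Rmin_glb_lt; [lra|apply cond_pos]|apply Rmin_l]|].
  intros t Ht. pose proof (Rmin_l 1 e). pose proof (Rmin_r 1 e).
  assert (Ht1 : 0 < t <= 1) by lra. destruct (one_minus_exp_bounds t Ht1).
  eapply Rle_trans; [apply HA|].
  - change (Rabs (exp (- t) - 1) < e). apply Rabs_lt_between. lra.
  - lra.
  - rewrite Rmult_assoc. apply Rle_trans with (Rabs A * Rabs (1 / Rpower (1 - exp (- t)) beta)).
    + apply Rmult_le_compat_r; [apply Rabs_pos|apply Rle_abs].
    + apply Rmult_le_compat_l; [apply Rabs_pos|now apply weight_upper].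
Qed.

Lemma bigO_intro : forall M beta C t0, 0 < beta -> 0 <= C -> 0 < t0 ->
  (forall t, 0 < t <= t0 -> Rabs (M (exp (- t))) <= C * rpow (/ t) beta) ->
  bigO_at_left_1 M (fun r => 1 / Rpower (1 - r) beta).
Proof.
  intros M beta C t0 Hb HC Ht0 H. exists C.
  set (t1 := Rmin t0 1). assert (Ht1 : 0 < t1) by (apply Rmin_glb_lt; lra).
  assert (E1 : t1 <= 1) by apply Rmin_r. assert (E0 : t1 <= t0) by apply Rmin_l.
  assert (He : 0 < 1 - exp (- t1)) by (destruct (one_minus_exp_bounds t1 (conj Ht1 E1)); lra).
  exists (mkposreal _ He). intros r Hr Hr1.
  change (Rabs (r - 1) < 1 - exp (- t1)) in Hr. apply Rabs_lt_between in Hr.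
  pose proof (exp_pos (- t1)).
  assert (Hr0 : 0 < r) by lra.
  set (t := - ln r). assert (Er : r = exp (- t)) by (unfold t; rewrite Ropp_involutive, exp_ln; lra).
  assert (Ht : 0 < t <= t1).
  { split.
    - apply Ropp_lt_cancel. rewrite Ropp_0. apply exp_lt_inv. rewrite <- Er, exp_0. lra.
    - apply Ropp_le_cancel. left. apply exp_lt_inv. rewrite <- Er. lra. }
  rewrite Er. eapply Rle_trans; [apply H; lra|].
  apply Rmult_le_compat_l; [assumption|]. apply weight_lower; lra.
Qed.

Lemma polar : forall z : C, 0 < Cmod z -> exists theta, - PI <= theta <= PI /\ z = circle_point (Cmod z) theta.
Proof.
  intros [x y] Hr. set (r := Cmod (x, y)) in *.
  pose proof (Cmod_sqr (x, y)) as E. fold r in E. simpl in E.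
  pose proof PI_RGT_0.
  assert (Hc : -1 <= x / r <= 1).
  { split; (apply Rmult_le_reg_r with r; [assumption|]; unfold Rdiv; rewrite Rmult_assoc, Rinv_l by lra; nra). }
  assert (Hs : sin (acos (x / r)) = Rabs y / r).
  { rewrite sin_acos by assumption. replace (1 - Rsqr (x / r)) with (Rsqr (y / r)).
    - rewrite sqrt_Rsqr_abs. unfold Rdiv. rewrite Rabs_mult, (Rabs_pos_eq (/ r)); [reflexivity|].
      left; now apply Rinv_0_lt_compat.
    - unfold Rsqr. apply Rmult_eq_reg_r with (r * r); [|nra].
      replace (y / r * (y / r) * (r * r)) with (y * y) by (field; lra).
      replace ((1 - x / r * (x / r)) * (r * r)) with (r * r - x * x) by (field; lra). lra. }
  pose proof (acos_bound (x / r)).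
  destruct (Rle_dec 0 y) as [Hy|Hy].
  - exists (acos (x / r)). split; [lra|]. unfold circle_point. rewrite cos_acos, Hs, Rabs_pos_eq by assumption.
    f_equal; field; lra.
  - exists (- acos (x / r)). split; [lra|]. unfold circle_point.
    rewrite cos_neg, sin_neg, cos_acos, Hs, Rabs_left by lra. f_equal; field; lra.
Qed.

Lemma Lub_Rbar_finite : forall (E : R -> Prop) M y0, E y0 -> (forall y, E y -> y <= M) ->
  (forall y, E y -> y <= real (Lub_Rbar E)) /\ real (Lub_Rbar E) <= M.
Proof.
  intros E M y0 H0 HM. destruct (Lub_Rbar_correct E) as [H1 H2].
  assert (A : Rbar_le (Lub_Rbar E) M) by (apply H2; intros y Hy; now apply HM).
  assert (B := H1 _ H0).
  destruct (Lub_Rbar E) as [l| |]; simpl in *; try contradiction.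
  split; [|assumption]. intros y Hy. exact (H1 y Hy).
Qed.

(** The bound [M] only ensures that the supremum is finite, so that passing to
    its real part keeps the value. *)
Lemma integral_mean_infty_ge : forall f r z M, Cmod z = r -> (forall w, Cmod w = r -> Rabs (f w) <= M) ->
  Rabs (f z) <= integral_mean p_infty r f.
Proof.
  intros f r z M Hz HM. simpl.
  apply (Lub_Rbar_finite (fun y => exists z, Cmod z = r /\ y = Rabs (f z)) M (Rabs (f z))).
  - now exists z.
  - intros y (w & Hw & ->). now apply HM.
  - now exists z.
Qed.

Lemma integral_mean_infty_le : forall f r M, 0 < r ->
  (forall theta, - PI <= theta <= PI -> Rabs (f (circle_point r theta)) <= M) ->
  Rabs (integral_mean p_infty r f) <= M.
Proof.
  intros f r M Hr HM.
  assert (HM' : forall w, Cmod w = r -> Rabs (f w) <= M).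
  { intros w Hw. destruct (polar w) as (th & Hth & E); [lra|]. rewrite E, Hw. now apply HM. }
  assert (Hz : Cmod (RtoC r) = r) by (rewrite Cmod_R; apply Rabs_pos_eq; lra).
  assert (B := integral_mean_infty_ge f r r M Hz HM').
  rewrite Rabs_pos_eq by (eapply Rle_trans; [apply Rabs_pos|exact B]).
  apply (Lub_Rbar_finite (fun y => exists z, Cmod z = r /\ y = Rabs (f z)) M (Rabs (f r))).
  - now exists (RtoC r).
  - intros y (w & Hw & ->). now apply HM'.
Qed.

Theorem theorem1 :
  forall (K : R) (p : Rbar) (beta : R) (f : C -> C),
    1 <= K -> Rbar_lt (Finite 0) p -> 0 < beta ->
    harmonic_quasiregular K f ->
    bigO_at_left_1 (fun r => integral_mean p r (fun z => Re (f z)))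
                   (fun r => 1 / Rpower (1 - r) beta) ->
    bigO_at_left_1 (fun r => integral_mean p r (fun z => Im (f z)))
                   (fun r => 1 / Rpower (1 - r) beta).
Proof.
  intros K p beta f HK Hp Hb Hf Hu.
  destruct (quasiregular_gradient_bound K f HK Hf) as (F & F' & F'' & G & G' & HF & HF' & HG & HRe & HIm & HGF).
  pose proof PI_RGT_0 as HPI.
  assert (Hdisk : forall t theta, 0 < t -> unit_disk (circle_point (exp (- t)) theta)).
  { intros t theta Ht. apply (Cexp_in_disk (- t, theta)). simpl; lra. }
  assert (EU : forall t theta, 0 < t -> Rabs (Re (f (circle_point (exp (- t)) theta))) = abs_re_log F (- t) theta).
  { intros t theta Ht. rewrite <- HRe by now apply Hdisk. reflexivity. }
  assert (EV : forall t theta, 0 < t -> Rabs (Im (f (circle_point (exp (- t)) theta))) = abs_im_log G (- t) theta).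
  { intros t theta Ht. rewrite <- HIm by now apply Hdisk. reflexivity. }
  destruct (bigO_elim _ _ Hb Hu) as (A & t1 & HA & Ht1 & HUA). clear Hu.
  destruct p as [p| |]; [| |contradiction].
  - simpl in Hp.
    assert (Hip : 0 < / p) by now apply Rinv_0_lt_compat.
    assert (Hi2 : 0 < / (2 * PI)) by (apply Rinv_0_lt_compat; lra).
    destruct (transfer_Lp K F F' F'' G G' HK HF HF' HG HGF p beta t1 (2 * PI * rpow A p) Hp Hb (proj1 Ht1)) as (t0 & C & Ht0 & HC & HV).
    + apply Rmult_le_pos; [lra|apply rpow_ge_0].
    + intros t Ht. specialize (HUA t Ht). unfold integral_mean in HUA.
      rewrite (RInt_ext_le (fun theta => rpow (Rabs (Re (f (circle_point (exp (- t)) theta)))) p)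
         (fun theta => rpow (abs_re_log F (- t) theta) p)) in HUA
        by (try lra; intros; rewrite EU by lra; reflexivity).
      set (I := RInt (fun theta => rpow (abs_re_log F (- t) theta) p) 0 (2 * PI)) in *.
      rewrite Rabs_pos_eq in HUA by apply rpow_ge_0.
      assert (HI : 0 <= / (2 * PI) * I).
      { apply Rmult_le_pos; [lra|]. apply RInt_ge_0_cont; [lra| |intros; apply rpow_ge_0].
        apply ex_RInt_cont; [lra|]. intros y _.
        apply continuous_ext with (fun y => rpow (Rabs (abs_re_log F (- t) y)) p).
        - intros q. unfold abs_re_log. now rewrite Rabs_Rabsolu.
        - apply (cont_comp (fun t => rpow (Rabs t) p) (fun y => abs_re_log F (- t) y)); [now apply rpow_abs_continuous|].
          apply (continuous_comp (fun y => (- t, y)) (fun q : R * R => abs_re_log F (fst q) (snd q))); [cont|].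
          apply (U_continuous F F' HF). lra. }
      assert (Hrt : 0 <= rpow (/ t) beta) by apply rpow_ge_0.
      assert (Hle : / (2 * PI) * I <= rpow (A * rpow (/ t) beta) p).
      { rewrite <- (rpow_root_inv (/ (2 * PI) * I) p) by lra. apply rpow_le; [assumption|]. split; [apply rpow_ge_0|assumption]. }
      rewrite rpow_mult, rpow_rpow in Hle by (try assumption; left; apply Rinv_0_lt_compat; lra).
      apply (Rmult_le_compat_l (2 * PI)) in Hle; [|lra].
      rewrite <- Rmult_assoc, Rinv_r, Rmult_1_l in Hle by lra. lra.
    + apply (bigO_intro _ beta (rpow (/ (2 * PI) * C) (/ p)) t0 Hb); [apply rpow_ge_0|assumption|].
      intros t Ht. specialize (HV t Ht). unfold integral_mean.
      rewrite (RInt_ext_le (fun theta => rpow (Rabs (Im (f (circle_point (exp (- t)) theta)))) p)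
         (fun theta => rpow (abs_im_log G (- t) theta) p))
        by (try lra; intros; rewrite EV by lra; reflexivity).
      rewrite Rabs_pos_eq by apply rpow_ge_0.
      assert (Hit : 0 <= / t) by (left; apply Rinv_0_lt_compat; lra).
      replace (rpow (/ t) beta) with (rpow (rpow (/ t) (beta * p)) (/ p)).
      2:{ rewrite rpow_rpow by assumption. f_equal. field; lra. }
      rewrite <- rpow_mult by (try apply rpow_ge_0; apply Rmult_le_pos; lra).
      apply rpow_le; [assumption|]. split.
      * apply Rmult_le_pos; [lra|]. apply RInt_ge_0_cont; [lra| |intros; apply rpow_ge_0].
        apply ex_RInt_cont; [lra|]. intros y _.
        apply continuous_ext with (fun y => rpow (Rabs (abs_im_log G (- t) y)) p).
        -- intros q. unfold abs_im_log. now rewrite Rabs_Rabsolu.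
        -- apply (cont_comp (fun t => rpow (Rabs t) p) (fun y => abs_im_log G (- t) y)); [now apply rpow_abs_continuous|].
           apply (continuous_comp (fun y => (- t, y)) (fun q : R * R => abs_im_log G (fst q) (snd q))); [cont|].
           apply (V_continuous G G' HG). lra.
      * rewrite Rmult_assoc. apply Rmult_le_compat_l; [lra|assumption].
  - destruct (transfer_sup K F F' F'' G G' HK HF HF' HG HGF beta t1 A Hb (proj1 Ht1) HA) as (t0 & C & Ht0 & HC & HV).
    + intros t theta Ht. rewrite <- EU by lra. eapply Rle_trans; [|apply HUA, Ht].
      eapply Rle_trans; [|apply Rle_abs].
      destruct (bounded_on_rect (abs_re_log F) (- t) (- t) (- PI) PI) as (M & HM & HMb).
      { intros x y Hx Hy. apply (U_continuous F F' HF). lra. }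
      apply (integral_mean_infty_ge (fun z => Re (f z)) (exp (- t)) (circle_point (exp (- t)) theta) M).
      * apply (Cmod_Cexp (- t, theta)).
      * intros w Hw. destruct (polar w) as (th & Hth & E); [rewrite Hw; apply exp_pos|].
        rewrite E, Hw, EU by lra. rewrite <- (Rabs_pos_eq (abs_re_log _ _ _)) by apply Rabs_pos. apply HMb; lra.
    + apply (bigO_intro _ beta C t0 Hb); [lra|assumption|].
      intros t Ht. apply integral_mean_infty_le; [apply exp_pos|].
      intros theta Hth. rewrite EV by lra. now apply HV.
Qed.
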